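(* Any non-singular quadric $\mathscr{Q}\subset\mathbb{CP}^3$ containing no twistor lines yields two distinct well-defined orthogonal complex structures $J_1$ and $J_2$ on $S^4\setminus C$, where $C=S^1\times D^2$ is a solid torus. That is, there is an embedded solid torus $C\cong S^1\times D^2$ in $S^4$ such that $\mathscr{Q}\cap\pi^{-1}(S^4\setminus C)$ is the union of the graphs of two distinct orthogonal complex structures $J_1,J_2$ on $S^4\setminus C$.
   Context: Use coordinates $[\xi_0,\xi_{12},W_1,W_2]$ on $\mathbb{CP}^3$. The twistor projection $\pi:\mathbb{CP}^3\to\mathbb{HP}^1=S^4$ is $\pi([\xi_0,\xi_{12},W_1,W_2])=[\xi_0+j\xi_{12},\,W_1+jW_2]$ ($\mathbb{HP}^1$ defined by right quaternionic multiplication); $S^4=\mathbb{R}^4\cup\{\infty\}$ with $(z_1,z_2)\in\mathbb{C}^2=\mathbb{R}^4$ corresponding to $[1,z_1+jz_2]$. Twistor lines are the fibers of $\pi$; the one over $(z_1,z_2)$ is $\{W_1=\xi_0z_1-\xi_{12}\bar z_2,\ W_2=\xi_0z_2+\xi_{12}\bar z_1\}$, parametrized by $[\xi_0,\xi_{12}]\in\mathbb{CP}^1$, and the one over $\infty$ is $\{\xi_0=\xi_{12}=0\}$. An orthogonal complex structure (OCS) on an open subset of $S^4$ (round metric) is an integrable almost complex structure $J$ that is pointwise orthogonal and compatible with the orientation. The fiber $\pi^{-1}(p)$ parametrizes the orthogonal, orientation-compatible complex structures on $T_pS^4$: for $p=(z_1,z_2)\in\mathbb{R}^4$, the point with parameter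 $[\xi_0,\xi_{12}]$ corresponds to the $J$ whose space of $(1,0)$-forms is spanned by $\xi_0\,dz_1-\xi_{12}\,d\bar z_2$ and $\xi_0\,dz_2+\xi_{12}\,d\bar z_1$; at $\infty$ the correspondence is obtained from that at the origin by the inversion $q\mapsto q^{-1}$ of $S^4$, which lifts to $[\xi_0,\xi_{12},W_1,W_2]\mapsto[W_1,W_2,\xi_0,\xi_{12}]$. The graph of an OCS $J$ on $\Omega\subset S^4$ is the corresponding section of $\pi$ over $\Omega$, viewed as a subset of $\mathbb{CP}^3$. *)

(* Defs.v *)
From HB Require Import structures.
From mathcomp Require Import all_boot all_order all_algebra.
From mathcomp Require Import all_classical all_reals all_analysis.
From mathcomp Require Import complex.

Set Implicit Arguments.
Unset Strict Implicit.
Unset Printing Implicit Defensive.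

Import Order.TTheory GRing.Theory Num.Theory.
Import numFieldNormedType.Exports.

Local Open Scope classical_set_scope.
Local Open Scope complex_scope.
Local Open Scope ring_scope.

(** * Smooth functions on open subsets of R^4 *)

Section Smooth.
Variables (R : realType) (V : normedModType R).
Implicit Types (U : set 'rV[R]_4) (f : 'rV[R]_4 -> V).

Fixpoint of_class (k : nat) U f : Prop :=
  match k with
  | 0%N => forall x, U x -> {for x, continuous f}
  | k'.+1 => (forall x, U x -> differentiable f x) /\
             (forall v : 'rV[R]_4, of_class k' U (fun x => 'D_v f x))
  end.

(* Used for open [U] only. *)
Definition smooth_on U f := forall k, of_class k U f.

End Smooth.

(** * Quaternions and the four-sphere *)

Notation S4 R := (one_point_compactification 'rV[R]_4).

Section Sphere.
Variable R : realType.
Local Notation C := R[i].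
Local Notation R4 := 'rV[R]_4.

(* R^4 = C^2 = H: the row (Re z1, Im z1, Re z2, Im z2) is both the point
   (z1, z2) of C^2 and the quaternion z1 + j z2, where j a = (conjc a) j. *)
Definition z1 (q : R4) : C := q ord0 0 +i* q ord0 1.
Definition z2 (q : R4) : C := q ord0 2 +i* q ord0 3.

Definition quat (a b : C) : R4 :=
  \row_(k < 4) nth 0 [:: complex.Re a; complex.Im a; complex.Re b; complex.Im b] k.

Definition qmul (p q : R4) : R4 :=
  quat (z1 p * z1 q - conjc (z2 p) * z2 q) (conjc (z1 p) * z2 q + z2 p * z1 q).

Definition dot (u v : R4) : R := (u *m v^T) ord0 ord0.

(* The conjugate of z1 + j z2 is conjc z1 - j z2; note that [qinv 0 = 0]. *)
Definition qinv (q : R4) : R4 := (dot q q)^-1 *: quat (conjc (z1 q)) (- z2 q).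

Definition infty : S4 R := None.
Definition pt (q : R4) : S4 R := Some q.

Definition inversion (p : S4 R) : S4 R :=
  match p with
  | None => pt 0
  | Some q => if q == 0 then infty else pt (qinv q)
  end.

(* The smooth structure of S^4 is given by two charts: [chart false] is the
   inclusion of R^4 and [chart true] is its composition with the inversion. The
   inversion preserves both the orientation and the round metric, so both charts
   are positively oriented and the metric has the same expression in both. *)
Definition chart (b : bool) (x : R4) : S4 R := if b then inversion (pt x) else pt x.

Definition coord (b : bool) (p : S4 R) : R4 :=
  if (if b then inversion p else p) is Some q then q else 0.

(** * Embedded solid tori *)

(* S^1 x D^2 inside R^2 x R^2 = R^4, with closed disc D^2 *)
Definition solid_torus : set R4 :=
  [set x | (x ord0 0) ^+ 2 + (x ord0 1) ^+ 2 = 1 /\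
           (x ord0 2) ^+ 2 + (x ord0 3) ^+ 2 <= 1].

(* The tangent space at x of S^1 x R^2, the 3-manifold (without boundary)
   containing S^1 x D^2 *)
Definition solid_torus_tangent (x : R4) : set R4 :=
  [set v | x ord0 0 * v ord0 0 + x ord0 1 * v ord0 1 = 0].

Definition smooth_to_S4 (U : set R4) (f : R4 -> S4 R) :=
  (forall x, U x -> {for x, continuous f}) /\
  (forall b, smooth_on (U `&` f @^-1` range (chart b)) (coord b \o f)).

(* The image of a smooth embedding of the compact manifold S^1 x D^2, i.e. of an
   injective immersion; smoothness on this manifold with boundary means having a
   smooth extension to an open neighbourhood in R^4. *)
Definition embedded_solid_torus (T : set (S4 R)) :=
  exists (U : set R4) (f : R4 -> S4 R),
    [/\ open U /\ solid_torus `<=` U,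
        smooth_to_S4 U f,
        {in solid_torus &, injective f},
        (forall b x v, solid_torus x -> range (chart b) (f x) ->
           solid_torus_tangent x v -> 'D_v (coord b \o f) x = 0 -> v = 0) &
        T = f @` solid_torus].

(** * Orthogonal complex structures *)

Definition round_metric (x u v : R4) : R := 4 / (1 + dot x x) ^+ 2 * dot u v.

(* Endomorphisms of a tangent space R^4 are matrices acting on row vectors on
   the right, so the composition "first A, then B" is [A *m B]. *)
Definition vf_act (K : R4 -> 'M[R]_4) (X : R4 -> R4) : R4 -> R4 :=
  fun x => X x *m K x.

Definition lie_bracket (X Y : R4 -> R4) : R4 -> R4 :=
  fun x => 'D_(X x) Y x - 'D_(Y x) X x.

Definition nijenhuis (K : R4 -> 'M[R]_4) (X Y : R4 -> R4) (x : R4) : R4 :=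
  lie_bracket (vf_act K X) (vf_act K Y) x
  - vf_act K (lie_bracket (vf_act K X) Y) x
  - vf_act K (lie_bracket X (vf_act K Y)) x
  - lie_bracket X Y x.

Definition integrable_on (U : set R4) (K : R4 -> 'M[R]_4) :=
  forall X Y, smooth_on U X -> smooth_on U Y ->
  forall x, U x -> nijenhuis K X Y x = 0.

Definition rows4 (u1 u2 u3 u4 : R4) : 'M[R]_4 :=
  \matrix_(k < 4) nth 0 [:: u1; u2; u3; u4] k.

(* Every basis of the form u, Ju, v, Jv is positively oriented. *)
Definition orientation_compatible (K : 'M[R]_4) :=
  forall u v : R4, let B := rows4 u (u *m K) v (v *m K) in
  \det B != 0 -> 0 < \det B.

Definition OCS_in_chart (U : set R4) (K : R4 -> 'M[R]_4) :=
  [/\ smooth_on U K /\ (forall x, U x -> K x *m K x = - 1%:M),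
      integrable_on U K,
      (forall x, U x -> forall u v,
         round_metric x (u *m K x) (v *m K x) = round_metric x u v) &
      (forall x, U x -> orientation_compatible (K x))].

(* An endomorphism field J on a subset of S^4 is given by matrices [J p]; the
   tangent space at p is identified with R^4 by [chart false] if p is in R^4, and
   by [chart true] if p is infinity. Its expression in [chart true] is therefore
   obtained, away from infinity, by conjugating with the differential of the
   coordinate change [qinv] (an involution of R^4 minus the origin). *)
Definition in_chart (b : bool) (J : S4 R -> 'M[R]_4) (y : R4) : 'M[R]_4 :=
  if b then
    if y == 0 then J infty
    else jacobian qinv y *m J (pt (qinv y)) *m jacobian qinv (qinv y)
  else J (pt y).

Definition OCS (Omega : set (S4 R)) (J : S4 R -> 'M[R]_4) :=
  open Omega /\ forall b, OCS_in_chart (chart b @^-1` Omega) (in_chart b J).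

(** * Twistor space *)

(* Points of CP^3 are the lines of C^4, in coordinates (xi0, xi12, W1, W2). *)
Definition CP3 := {L : {vspace 'rV[C]_4} | \dim L == 1%N}.

Definition homog (L : CP3) : 'rV[C]_4 := vpick (sval L).

Definition xi0 (L : CP3) : C := homog L ord0 0.
Definition xi12 (L : CP3) : C := homog L ord0 1.
Definition W1 (L : CP3) : C := homog L ord0 2.
Definition W2 (L : CP3) : C := homog L ord0 3.

(* [q1, q2] = [1, q2 q1^-1] in HP^1, defined by right multiplication. *)
Definition twistor_proj (L : CP3) : S4 R :=
  let q1 := quat (xi0 L) (xi12 L) in
  let q2 := quat (W1 L) (W2 L) in
  if q1 == 0 then infty else pt (qmul q2 (qinv q1)).

Definition twistor_line (p : S4 R) : set CP3 := twistor_proj @^-1` [set p].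

Definition ii : C := 0 +i* 1.

(* Complex-valued real-linear forms on R^4 are columns: [alpha] maps the row v
   to v *m alpha. *)
Definition dz1 : 'cV[C]_4 := \col_(k < 4) nth 0 [:: 1; ii; 0; 0] k.
Definition dz1bar : 'cV[C]_4 := \col_(k < 4) nth 0 [:: 1; - ii; 0; 0] k.
Definition dz2 : 'cV[C]_4 := \col_(k < 4) nth 0 [:: 0; 0; 1; ii] k.
Definition dz2bar : 'cV[C]_4 := \col_(k < 4) nth 0 [:: 0; 0; 1; - ii] k.

(* alpha \o J = i alpha *)
Definition form10 (J : 'M[R]_4) : set 'cV[C]_4 :=
  [set alpha | map_mx (real_complex R) J *m alpha = ii *: alpha].

Definition has_parameter (J : 'M[R]_4) (a b : C) :=
  form10 J = [set alpha | exists c d : C,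
    alpha = c *: (a *: dz1 - b *: dz2bar) + d *: (a *: dz2 + b *: dz1bar)].

(* The point L of CP^3 corresponds to the structure J on the tangent space at
   [twistor_proj L]. Over infinity, that tangent space is read in [chart true]
   and the lift of the inversion exchanges (xi0, xi12) and (W1, W2). *)
Definition corresponds (L : CP3) (J : 'M[R]_4) :=
  if twistor_proj L is Some _ then has_parameter J (xi0 L) (xi12 L)
  else has_parameter J (W1 L) (W2 L).

Definition graph (Omega : set (S4 R)) (J : S4 R -> 'M[R]_4) : set CP3 :=
  [set L | Omega (twistor_proj L) /\ corresponds L (J (twistor_proj L))].

Definition quadric (A : 'M[C]_4) : set CP3 :=
  [set L | homog L *m A *m (homog L)^T = 0].

Definition nonsingular_quadric (Q : set CP3) :=
  exists A : 'M[C]_4, [/\ A^T = A, \det A != 0 & Q = quadric A].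

End Sphere.

(* Main.v *)
(* A quadric meets the twistor fibre over a point of S^4 in the zeros of a binary
   quadratic form. Where the discriminant of this form avoids (-oo, 0], its
   principal square root is smooth and separates the two zeros; each of them then
   defines a smooth structure, which is integrable because it is cut out by a
   holomorphic equation. Let T be the set where the discriminant lies in (-oo, 0].

   After multiplication by a scalar, the quadratic form is diagonal in a basis
   e, je, f, jf of C^4 = H^2, with coefficients l om, om / l, m om*, om* / m, where
   |om| = 1 and Re om <> 0 (this uses that no twistor line is contained in the
   quadric). The basis change is a Moebius transformation of S^4, and in the new
   coordinate w the discriminant is (P + iQ)^2 for P and Q in R^3 that are
   explicit in w. So T is given by P.Q = 0 and |P| <= |Q|: the directions of Q
   form a circle, and P / |Q| runs over a disc orthogonal to Q. *)

(* The cut depends on more than the quadric: multiplying the matrix by k multiplies the discriminant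
   by k^2, so the scalar fixed in the normal form selects which cut is used. The locus where the two
   zeros collide, given by P.Q = 0 and |P| = |Q|, is the same for every k.

   Re om <> 0 keeps w = 0 and w = infinity off the cut, so that one affine coordinate sees all of
   it, and lets the third coordinate of P determine 1 - |w|^2. The absence of twistor lines enters
   twice: it makes the diagonal coefficients nonzero, and for real om it excludes the degenerate
   values of l and m at which Q would vanish somewhere on the cut.

   Two parametrisations are needed. If Im om <> 0, the third coordinate of Q never vanishes, and the
   equation P.Q = 0 is solved by dividing by Im om. If Im om = 0, Q stays in a plane and P.Q = 0 no
   longer involves the third coordinate of P.

   That the parametrisations are embeddings is proved without computing a Jacobian: each has an
   explicit differentiable left inverse. *)
Require Import Defs.
From mathcomp Require Import all_boot all_order all_algebra.
From mathcomp Require Import all_classical all_reals all_analysis.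
From mathcomp Require Import complex ring lra.
Set Implicit Arguments.
Unset Strict Implicit.
Unset Printing Implicit Defensive.
Import Order.TTheory GRing.Theory Num.Theory.
Import numFieldNormedType.Exports.
Local Open Scope classical_set_scope.
Local Open Scope complex_scope.
Local Open Scope ring_scope.

(** * Smooth functions *)

(** The difference [g - f] vanishes near [x], so it has zero differential there; adding it to [f]
    transfers differentiability. *)
Lemma near_eq_differentiable (R : numFieldType) (V W : normedModType R)
    (f g : V -> W) (x : V) :
  (\near x, f x = g x) -> differentiable f x -> differentiable g x.
Proof.
move=> fg df.
have -> : g = f + (g - f) by rewrite addrC subrK.
apply: differentiableD => //.
have h0 : (g - f) \o shift x = cst ((g - f) x) + (0 : V -> W) +o_ 0 id.
  have -> : (g - f) x = 0 by rewrite !fctE (nbhs_singleton fg) subrr.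
  apply/eqaddoP => e e0 /=.
  rewrite addr0 subr0.
  have : \forall h \near (0 : V), f (h + x) = g (h + x).
    rewrite (near_shift x) sub0r; near=> z; rewrite /= subrK; near: z; exact: fg.
  by apply: filterS => h /= E; rewrite !fctE E subrr normr0 mulr_ge0 // ltW.
have d0 : 'd (g - f) x = 0 :> (V -> W).
  apply: diff_unique h0; exact: cst_continuous.
by apply/diff_locallyP; rewrite d0; split => //; exact: cst_continuous.
Unshelve. all: by end_near. Qed.

Section Calculus.
Variable R : realType.
Local Notation R4 := 'rV[R]_4.

Section GeneralTarget.
Variable V : normedModType R.
Implicit Types (U : set R4) (f g : R4 -> V).

Lemma of_classS k U f : of_class k.+1 U f -> of_class k U f.
Proof.
elim: k f => [|k IH] f [df Df]; first by move=> x Ux; exact/differentiable_continuous/df.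
by split=> // v; exact: IH.
Qed.

Lemma smooth_onE U f : smooth_on U f <->
  (forall x, U x -> differentiable f x) /\ (forall v, smooth_on U (fun x => 'D_v f x)).
Proof.
split=> [sf|[df Df] [|k]]; last by split=> // v; exact: Df.
  split=> [x Ux|v k]; first by have [df _] := sf 1%N; exact: df.
  by have [_ Df] := sf k.+1; exact: Df.
by move=> x Ux; exact/differentiable_continuous/df.
Qed.

(** [of_class] tests the globally defined [f] at each point of the set, never a restriction of it,
    so the class at a point can be read off from any [W] containing it. *)
Lemma of_class_local k U f :
  (forall x, U x -> exists W : set R4, W x /\ of_class k W f) -> of_class k U f.
Proof.
elim: k f => [|k IH] f H; first by move=> x /H[W [Wx]]; exact.
split=> [x /H[W [Wx [df _]]]|v]; first exact: df.
by apply: IH => x /H[W [Wx [_ Df]]]; exists W; split=> //; exact: Df.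
Qed.

Lemma of_class_sub k U W f : U `<=` W -> of_class k W f -> of_class k U f.
Proof. by move=> UW Wf; apply: of_class_local => x /UW Wx; exists W. Qed.

Lemma near_of_open U (P : R4 -> Prop) x : open U -> U x ->
  (forall y, U y -> P y) -> \near x, P x.
Proof. by move=> oU Ux UP; apply: filterS UP _; exact: open_nbhs_nbhs. Qed.

Lemma of_class_eq k U f g : open U -> (forall x, U x -> f x = g x) ->
  of_class k U f -> of_class k U g.
Proof.
move=> oU; elim: k f g => [|k IH] f g fg.
  move=> cf x Ux; suff : g @ x --> f x by rewrite (fg _ Ux).
  have fgx : \near x, f x = g x by exact: (near_of_open oU Ux fg).
  exact: cvg_trans (near_eq_cvg fgx) (cf x Ux).
case=> df Df; split=> [x Ux|v].
  by apply: near_eq_differentiable (df x Ux); exact: (near_of_open oU Ux fg).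
apply: IH (Df v) => x Ux; apply: near_eq_derive; exact: (near_of_open oU Ux fg).
Qed.

Lemma smooth_on_local U f :
  (forall x, U x -> exists W : set R4, W x /\ smooth_on W f) -> smooth_on U f.
Proof.
by move=> H k; apply: of_class_local => x /H[W [Wx sf]]; exists W; split => //; exact: sf.
Qed.

Lemma smooth_on_sub U W f : U `<=` W -> smooth_on W f -> smooth_on U f.
Proof. by move=> UW sf k; apply: of_class_sub UW (sf k). Qed.

Lemma smooth_on_eq U f g : open U -> (forall x, U x -> f x = g x) ->
  smooth_on U f -> smooth_on U g.
Proof. by move=> oU fg sf k; apply: of_class_eq oU fg (sf k). Qed.

Lemma smooth_on_differentiable U f x : smooth_on U f -> U x -> differentiable f x.
Proof. by move=> /smooth_onE[df _]; exact: df. Qed.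

Lemma of_class_cst k U (c : V) : of_class k U (cst c).
Proof.
elim: k c => [|k IH] c; first by move=> x _; exact: cst_continuous.
split=> [x _|v]; first exact: differentiable_cst.
rewrite (_ : (fun x => _) = cst 0) //; apply/funext => x.
by rewrite derive_cst.
Qed.

Lemma of_classD k U f g : open U ->
  of_class k U f -> of_class k U g -> of_class k U (f + g).
Proof.
move=> oU; elim: k f g => [|k IH] f g.
  by move=> cf cg x Ux; apply: continuousD; [exact: cf|exact: cg].
move=> [df Df] [dg Dg]; split=> [x Ux|v].
  by apply: differentiableD; [exact: df|exact: dg].
apply: (@of_class_eq _ _ ((fun x => 'D_v f x) + (fun x => 'D_v g x))) => //.
  by move=> x Ux; rewrite deriveD //; apply: diff_derivable; [exact: df|exact: dg].
by apply: IH; [exact: Df|exact: Dg].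
Qed.

End GeneralTarget.

Section RealTarget.
Implicit Types (U : set R4) (f g : R4 -> R^o).

Lemma of_classM k U f g : open U ->
  of_class k U f -> of_class k U g -> of_class k U (f * g).
Proof.
move=> oU; elim: k f g => [|k IH] f g.
  by move=> cf cg x Ux; apply: continuousM; [exact: cf|exact: cg].
move=> Hf Hg; case: (Hf) (Hg) => [df Df] [dg Dg]; split=> [x Ux|v].
  by apply: differentiableM; [exact: df|exact: dg].
apply: (@of_class_eq _ _ _ ((f * (fun x => 'D_v g x)) + (g * (fun x => 'D_v f x)))) => //.
  by move=> x Ux; rewrite deriveM //; apply: diff_derivable; [exact: df|exact: dg].
apply: of_classD => //; apply: IH => //; try exact: of_classS.
  exact: Dg.
exact: Df.
Qed.

Lemma of_classV k U f : open U -> (forall x, U x -> f x != 0) ->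
  of_class k U f -> of_class k U (fun x => (f x)^-1).
Proof.
move=> oU f0; elim: k => [|k IH].
  by move=> cf x Ux; apply: continuousV; [exact: f0|exact: cf].
move=> Hf; case: (Hf) => [df Df]; split=> [x Ux|v].
  by apply: differentiableV; [exact: df|exact: f0].
(* The derivative - f' / f^2 is written with the reciprocal of [f] as a factor, so the induction
   hypothesis at the lower class applies. *)
apply: (@of_class_eq _ _ _ (cst (-1) * ((fun x => (f x)^-1) * ((fun x => (f x)^-1) * (fun x => 'D_v f x))))) => //.
  move=> x Ux; rewrite deriveV //; [|exact: f0|by apply: diff_derivable; exact: df].
  by rewrite !fctE /= expr2 invfM mulN1r mulrA -mulNr.
apply: of_classM => //; first exact: of_class_cst.
have IHf := IH (of_classS Hf).
by apply: of_classM => //; apply: of_classM => //; exact: Df.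
Qed.

Lemma differentiable_sqrt f x : 0 < f x -> differentiable f x ->
  differentiable (fun y => Num.sqrt (f y) : R^o) x.
Proof.
move=> f0 df.
apply: (differentiable_comp df).
apply/derivable1_diffP.
by have [] := is_derive1_sqrt f0.
Qed.

(** Comes from differentiating [s * s = f] by the product rule, once [s] is known to be
    differentiable. *)
Lemma derive_sqrt_comp U f v x : open U -> (forall x, U x -> 0 < f x) ->
  (forall x, U x -> differentiable f x) -> U x ->
  'D_v (fun y => Num.sqrt (f y) : R^o) x = 2^-1 * ((Num.sqrt (f x))^-1 * 'D_v f x).
Proof.
move=> oU f0 df Ux.
set s := (fun y => Num.sqrt (f y) : R^o).
have ds : differentiable s x by apply: differentiable_sqrt; [exact: f0|exact: df].
have E : 'D_v f x = 'D_v (s * s) x.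
  apply: near_eq_derive; apply: (near_of_open oU Ux) => y Uy.
  by rewrite /s !fctE -expr2 sqr_sqrtr // ltW // f0.
have sx0 : s x != 0 by rewrite /s sqrtr_eq0 -ltNge f0.
rewrite E deriveM; [|exact: diff_derivable..].
rewrite -/(s x); set D := 'D_v s x; rewrite /GRing.scale /=.
by field.
Qed.

Lemma of_class_sqrt k U f : open U -> (forall x, U x -> 0 < f x) ->
  of_class k U f -> of_class k U (fun x => Num.sqrt (f x) : R^o).
Proof.
move=> oU f0; elim: k => [|k IH].
  move=> cf x Ux.
  exact: (continuous_comp (cf x Ux) (@sqrt_continuous _ _)).
move=> Hf; case: (Hf) => [df Df]; split=> [x Ux|v].
  by apply: differentiable_sqrt; [exact: f0|exact: df].
apply: (@of_class_eq _ _ _ (cst 2^-1 * ((fun x => (Num.sqrt (f x))^-1) * (fun x => 'D_v f x)))) => //.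
  by move=> x Ux; rewrite (derive_sqrt_comp _ oU).
apply: of_classM => //; first exact: of_class_cst.
apply: of_classM => //; last exact: Df.
apply: of_classV => //.
  by move=> x Ux; rewrite sqrtr_eq0 -ltNge f0.
exact: IH (of_classS Hf).
Qed.

Lemma smooth_cst U (c : R) : smooth_on U (fun _ => c : R^o).
Proof. by move=> k; exact: of_class_cst. Qed.

Lemma smoothD U f g : open U -> smooth_on U f -> smooth_on U g ->
  smooth_on U (fun x => f x + g x).
Proof. by move=> oU sf sg k; exact: of_classD. Qed.

Lemma smoothM U f g : open U -> smooth_on U f -> smooth_on U g ->
  smooth_on U (fun x => f x * g x).
Proof. by move=> oU sf sg k; exact: of_classM. Qed.

Lemma smoothN U f : open U -> smooth_on U f -> smooth_on U (fun x => - f x).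
Proof.
move=> oU sf; apply: (@smooth_on_eq _ _ (fun x => -1 * f x)) => //.
  by move=> x _; rewrite mulN1r.
by apply: smoothM => //; exact: smooth_cst.
Qed.

Lemma smoothB U f g : open U -> smooth_on U f -> smooth_on U g ->
  smooth_on U (fun x => f x - g x).
Proof. by move=> oU sf sg; apply: smoothD => //; exact: smoothN. Qed.

Lemma smoothV U f : open U -> (forall x, U x -> f x != 0) -> smooth_on U f ->
  smooth_on U (fun x => (f x)^-1).
Proof. by move=> oU f0 sf k; exact: of_classV. Qed.

Lemma smooth_sqrt U f : open U -> (forall x, U x -> 0 < f x) -> smooth_on U f ->
  smooth_on U (fun x => Num.sqrt (f x) : R^o).
Proof. by move=> oU f0 sf k; exact: of_class_sqrt. Qed.

Lemma derive_coord (x v : R4) i : 'D_v (fun x : R4 => x ord0 i : R^o) x = v ord0 i.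
Proof.
have /(derive_mx (v := v)) : derivable (@id R4) x v by exact: derivable_id.
by rewrite derive_id => /(congr1 (fun M : R4 => M ord0 i)); rewrite mxE => ->.
Qed.

Lemma smooth_coord U i : smooth_on U (fun x : R4 => x ord0 i : R^o).
Proof.
apply/smooth_onE; split=> [x _|v]; first exact: differentiable_coord.
rewrite (_ : (fun x => _) = fun=> v ord0 i); first exact: smooth_cst.
by apply/funext => x; exact: derive_coord.
Qed.

End RealTarget.

Section MatrixTarget.
Variables (m n : nat).
Implicit Types (U : set R4) (M : R4 -> 'M[R]_(m, n)).

Lemma of_classZl (V : normedModType R) k U (f : R4 -> R^o) (w : V) : open U -> of_class k U f ->
  of_class k U (fun x => f x *: w).
Proof.
move=> oU; elim: k f => [|k IH] f.
  by move=> cf x Ux; apply: continuousZr_tmp; exact: cf.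
move=> [df Df]; split=> [x Ux|v]; first by apply: differentiableZl; exact: df.
apply: (@of_class_eq _ _ _ (fun x => ('D_v f x) *: w)) => //.
  move=> x Ux; have dfx := df x Ux.
  by rewrite !deriveE ?diffZl //; exact: differentiableZl.
by apply: IH; exact: Df.
Qed.

Lemma smooth_mx U M : open U -> (forall i j, smooth_on U (fun x => M x i j : R^o)) ->
  smooth_on U M.
Proof.
move=> oU sM k.
apply: (@of_class_eq _ _ _ (\sum_i \sum_j fun x => M x i j *: delta_mx i j)) => //.
  move=> x _; rewrite [RHS]matrix_sum_delta fct_sumE; apply: eq_bigr => i _.
  by rewrite fct_sumE.
elim/big_ind: _ => [|f g|i _]; [exact: of_class_cst|exact: of_classD|].
elim/big_ind: _ => [|f g|j _]; [exact: of_class_cst|exact: of_classD|].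
by apply: of_classZl => //; exact: sM.
Qed.

Lemma differentiable_mx M x : (forall i j, differentiable (fun x => M x i j : R^o) x) ->
  differentiable M x.
Proof.
move=> dM.
rewrite (_ : M = \sum_i \sum_j fun x => M x i j *: delta_mx i j).
  elim/big_ind: _ => [|f g|i _]; [exact: differentiable_cst|exact: differentiableD|].
  elim/big_ind: _ => [|f g|j _]; [exact: differentiable_cst|exact: differentiableD|].
  exact: differentiableZl.
apply/funext => y; rewrite [LHS]matrix_sum_delta fct_sumE; apply: eq_bigr => i _.
by rewrite fct_sumE.
Qed.

Lemma derive_entry M x v i j : derivable M x v ->
  'D_v M x i j = 'D_v (fun x => M x i j : R^o) x.
Proof. by move=> /derive_mx ->; rewrite mxE. Qed.

Lemma differentiable_entry M x i j : differentiable M x ->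
  differentiable (fun x => M x i j : R^o) x.
Proof. by move=> dM; exact: (differentiable_comp dM (differentiable_coord _ _ _)). Qed.

End MatrixTarget.
End Calculus.

(** * Complex-valued functions and the principal square root *)

Section ComplexCalculus.
Variable R : realType.
Local Notation C := R[i].
Local Notation R4 := 'rV[R]_4.
Local Notation cRe := complex.Re.
Local Notation cIm := complex.Im.
Implicit Types (U : set R4) (F G : R4 -> C) (x v : R4).

(** Smoothness is over the reals, and [smooth_on] takes values in a normed module over [R]; hence
    the passage through real and imaginary parts. *)
Definition csmooth U F :=
  smooth_on U (fun x => cRe (F x) : R^o) /\ smooth_on U (fun x => cIm (F x) : R^o).

Definition cdiff F x :=
  differentiable (fun x => cRe (F x) : R^o) x /\ differentiable (fun x => cIm (F x) : R^o) x.

Definition cD v F x : C :=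
  'D_v (fun x => cRe (F x) : R^o) x +i* 'D_v (fun x => cIm (F x) : R^o) x.

Lemma cReD (a b : C) : cRe (a + b) = cRe a + cRe b. Proof. by case: a; case: b. Qed.
Lemma cImD (a b : C) : cIm (a + b) = cIm a + cIm b. Proof. by case: a; case: b. Qed.
Lemma cReN (a : C) : cRe (- a) = - cRe a. Proof. by case: a. Qed.
Lemma cImN (a : C) : cIm (- a) = - cIm a. Proof. by case: a. Qed.
Lemma cReM (a b : C) : cRe (a * b) = cRe a * cRe b - cIm a * cIm b.
Proof. by case: a; case: b. Qed.
Lemma cImM (a b : C) : cIm (a * b) = cRe a * cIm b + cIm a * cRe b.
Proof. by case: a => a a'; case: b => b b' /=; rewrite addrC. Qed.
Lemma cRe_conj (a : C) : cRe (conjc a) = cRe a. Proof. by case: a. Qed.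
Lemma cIm_conj (a : C) : cIm (conjc a) = - cIm a. Proof. by case: a. Qed.
Lemma complex_ext (a b : C) : cRe a = cRe b -> cIm a = cIm b -> a = b.
Proof. by case: a => a a'; case: b => b b' /= -> ->. Qed.

Lemma csmooth_cst U (c : C) : csmooth U (fun=> c).
Proof. by split; exact: smooth_cst. Qed.

Lemma csmooth_eq U F G : open U -> (forall x, U x -> F x = G x) -> csmooth U F -> csmooth U G.
Proof.
by move=> oU FG [s1 s2]; split; [move: s1|move: s2]; apply: smooth_on_eq => // x Ux; rewrite FG.
Qed.

Lemma csmoothD U F G : open U -> csmooth U F -> csmooth U G ->
  csmooth U (fun x => F x + G x).
Proof.
move=> oU [f1 f2] [g1 g2]; split.
  by apply: smooth_on_eq (smoothD oU f1 g1) => // x _; rewrite cReD.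
by apply: smooth_on_eq (smoothD oU f2 g2) => // x _; rewrite cImD.
Qed.

Lemma csmoothN U F : open U -> csmooth U F -> csmooth U (fun x => - F x).
Proof.
move=> oU [f1 f2]; split.
  by apply: smooth_on_eq (smoothN oU f1) => // x _; rewrite cReN.
by apply: smooth_on_eq (smoothN oU f2) => // x _; rewrite cImN.
Qed.

Lemma csmoothB U F G : open U -> csmooth U F -> csmooth U G ->
  csmooth U (fun x => F x - G x).
Proof. by move=> oU sF sG; apply: csmoothD => //; exact: csmoothN. Qed.

Lemma csmoothM U F G : open U -> csmooth U F -> csmooth U G ->
  csmooth U (fun x => F x * G x).
Proof.
move=> oU [f1 f2] [g1 g2]; split.
  apply: smooth_on_eq (smoothB oU (smoothM oU f1 g1) (smoothM oU f2 g2)) => // x _.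
  by rewrite cReM.
apply: smooth_on_eq (smoothD oU (smoothM oU f1 g2) (smoothM oU f2 g1)) => // x _.
by rewrite cImM.
Qed.

Lemma csmooth_conj U F : open U -> csmooth U F -> csmooth U (fun x => conjc (F x)).
Proof.
move=> oU [f1 f2]; split.
  by apply: smooth_on_eq f1 => // x _; rewrite cRe_conj.
by apply: smooth_on_eq (smoothN oU f2) => // x _; rewrite cIm_conj.
Qed.

Lemma csmooth_sum U n (F : 'I_n -> R4 -> C) : open U -> (forall i, csmooth U (F i)) ->
  csmooth U (fun x => \sum_i F i x).
Proof.
move=> oU sF.
apply: (@csmooth_eq _ (fun x => (\sum_(i <- index_enum 'I_n) F i) x)) => //.
  by move=> x _; rewrite fct_sumE.
elim: (index_enum _) => [|i s IH].
  by rewrite big_nil; exact: csmooth_cst.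
by rewrite big_cons; apply: csmoothD.
Qed.

Lemma near_eq_cD v F G x : (\near x, F x = G x) -> cD v F x = cD v G x.
Proof.
move=> FG; rewrite /cD; congr (_ +i* _); apply: near_eq_derive.
  by apply: filterS FG => y ->.
by apply: filterS FG => y ->.
Qed.

Lemma cD_cst v (c : C) x : cD v (fun=> c) x = 0.
Proof. by rewrite /cD !derive_cst. Qed.

Lemma cDD v F G x : cdiff F x -> cdiff G x ->
  cD v (fun x => F x + G x) x = cD v F x + cD v G x.
Proof.
move=> [f1 f2] [g1 g2].
rewrite /cD /= (_ : (fun x => cRe (F x + G x)) = (fun x => cRe (F x)) + (fun x => cRe (G x))).
  rewrite (_ : (fun x => cIm (F x + G x)) = (fun x => cIm (F x)) + (fun x => cIm (G x))).
    by rewrite !deriveD //; exact: diff_derivable.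
  by apply/funext => y; rewrite cImD.
by apply/funext => y; rewrite cReD.
Qed.

(** The two combinations are the real and imaginary parts of a product of complex functions; this
    reduces the complex product rule to the real one. *)
Lemma derive_mulM v x (f1 g1 f2 g2 : R4 -> R^o) :
  differentiable f1 x -> differentiable g1 x -> differentiable f2 x -> differentiable g2 x ->
  'D_v (f1 * g1 - f2 * g2) x =
    'D_v f1 x * g1 x + f1 x * 'D_v g1 x - ('D_v f2 x * g2 x + f2 x * 'D_v g2 x) /\
  'D_v (f1 * g1 + f2 * g2) x =
    'D_v f1 x * g1 x + f1 x * 'D_v g1 x + ('D_v f2 x * g2 x + f2 x * 'D_v g2 x).
Proof.
move=> d1 e1 d2 e2.
have [df1 df2] := (@diff_derivable _ _ _ _ _ v d1, @diff_derivable _ _ _ _ _ v d2).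
have [dg1 dg2] := (@diff_derivable _ _ _ _ _ v e1, @diff_derivable _ _ _ _ _ v e2).
have E (f g : R4 -> R^o) : derivable f x v -> derivable g x v ->
    'D_v (f * g) x = 'D_v f x * g x + f x * 'D_v g x.
  by move=> df dg; rewrite (deriveM df dg) addrC; congr (_ + _); exact: mulrC.
have [m1 m2] := (derivableM df1 dg1, derivableM df2 dg2).
by rewrite (deriveB m1 m2) (deriveD m1 m2) (E _ _ df1 dg1) (E _ _ df2 dg2).
Qed.

Lemma cDM v F G x : cdiff F x -> cdiff G x ->
  cD v (fun x => F x * G x) x = cD v F x * G x + F x * cD v G x.
Proof.
move=> [f1 f2] [g1 g2]; have [E1 _] := derive_mulM v f1 g1 f2 g2.
have [_ E2] := derive_mulM v f1 g2 f2 g1.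
rewrite {1}/cD.
have -> : (fun x => cRe (F x * G x)) = ((fun x => cRe (F x)) : R4 -> R^o) * (fun x => cRe (G x))
     - ((fun x => cIm (F x)) : R4 -> R^o) * (fun x => cIm (G x)).
  by apply/funext => y; rewrite cReM.
have -> : (fun x => cIm (F x * G x)) = ((fun x => cRe (F x)) : R4 -> R^o) * (fun x => cIm (G x))
     + ((fun x => cIm (F x)) : R4 -> R^o) * (fun x => cRe (G x)).
  by apply/funext => y; rewrite cImM.
rewrite E1 E2 /cD; move: ('D_v _ x) ('D_v _ x) ('D_v _ x) ('D_v _ x) => a b c d.
by apply: complex_ext; rewrite ?cReD ?cImD !(cReM, cImM) /=; ring.
Qed.

Lemma cdiff_cst (c : C) x : cdiff (fun=> c) x.
Proof. by split; exact: differentiable_cst. Qed.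

Lemma cdiffD F G x : cdiff F x -> cdiff G x -> cdiff (fun x => F x + G x) x.
Proof.
move=> [f1 f2] [g1 g2]; split.
  rewrite (_ : (fun x => _) = (fun x => cRe (F x)) + (fun x => cRe (G x))).
    exact: differentiableD.
  by apply/funext => y; rewrite cReD.
rewrite (_ : (fun x => _) = (fun x => cIm (F x)) + (fun x => cIm (G x))).
  exact: differentiableD.
by apply/funext => y; rewrite cImD.
Qed.

Lemma cdiffM F G x : cdiff F x -> cdiff G x -> cdiff (fun x => F x * G x) x.
Proof.
move=> [f1 f2] [g1 g2]; split.
  rewrite (_ : (fun x => _) = (fun x => cRe (F x)) * (fun x => cRe (G x))
     - (fun x => cIm (F x)) * (fun x => cIm (G x))).
    by apply: differentiableB; exact: differentiableM.
  by apply/funext => y; rewrite cReM.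
rewrite (_ : (fun x => _) = (fun x => cRe (F x)) * (fun x => cIm (G x))
     + (fun x => cIm (F x)) * (fun x => cRe (G x))).
  by apply: differentiableD; exact: differentiableM.
by apply/funext => y; rewrite cImM.
Qed.

Lemma cD_sum v n (F : 'I_n -> R4 -> C) x : (forall i, cdiff (F i) x) ->
  cD v (fun x => \sum_i F i x) x = \sum_i cD v (F i) x /\
  cdiff (fun x => \sum_i F i x) x.
Proof.
move=> dF.
have -> : (fun x => \sum_i F i x) = \sum_(i <- index_enum 'I_n) F i.
  by apply/funext => y; rewrite fct_sumE.
elim: (index_enum _) => [|i s [IH1 IH2]].
  by rewrite !big_nil; split; [exact: cD_cst|exact: cdiff_cst].
by rewrite !big_cons; split; [rewrite cDD // IH1|exact: cdiffD].
Qed.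

(** The plane cut along (-oo, 0]. The point 0 belongs to the cut, so a value off it has two distinct
    square roots. *)
Definition slit (z : C) : bool := (cIm z != 0) || (0 < cRe z).

Lemma slit_sqr (z : C) : cRe z != 0 -> slit (z * z).
Proof.
rewrite /slit cReM cImM; move: (cRe z) (cIm z) => x y x0.
have [->|y0] := eqVneq y 0; apply/orP; [right|left].
  by rewrite mulr0 subr0 -expr2 exprn_even_gt0.
rewrite (_ : _ + _ = 2 * x * y); last by ring.
by rewrite !mulf_neq0 // pnatr_eq0.
Qed.

(** The principal root in real terms, with real part sqrt((|z| + Re z) / 2). Off the cut both
    radicands are positive, so smoothness reduces to that of real square roots. *)
Definition csqrt (z : C) : C :=
  let p := Num.sqrt ((Num.sqrt (cRe z ^+ 2 + cIm z ^+ 2) + cRe z) / 2) in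
  p +i* (cIm z / (2 * p)).

Lemma slit_gt0 z : slit z -> 0 < cRe z ^+ 2 + cIm z ^+ 2 /\
  0 < (Num.sqrt (cRe z ^+ 2 + cIm z ^+ 2) + cRe z) / 2.
Proof.
case: z => a b; rewrite /slit /= => H.
have s0 : 0 <= Num.sqrt (a ^+ 2 + b ^+ 2) by exact: sqrtr_ge0.
have ab0 : 0 < a ^+ 2 + b ^+ 2.
  case/orP: H => [b0|a0].
    by rewrite ltr_wpDl ?sqr_ge0 // exprn_even_gt0.
  by rewrite ltr_pwDl ?sqr_ge0 // exprn_gt0.
split => //; apply: divr_gt0 => //.
have [a0|a0] := ltP 0 a; first by rewrite ltr_wpDl.
have b0 : b != 0 by case/orP: H => //; rewrite ltNge a0.
(* Here Re z <= 0, and Im z <> 0 makes |Re z| strictly smaller than |z|. *)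
rewrite -(opprK a) subr_gt0 opprK -[ltLHS]ger0_norm ?oppr_ge0 // -sqrtr_sqr ltr_sqrt //.
by rewrite sqrrN ltrDl exprn_even_gt0.
Qed.

Lemma csqrt_sqr z : slit z -> csqrt z * csqrt z = z.
Proof.
move=> /slit_gt0; case: z => a b /= [N0 P0].
set s := Num.sqrt _ in P0 *; set p := Num.sqrt ((s + a) / 2).
have ss : s * s = a ^+ 2 + b ^+ 2 by rewrite -expr2 sqr_sqrtr // ltW.
have pp : p * p = (s + a) / 2 by rewrite -expr2 sqr_sqrtr // ltW.
have p0 : p != 0 by rewrite sqrtr_eq0 -ltNge.
have sa0 : s + a != 0 by apply: contraTneq P0 => ->; rewrite mul0r ltxx.
apply: complex_ext; rewrite ?cReM ?cImM /=.
  have -> : b / (2 * p) * (b / (2 * p)) = b ^+ 2 / (2 * (s + a)).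
    have -> : 2 * (s + a) = 4 * (p * p) by rewrite pp; field.
    by field.
  by rewrite pp (_ : b ^+ 2 = s * s - a ^+ 2); [field|rewrite ss; ring].
by field.
Qed.

Lemma csqrt_Re_gt0 z : slit z -> 0 < cRe (csqrt z).
Proof. by move=> /slit_gt0 [_ P0]; rewrite /= sqrtr_gt0. Qed.

Lemma csqrt_unique z w : slit z -> w * w = z -> 0 < cRe w -> w = csqrt z.
Proof.
move=> sz wz w0; have s0 := csqrt_Re_gt0 sz; have ss := csqrt_sqr sz.
have /eqP : (w - csqrt z) * (w + csqrt z) = 0.
  by rewrite (_ : _ * _ = w * w - csqrt z * csqrt z); [rewrite wz ss subrr|ring].
rewrite mulf_eq0 subr_eq0 => /orP[/eqP //|/eqP /(congr1 (@cRe R))].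
by rewrite cReD /= => E; move: (addr_gt0 w0 s0); rewrite E ltxx.
Qed.

Lemma slit_scale (k : R) z : 0 < k -> slit (real_complex R k * z) = slit z.
Proof.
move=> k0; case: z => a b; rewrite /slit /= !mul0r subr0 addr0 mulf_eq0 gt_eqF //=.
by rewrite pmulr_rgt0.
Qed.

(** Lets the choice of root survive a change of chart, which multiplies the discriminant by a
    positive square. *)
Lemma csqrt_scale (k : R) z : 0 < k -> slit z ->
  csqrt (real_complex R (k ^+ 2) * z) = real_complex R k * csqrt z.
Proof.
move=> k0 sz; apply/esym/csqrt_unique; first by rewrite slit_scale ?exprn_gt0.
  by rewrite mulrACA csqrt_sqr // rmorphXn expr2.
by rewrite /= mul0r subr0 mulr_gt0 // csqrt_Re_gt0.
Qed.

Lemma csmooth_csqrt U F : open U -> (forall x, U x -> slit (F x)) -> csmooth U F ->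
  csmooth U (fun x => csqrt (F x)).
Proof.
move=> oU sl [f1 f2].
have s1 : smooth_on U (fun x => cRe (F x) ^+ 2 + cIm (F x) ^+ 2 : R^o).
  exact: (smoothD oU (smoothM oU f1 f1) (smoothM oU f2 f2)).
have s2 : smooth_on U (fun x => Num.sqrt
    ((Num.sqrt (cRe (F x) ^+ 2 + cIm (F x) ^+ 2) + cRe (F x)) / 2) : R^o).
  apply: smooth_sqrt => //; first by move=> x /sl /slit_gt0 [].
  apply: smoothM => //; last exact: smooth_cst.
  apply: smoothD => //; apply: smooth_sqrt => //.
  by move=> x /sl /slit_gt0 [].
split => //=; apply: smoothM => //; apply: smoothV => //.
  move=> x /sl /slit_gt0 [_ P0].
  by rewrite mulf_neq0 // ?pnatr_eq0 // sqrtr_eq0 -ltNge.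
by apply: smoothM => //; exact: smooth_cst.
Qed.

End ComplexCalculus.

(** * Quaternions *)

Section Quaternions.
Variable R : realType.
Local Notation C := R[i].
Local Notation R4 := 'rV[R]_4.
Implicit Types (p q r u w h n x y : R4) (a b c : C).

Lemma forall_ord4 (P : 'I_4 -> Prop) : P 0 -> P 1 -> P 2 -> P 3 -> forall i, P i.
Proof.
move=> P0 P1 P2 P3 [[|[|[|[|//]]]] Hi].
- by rewrite (_ : Ordinal Hi = 0) //; apply/val_inj.
- by rewrite (_ : Ordinal Hi = 1) //; apply/val_inj.
- by rewrite (_ : Ordinal Hi = 2) //; apply/val_inj.
- by rewrite (_ : Ordinal Hi = 3) //; apply/val_inj.
Qed.

Lemma sum_ord4 (V : nmodType) (F : 'I_4 -> V) : \sum_i F i = F 0 + F 1 + F 2 + F 3.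
Proof.
rewrite !big_ord_recl big_ord0 addr0 !addrA.
by congr (F _ + F _ + F _ + F _); apply/val_inj.
Qed.

Lemma row4_ext (T : Type) (p q : 'rV[T]_4) : p ord0 0 = q ord0 0 -> p ord0 1 = q ord0 1 ->
  p ord0 2 = q ord0 2 -> p ord0 3 = q ord0 3 -> p = q.
Proof.
move=> e0 e1 e2 e3; apply/rowP => i; move: i.
exact: (@forall_ord4 (fun i => p ord0 i = q ord0 i)).
Qed.

Lemma quatE a b : (quat a b ord0 0 = complex.Re a) * (quat a b ord0 1 = complex.Im a) *
  (quat a b ord0 2 = complex.Re b) * (quat a b ord0 3 = complex.Im b).
Proof. by rewrite !mxE. Qed.

Lemma z1_quat a b : z1 (quat a b) = a.
Proof. by case: a => a a'; rewrite /z1 !quatE. Qed.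
Lemma z2_quat a b : z2 (quat a b) = b.
Proof. by case: b => b b'; rewrite /z2 !quatE. Qed.
Lemma quatK q : quat (z1 q) (z2 q) = q.
Proof. by apply: row4_ext; rewrite quatE. Qed.
Lemma quat_ext p q : z1 p = z1 q -> z2 p = z2 q -> p = q.
Proof. by move=> e1 e2; rewrite -(quatK p) -(quatK q) e1 e2. Qed.

Lemma z1D p q : z1 (p + q) = z1 p + z1 q. Proof. by rewrite /z1 !mxE. Qed.
Lemma z2D p q : z2 (p + q) = z2 p + z2 q. Proof. by rewrite /z2 !mxE. Qed.
Lemma z1N p : z1 (- p) = - z1 p. Proof. by rewrite /z1 !mxE. Qed.
Lemma z2N p : z2 (- p) = - z2 p. Proof. by rewrite /z2 !mxE. Qed.
Lemma z1Z (k : R) p : z1 (k *: p) = real_complex R k * z1 p.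
Proof. by apply: complex_ext; rewrite ?cReM ?cImM /= !mxE !mul0r ?subr0 ?addr0. Qed.
Lemma z2Z (k : R) p : z2 (k *: p) = real_complex R k * z2 p.
Proof. by apply: complex_ext; rewrite ?cReM ?cImM /= !mxE !mul0r ?subr0 ?addr0. Qed.
Lemma z1_0 : z1 (0 : R4) = 0. Proof. by rewrite /z1 !mxE. Qed.
Lemma z2_0 : z2 (0 : R4) = 0. Proof. by rewrite /z2 !mxE. Qed.

Lemma z1_qmul p q : z1 (qmul p q) = z1 p * z1 q - conjc (z2 p) * z2 q.
Proof. exact: z1_quat. Qed.
Lemma z2_qmul p q : z2 (qmul p q) = conjc (z1 p) * z2 q + z2 p * z1 q.
Proof. exact: z2_quat. Qed.

Lemma qmulE p q :
  (qmul p q ord0 0 = p ord0 0 * q ord0 0 - p ord0 1 * q ord0 1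
                   - p ord0 2 * q ord0 2 - p ord0 3 * q ord0 3) *
  (qmul p q ord0 1 = p ord0 0 * q ord0 1 + p ord0 1 * q ord0 0
                   - p ord0 2 * q ord0 3 + p ord0 3 * q ord0 2) *
  (qmul p q ord0 2 = p ord0 0 * q ord0 2 + p ord0 1 * q ord0 3
                   + p ord0 2 * q ord0 0 - p ord0 3 * q ord0 1) *
  (qmul p q ord0 3 = p ord0 0 * q ord0 3 - p ord0 1 * q ord0 2
                   + p ord0 2 * q ord0 1 + p ord0 3 * q ord0 0).
Proof.
rewrite /qmul !quatE /z1 /z2 !(cReD, cReN, cReM, cImD, cImN, cImM) /=.
by do ![split]; ring.
Qed.

Lemma qmulA p q r : qmul p (qmul q r) = qmul (qmul p q) r.
Proof. by apply: row4_ext; rewrite !qmulE; ring. Qed.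

Lemma qmulDl p q r : qmul (p + q) r = qmul p r + qmul q r.
Proof. by apply: row4_ext; rewrite !(qmulE, mxE); ring. Qed.
Lemma qmulDr p q r : qmul p (q + r) = qmul p q + qmul p r.
Proof. by apply: row4_ext; rewrite !(qmulE, mxE); ring. Qed.
Lemma qmulZl (k : R) p q : qmul (k *: p) q = k *: qmul p q.
Proof. by apply: row4_ext; rewrite !(qmulE, mxE); ring. Qed.
Lemma qmulZr (k : R) p q : qmul p (k *: q) = k *: qmul p q.
Proof. by apply: row4_ext; rewrite !(qmulE, mxE); ring. Qed.
Lemma qmulNl p q : qmul (- p) q = - qmul p q.
Proof. by rewrite -scaleN1r qmulZl scaleN1r. Qed.
Lemma qmulNr p q : qmul p (- q) = - qmul p q.
Proof. by rewrite -scaleN1r qmulZr scaleN1r. Qed.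
Lemma qmul0l q : qmul 0 q = 0.
Proof. by have := qmulZl 0 0 q; rewrite !scale0r. Qed.
Lemma qmul0r q : qmul q 0 = 0.
Proof. by have := qmulZr 0 q 0; rewrite !scale0r. Qed.

Definition qone : R4 := quat 1 0.
Definition qi : R4 := quat (ii R) 0.
Definition qj : R4 := quat 0 1.
Definition qconj q : R4 := quat (conjc (z1 q)) (- z2 q).

Lemma qmul1l q : qmul qone q = q.
Proof. apply: row4_ext; rewrite !qmulE !quatE /=; ring. Qed.
Lemma qmul1r q : qmul q qone = q.
Proof. by apply: row4_ext; rewrite !qmulE !quatE /=; ring. Qed.

Lemma dotE p q : dot p q = p ord0 0 * q ord0 0 + p ord0 1 * q ord0 1
                         + p ord0 2 * q ord0 2 + p ord0 3 * q ord0 3.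
Proof. by rewrite /dot mxE sum_ord4 !mxE. Qed.

Lemma dot_ge0 q : 0 <= dot q q.
Proof. by rewrite dotE -!expr2 !addr_ge0 ?sqr_ge0. Qed.

Lemma dot_eq0 q : (dot q q == 0) = (q == 0).
Proof.
apply/eqP/eqP => [|->]; last by rewrite dotE !mxE !mul0r !addr0.
rewrite dotE -!expr2 => E.
have [h0 h1 h2 h3] : [/\ 0 <= q ord0 0 ^+ 2, 0 <= q ord0 1 ^+ 2, 0 <= q ord0 2 ^+ 2 & 0 <= q ord0 3 ^+ 2].
  by rewrite !sqr_ge0.
apply: row4_ext; rewrite mxE; apply/eqP; rewrite -sqrf_eq0; apply/eqP; lra.
Qed.

Lemma dot_gt0 q : q != 0 -> 0 < dot q q.
Proof. by move=> q0; rewrite lt0r dot_eq0 q0 dot_ge0. Qed.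

Lemma dot_qmul p q : dot (qmul p q) (qmul p q) = dot p p * dot q q.
Proof. by rewrite !dotE !qmulE; ring. Qed.

Lemma qmul_eq0 p q : (qmul p q == 0) = (p == 0) || (q == 0).
Proof. by rewrite -!dot_eq0 dot_qmul mulf_eq0. Qed.

Lemma qconjE q : (qconj q ord0 0 = q ord0 0) * (qconj q ord0 1 = - q ord0 1) *
  (qconj q ord0 2 = - q ord0 2) * (qconj q ord0 3 = - q ord0 3).
Proof. by rewrite !quatE /=. Qed.

Lemma qmul_conj q : qmul q (qconj q) = dot q q *: qone.
Proof. by apply: row4_ext; rewrite !(qmulE, dotE, mxE) ?qconjE ?quatE /=; ring. Qed.
Lemma qconj_mul q : qmul (qconj q) q = dot q q *: qone.
Proof. by apply: row4_ext; rewrite !(qmulE, dotE, mxE) ?qconjE ?quatE /=; ring. Qed.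

Lemma qinvE q : qinv q = (dot q q)^-1 *: qconj q. Proof. by []. Qed.

Lemma qmulV q : q != 0 -> qmul q (qinv q) = qone.
Proof.
by move=> q0; rewrite qinvE qmulZr qmul_conj scalerA mulVf ?scale1r // dot_eq0.
Qed.
Lemma qmulVl q : q != 0 -> qmul (qinv q) q = qone.
Proof.
by move=> q0; rewrite qinvE qmulZl qconj_mul scalerA mulVf ?scale1r // dot_eq0.
Qed.

Lemma qinv_neq0 q : q != 0 -> qinv q != 0.
Proof.
move=> q0; apply/eqP => E; have := qmulV q0.
rewrite E qmul0r => /(congr1 (fun p : R4 => p ord0 0)); rewrite !mxE /= => /eqP.
by rewrite eq_sym oner_eq0.
Qed.

Lemma qmulKl q p : q != 0 -> qmul (qinv q) (qmul q p) = p.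
Proof. by move=> q0; rewrite qmulA qmulVl // qmul1l. Qed.
Lemma qmulKr q p : q != 0 -> qmul (qmul p q) (qinv q) = p.
Proof. by move=> q0; rewrite -qmulA qmulV // qmul1r. Qed.
Lemma qmulVKl q p : q != 0 -> qmul q (qmul (qinv q) p) = p.
Proof. by move=> q0; rewrite qmulA qmulV // qmul1l. Qed.
Lemma qmulVKr q p : q != 0 -> qmul (qmul p (qinv q)) q = p.
Proof. by move=> q0; rewrite -qmulA qmulVl // qmul1r. Qed.

Lemma qmul_injr q p p' : q != 0 -> qmul p q = qmul p' q -> p = p'.
Proof. by move=> q0 E; rewrite -(qmulKr p q0) E qmulKr. Qed.

Lemma qinv0 : qinv (0 : R4) = 0.
Proof. by rewrite qinvE dotE !mxE !mul0r !addr0 invr0 scale0r. Qed.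

Lemma qinvK q : qinv (qinv q) = q.
Proof.
have [->|q0] := eqVneq q 0; first by rewrite !qinv0.
by apply: (@qmul_injr (qinv q)); rewrite ?qinv_neq0 // qmulVl ?qinv_neq0 // qmulV.
Qed.

Lemma qinvM p q : p != 0 -> q != 0 -> qinv (qmul p q) = qmul (qinv q) (qinv p).
Proof.
move=> p0 q0; have pq0 : qmul p q != 0 by rewrite qmul_eq0 negb_or p0.
apply: (@qmul_injr (qmul p q)) => //.
by rewrite qmulVl // -qmulA qmulKl // qmulVl.
Qed.

(** All complex structures below are right multiplications by unit imaginary quaternions; left
    multiplications would induce the opposite orientation. *)
Definition Rmat n : 'M[R]_4 := \matrix_(i, j) qmul (delta_mx ord0 i) n ord0 j.

Lemma RmatE n i j : Rmat n i j = qmul (delta_mx ord0 i) n ord0 j.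
Proof. by rewrite mxE. Qed.

Lemma mul_Rmat h n : h *m Rmat n = qmul h n.
Proof.
apply: row4_ext; rewrite mxE sum_ord4 !RmatE !qmulE !mxE /=; ring.
Qed.

Lemma mx4_ext (A B : 'M[R]_4) : (forall h, h *m A = h *m B) -> A = B.
Proof. by move=> H; apply/row_matrixP => i; rewrite !rowE. Qed.

Lemma RmatM p q : Rmat (qmul p q) = Rmat p *m Rmat q.
Proof. by apply: mx4_ext => h; rewrite mulmxA !mul_Rmat qmulA. Qed.
Lemma RmatZ (k : R) q : Rmat (k *: q) = k *: Rmat q.
Proof. by apply: mx4_ext => h; rewrite -scalemxAr !mul_Rmat qmulZr. Qed.
Lemma Rmat1 : Rmat qone = 1%:M.
Proof. by apply: mx4_ext => h; rewrite mul_Rmat qmul1r mulmx1. Qed.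
Lemma Rmat_inj : injective Rmat.
Proof. by move=> p q E; rewrite -(qmul1l p) -(qmul1l q) -!mul_Rmat E. Qed.

Definition im_unit n := n ord0 0 = 0 /\ dot n n = 1.

Lemma im_unit_sqr n : im_unit n -> Rmat n *m Rmat n = - 1%:M.
Proof.
move=> [n0 n1]; rewrite -RmatM -Rmat1 -scaleN1r -RmatZ; congr Rmat.
rewrite -n1; apply: row4_ext; rewrite !(qmulE, dotE, mxE) /= n0; ring.
Qed.

Lemma im_unit_orthogonal n u w : im_unit n -> dot (u *m Rmat n) (w *m Rmat n) = dot u w.
Proof.
move=> [n0 n1]; rewrite !mul_Rmat -[RHS]mulr1 -n1 !dotE !qmulE n0; ring.
Qed.

Lemma det4 (A : 'M[R]_4) : \det A =
  A 0 0 * (A 1 1 * (A 2 2 * A 3 3 - A 2 3 * A 3 2) - A 1 2 * (A 2 1 * A 3 3 - A 2 3 * A 3 1)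
           + A 1 3 * (A 2 1 * A 3 2 - A 2 2 * A 3 1))
- A 0 1 * (A 1 0 * (A 2 2 * A 3 3 - A 2 3 * A 3 2) - A 1 2 * (A 2 0 * A 3 3 - A 2 3 * A 3 0)
           + A 1 3 * (A 2 0 * A 3 2 - A 2 2 * A 3 0))
+ A 0 2 * (A 1 0 * (A 2 1 * A 3 3 - A 2 3 * A 3 1) - A 1 1 * (A 2 0 * A 3 3 - A 2 3 * A 3 0)
           + A 1 3 * (A 2 0 * A 3 1 - A 2 1 * A 3 0))
- A 0 3 * (A 1 0 * (A 2 1 * A 3 2 - A 2 2 * A 3 1) - A 1 1 * (A 2 0 * A 3 2 - A 2 2 * A 3 0)
           + A 1 2 * (A 2 0 * A 3 1 - A 2 1 * A 3 0)).
Proof.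
(* Entries are indexed by natural numbers so that, after the cofactor expansion, equal entries are
   syntactically equal for [ring]. *)
pose f (a b : nat) := A (inord a) (inord b).
have Af i j : A i j = f i j by rewrite /f !inord_val.
rewrite !Af /=.
have -> : A = \matrix_(i, j) f i j by apply/matrixP => i j; rewrite mxE Af.
rewrite (expand_det_row _ ord0) !big_ord_recl big_ord0 /cofactor.
rewrite !(expand_det_row _ (ord0 : 'I_3)) !big_ord_recl !big_ord0 /cofactor.
rewrite !(expand_det_row _ (ord0 : 'I_2)) !big_ord_recl !big_ord0 /cofactor.
rewrite !det_mx11 !mxE /=.
rewrite /bump /=.
ring.
Qed.

Lemma rows4E u1 u2 u3 u4 j : (rows4 u1 u2 u3 u4 0 j = u1 ord0 j) * (rows4 u1 u2 u3 u4 1 j = u2 ord0 j) *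
  (rows4 u1 u2 u3 u4 2 j = u3 ord0 j) * (rows4 u1 u2 u3 u4 3 j = u4 ord0 j).
Proof. by rewrite !mxE; do ![split]; congr (_ _ _); apply/val_inj. Qed.

(* The determinant of u, un, v, vn is |n x (a1, a2, a3)|^2 where a1, a2, a3 are
   the components of the imaginary part of the quaternion ubar v. *)
Lemma im_unit_orientation n : im_unit n -> orientation_compatible (Rmat n).
Proof.
move=> [n0 n1] u w /=; set B := rows4 _ _ _ _ => B0; rewrite lt0r B0 /=.
pose a := qmul (qconj u) w.
have -> : \det B = (n ord0 2 * a ord0 3 - n ord0 3 * a ord0 2) ^+ 2
                + (n ord0 3 * a ord0 1 - n ord0 1 * a ord0 3) ^+ 2
                + (n ord0 1 * a ord0 2 - n ord0 2 * a ord0 1) ^+ 2.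
  rewrite det4 !rows4E !mul_Rmat /a !(qmulE, qconjE) n0.
  ring.
by rewrite !addr_ge0 ?sqr_ge0.
Qed.

End Quaternions.

(** * Orthogonal complex structures defined by a parameter function *)

Section Hopf.
Variable R : realType.
Local Notation C := R[i].
Local Notation R4 := 'rV[R]_4.
Implicit Types (p q r u v w h n m x y : R4) (a b c d : C).
Local Notation qi := (qi R).
Local Notation qone := (qone R).
Local Notation qj := (qj R).

(** The Hopf map. It is constant on the complex lines u C, so it identifies a twistor fibre CP^1
    with the sphere of unit imaginary quaternions. *)
Definition hopf u : R4 := qmul (qmul u qi) (qinv u).

Lemma ii_sqr : ii R * ii R = -1.
Proof. by apply: complex_ext; rewrite ?cReM ?cImM ?cReN ?cImN /=; ring. Qed.
Lemma conj_ii : conjc (ii R) = - ii R.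
Proof. by apply: complex_ext; rewrite ?cReN ?cImN /= ?oppr0. Qed.
Lemma conjD a b : conjc (a + b) = conjc a + conjc b. Proof. exact: rmorphD. Qed.
Lemma conjM a b : conjc (a * b) = conjc a * conjc b. Proof. exact: rmorphM. Qed.
Lemma conjN a : conjc (- a) = - conjc a. Proof. exact: rmorphN. Qed.
Lemma ii_neq0 : ii R != 0.
Proof. by apply/eqP => /(congr1 (@complex.Im R)) /= /eqP; rewrite oner_eq0. Qed.

Lemma z1_qi q : z1 (qmul q qi) = ii R * z1 q.
Proof. by rewrite z1_qmul z1_quat z2_quat mulr0 subr0 mulrC. Qed.
Lemma z2_qi q : z2 (qmul q qi) = ii R * z2 q.
Proof. by rewrite z2_qmul z1_quat z2_quat mulr0 add0r mulrC. Qed.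

Lemma hopf_mul u : u != 0 -> qmul (hopf u) u = qmul u qi.
Proof. by move=> u0; rewrite /hopf qmulVKr. Qed.

Lemma im_unit_hopf u : u != 0 -> im_unit (hopf u).
Proof.
move=> u0; split.
  by rewrite /hopf qinvE qmulZr mxE !(qmulE, qconjE) !quatE /=; ring.
have /(congr1 (fun q => dot q q)) := hopf_mul u0; rewrite !dot_qmul.
have -> : dot qi qi = 1 by rewrite dotE !quatE /=; ring.
by rewrite mulrC => /mulfI; apply; rewrite dot_eq0.
Qed.

Lemma commute_qi m : qmul m qi = qmul qi m <-> z2 m = 0.
Proof.
split=> [/(congr1 (@z2 R))|m2].
  rewrite z2_qi z2_qmul z1_quat z2_quat conj_ii mul0r addr0 mulNr => E.
  have /eqP : (2 * ii R) * z2 m = 0 by rewrite -mulrA mulrDl mul1r {1}E addNr.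
  by rewrite !mulf_eq0 (negPf ii_neq0) pnatr_eq0 /= => /eqP.
apply: quat_ext; rewrite ?z1_qi ?z2_qi ?z1_qmul ?z2_qmul z1_quat z2_quat m2; ring.
Qed.

(** The complex area form on H = C^2. For nonzero arguments it vanishes exactly when both lie on the
    same complex line, that is, give the same point of CP^1. *)
Definition wedge u w : C := z1 u * z2 w - z2 u * z1 w.

Lemma wedgeE u w : z2 (qmul (qconj u) w) = wedge u w.
Proof. by rewrite z2_qmul z1_quat z2_quat conjcK mulNr. Qed.

Lemma z2_qinv_mul u w : wedge u w = 0 -> z2 (qmul (qinv u) w) = 0.
Proof. by move=> E; rewrite qinvE qmulZl z2Z wedgeE E mulr0. Qed.

(** Both sides say that u^-1 w commutes with i, hence is a complex number. *)
Lemma wedge_eq0 u w : u != 0 -> (hopf w = hopf u /\ w != 0 <-> wedge u w = 0 /\ w != 0).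
Proof.
move=> u0; split=> [] [E w0]; split=> //.
  have : qmul (hopf u) w = qmul w qi by rewrite -E hopf_mul.
  rewrite /hopf -!qmulA => /(congr1 (qmul (qinv u))); rewrite qmulKl // qmulA => /esym.
  rewrite -{2}(qmulVKl w u0) -!qmulA qmulKl // qmulA => /commute_qi.
  by rewrite qinvE qmulZl z2Z wedgeE => /eqP; rewrite mulf_eq0 fmorph_eq0 invr_eq0 dot_eq0 (negPf u0) /= => /eqP.
have /commute_qi E1 := z2_qinv_mul E.
apply: (@qmul_injr _ w) => //; rewrite hopf_mul // -{1}(qmulVKl w u0) -qmulA E1.
by rewrite /hopf !qmulA.
Qed.

Lemma quat_decomp q :
  q = complex.Re (z1 q) *: qone + complex.Im (z1 q) *: qmul qone qi
              + (complex.Re (z2 q) *: qj + complex.Im (z2 q) *: qmul qj qi).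
Proof. by apply: row4_ext; rewrite !(qmulE, quatE, mxE) /=; ring. Qed.

Lemma complex_decomp a : a = real_complex R (complex.Re a) + ii R * real_complex R (complex.Im a).
Proof. by apply: complex_ext; rewrite ?cReD ?cImD ?cReM ?cImM /=; ring. Qed.

(** * Spaces of (1,0)-forms in quaternionic terms *)

Section Forms.
Implicit Types (alpha : 'cV[C]_4) (K : 'M[R]_4).

Definition form_ev alpha h : C := \sum_i real_complex R (h ord0 i) * alpha i ord0.

Lemma form_evE alpha h : form_ev alpha h = (map_mx (real_complex R) h *m alpha) ord0 ord0.
Proof. by rewrite mxE; apply: eq_bigr => i _; rewrite mxE. Qed.

Lemma form_ev_inj alpha beta : (forall h, form_ev alpha h = form_ev beta h) -> alpha = beta.
Proof.
move=> H; apply/colP => i; have := H (delta_mx ord0 i).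
rewrite /form_ev (bigD1 i) //= [X in _ = X](bigD1 i) //= !mxE !eqxx /= !rmorph1 !mul1r.
by rewrite !big1 ?addr0 // => j ji; rewrite mxE (negPf ji) andbF rmorph0 mul0r.
Qed.

Lemma form_evD alpha h h' : form_ev alpha (h + h') = form_ev alpha h + form_ev alpha h'.
Proof. by rewrite -big_split; apply: eq_bigr => i _; rewrite mxE rmorphD mulrDl. Qed.

Lemma form_evZ alpha (k : R) h : form_ev alpha (k *: h) = real_complex R k * form_ev alpha h.
Proof. by rewrite mulr_sumr; apply: eq_bigr => i _; rewrite mxE rmorphM mulrA. Qed.

Lemma form10P K alpha :
  form10 K alpha <-> forall h, form_ev alpha (h *m K) = ii R * form_ev alpha h.
Proof.
split=> [E h|E].
  by rewrite !form_evE map_mxM -mulmxA E -scalemxAr mxE.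
apply: form_ev_inj => h; rewrite form_evE mulmxA -map_mxM -form_evE E !form_evE.
by rewrite -scalemxAr [RHS]mxE.
Qed.

(** The two spanning forms are the complex coordinates of h (a + j b); this translates the given
    parametrisation of the fibre into quaternions. *)
Lemma form_ev_span a b c d h :
  form_ev (c *: (a *: dz1 R - b *: dz2bar R) + d *: (a *: dz2 R + b *: dz1bar R)) h =
  c * z1 (qmul h (quat a b)) + d * z2 (qmul h (quat a b)).
Proof.
have e1 : z1 h = real_complex R (h ord0 0) + ii R * real_complex R (h ord0 1).
  by apply: complex_ext; rewrite ?cReD ?cImD ?cReM ?cImM /=; ring.
have e2 : z2 h = real_complex R (h ord0 2) + ii R * real_complex R (h ord0 3).
  by apply: complex_ext; rewrite ?cReD ?cImD ?cReM ?cImM /=; ring.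
rewrite z1_qmul z2_qmul z1_quat z2_quat e1 e2 /form_ev sum_ord4.
rewrite !conjD !conjM conj_ii !conjc_real.
set h0 := real_complex R _; set h1 := real_complex R (h ord0 1).
set h2 := real_complex R (h ord0 2); set h3 := real_complex R (h ord0 3).
rewrite !mxE /=.
by ring.
Qed.

(** The map h -> h u turns right multiplication by u i u^-1 into right multiplication by i, which
    multiplies both complex coordinates by i. *)
Lemma hopf_has_parameter a b : quat a b != 0 -> has_parameter (Rmat (hopf (quat a b))) a b.
Proof.
set u := quat a b => u0; apply/seteqP; split=> alpha /=; last first.
  move=> [c [d ->]]; apply/form10P => h; rewrite !form_ev_span -/u mul_Rmat -qmulA.
  by rewrite hopf_mul // qmulA z1_qi z2_qi; ring.
move=> /form10P E.
(* Transported by h = k u^-1, a (1,0)-form becomes complex linear on H, so its values at 1 and j are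
   its coefficients. *)
pose B k := form_ev alpha (qmul k (qinv u)).
have BI k : B (qmul k qi) = ii R * B k.
  by rewrite /B -E mul_Rmat /hopf -!qmulA qmulKl.
have BD k k' : B (k + k') = B k + B k' by rewrite /B qmulDl form_evD.
have BZ t k : B (t *: k) = real_complex R t * B k by rewrite /B qmulZl form_evZ.
exists (B qone), (B qj).
apply: form_ev_inj => h; rewrite form_ev_span -/u.
have -> : form_ev alpha h = B (qmul h u) by rewrite /B qmulKr.
clearbody B; move: (qmul h u) => k.
rewrite {1}(quat_decomp k) BD [B (_ + _)]BD [B (_ + _)]BD !BZ BI (BI qj).
rewrite [in RHS](complex_decomp (z1 k)) [in RHS](complex_decomp (z2 k)).
by ring.
Qed.

Lemma has_parameter_hopf u a b : u != 0 -> quat a b != 0 ->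
  has_parameter (Rmat (hopf u)) a b <-> wedge u (quat a b) = 0.
Proof.
move=> u0 ab0; split=> [E|E]; last first.
  have [<- _] : hopf (quat a b) = hopf u /\ quat a b != 0 by apply/wedge_eq0.
  exact: hopf_has_parameter.
set w := quat a b in ab0 *.
(* Each of the two spanning forms is of type (1,0), so h -> h w intertwines the structure with right
   multiplication by i; h = 1 then gives [hopf w]. *)
have H h : qmul (qmul h (hopf u)) w = qmul (qmul h w) qi.
  apply: quat_ext.
    have : form10 (Rmat (hopf u)) (1 *: (a *: dz1 R - b *: dz2bar R) + 0 *: (a *: dz2 R + b *: dz1bar R)).
      by rewrite E; exists 1, 0.
    move=> /form10P /(_ h); rewrite !form_ev_span !mul0r !addr0 !mul1r mul_Rmat => ->.
    by rewrite z1_qi.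
  have : form10 (Rmat (hopf u)) (0 *: (a *: dz1 R - b *: dz2bar R) + 1 *: (a *: dz2 R + b *: dz1bar R)).
    by rewrite E; exists 0, 1.
  move=> /form10P /(_ h); rewrite !form_ev_span !mul0r !add0r !mul1r mul_Rmat => ->.
  by rewrite z2_qi.
have Hw : hopf w = hopf u.
  by apply: (@qmul_injr _ w) => //; have := H qone; rewrite !qmul1l hopf_mul.
by have [] : wedge u w = 0 /\ w != 0 by apply/wedge_eq0.
Qed.

End Forms.

(** * Integrability as a Cauchy-Riemann equation *)

Section Integrability.
Implicit Types (U : set R4).

Lemma derive_mulmx (m n p : nat) (M : R4 -> 'M[R]_(m, n)) (N : R4 -> 'M[R]_(n, p)) x v :
  differentiable M x -> differentiable N x ->
  differentiable (fun x => M x *m N x) x /\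
  'D_v (fun x => M x *m N x) x = 'D_v M x *m N x + M x *m 'D_v N x.
Proof.
move=> dM dN.
have dMij i j : differentiable (fun x => M x i j : R^o) x by exact: differentiable_entry.
have dNij i j : differentiable (fun x => N x i j : R^o) x by exact: differentiable_entry.
have E i j : (fun x => (M x *m N x) i j : R^o) =
    \sum_(k < n) ((fun x => M x i k) : R4 -> R^o) * ((fun x => N x k j) : R4 -> R^o).
  by apply/funext => y; rewrite mxE fct_sumE.
have dMN : differentiable (fun x => M x *m N x) x.
  apply: differentiable_mx => i j; rewrite E; apply: differentiable_sum => k.
  exact: differentiableM.
split => //.
apply/matrixP => i j; rewrite derive_entry; last exact: diff_derivable.
rewrite E derive_sum; last by move=> k; apply: derivableM; exact: diff_derivable.
rewrite !mxE -big_split /=; apply: eq_bigr => k _.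
rewrite deriveM; [|exact: diff_derivable..].
rewrite !derive_entry; [|exact: diff_derivable..].
by rewrite addrC; congr (_ + _); exact: mulrC.
Qed.

(** [P] and [Q] stand for D_X K and D_Y K, [a] and [b] for D_(KX) Y and D_(KY) X, [c] and [d] for
    D_X Y and D_Y X. *)
Lemma nijenhuis_algebra (k P Q : 'M[R]_4) (X Y a b c d : R4) : k *m k = - 1%:M ->
  a *m k + Y *m (P *m k) - (b *m k + X *m (Q *m k)) - (a - (d *m k + X *m Q)) *m k
  - (c *m k + Y *m P - b) *m k - (c - d) = 0.
Proof.
move=> kk; rewrite !(mulmxDl, mulNmx) -!mulmxA kk !mulmxN !mulmx1.
move: (a *m k) (b *m k) (X *m _) (Y *m _) => a' b' X' Y'.
by apply/rowP => j; rewrite !mxE; ring.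
Qed.

(** In linear coordinates only first derivatives of [K] survive in the Nijenhuis tensor. The last
    hypothesis says that [K] is holomorphic as a map into the space of complex structures, and it
    makes these derivatives cancel. *)
Lemma integrable_criterion U (K : R4 -> 'M[R]_4) :
  (forall x, U x -> differentiable K x) ->
  (forall x, U x -> K x *m K x = - 1%:M) ->
  (forall x h, U x -> 'D_(h *m K x) K x = 'D_h K x *m K x) ->
  integrable_on U K.
Proof.
move=> dK KK DK X Y sX sY x Ux.
have dX := smooth_on_differentiable sX Ux.
have dY := smooth_on_differentiable sY Ux.
have dKx := dK x Ux.
have DM v Z : differentiable Z x ->
    'D_v (vf_act K Z) x = 'D_v Z x *m K x + Z x *m 'D_v K x.
  by move=> dZ; have [] := derive_mulmx v dZ dKx.
have vfE (Z : R4 -> R4) : vf_act K Z x = Z x *m K x by [].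
rewrite /nijenhuis !vfE /lie_bracket !vfE !(DM _ _ dX, DM _ _ dY) !DK //.
by apply: nijenhuis_algebra; exact: KK.
Qed.

Lemma derive_Rmat x v (f : R4 -> R4) : differentiable f x ->
  differentiable (fun y => Rmat (f y)) x /\ 'D_v (fun y => Rmat (f y)) x = Rmat ('D_v f x).
Proof.
move=> df.
(* [Lmat i] is left multiplication by the i-th basis quaternion: it displays row [i] of [Rmat m] as
   a linear function of [m]. *)
pose Lmat i : 'M[R]_4 := \matrix_(k, j) qmul (delta_mx ord0 i) (delta_mx ord0 k) ord0 j.
have LmE i k j : Lmat i k j = qmul (delta_mx ord0 i) (delta_mx ord0 k) ord0 j by rewrite mxE.
have LE m i j : Rmat m i j = (m *m Lmat i) ord0 j.
  suff -> : m *m Lmat i = qmul (delta_mx ord0 i) m by rewrite RmatE.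
  by apply: row4_ext; rewrite mxE sum_ord4 !LmE !qmulE !mxE /=; ring.
have dDL i : differentiable (fun y => f y *m Lmat i) x /\
    'D_v (fun y => f y *m Lmat i) x = 'D_v f x *m Lmat i.
  have [dfL ->] := derive_mulmx v df (differentiable_cst (Lmat i) x).
  by rewrite derive_cst mulmx0 addr0.
have dR : differentiable (fun y => Rmat (f y)) x.
  apply: differentiable_mx => i j.
  rewrite (_ : (fun y => _) = fun y => (f y *m Lmat i) ord0 j); first by apply: differentiable_entry; have [] := dDL i.
  by apply/funext => y; rewrite LE.
split=> //; apply/matrixP => i j.
rewrite derive_entry; last exact: diff_derivable.
rewrite LE; have [dL <-] := dDL i.
rewrite derive_entry; last exact: diff_derivable.
by congr ('D_v _ x); apply/funext => y; rewrite LE.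
Qed.

Lemma derive_qmul (f g : R4 -> R4) x v : differentiable f x -> differentiable g x ->
  differentiable (fun y => qmul (f y) (g y)) x /\ 'D_v (fun y => qmul (f y) (g y)) x = qmul ('D_v f x) (g x) + qmul (f x) ('D_v g x).
Proof.
move=> df dg; have [dRg DRg] := derive_Rmat v dg.
have -> : (fun y => qmul (f y) (g y)) = (fun y => f y *m Rmat (g y)).
  by apply/funext => y; rewrite mul_Rmat.
have [dM ->] := derive_mulmx v df dRg.
by rewrite DRg !mul_Rmat.
Qed.

(** Write du' = M + du i with u^-1 M complex. Then n M = M i for n = [hopf u], so M drops out of
    dn', and what remains is (dn u) i = dn n u. *)
Lemma hopf_derivative_algebra u dn dn' du du' : u != 0 ->
  qmul dn u = qmul du qi - qmul (hopf u) du ->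
  qmul dn' u = qmul du' qi - qmul (hopf u) du' ->
  wedge u (du' - qmul du qi) = 0 -> dn' = qmul dn (hopf u).
Proof.
move=> u0 E E' /z2_qinv_mul /commute_qi.
have : du' = (du' - qmul du qi) + qmul du qi by rewrite subrK.
move: (du' - _) => M Edu comm; rewrite {}Edu in E'.
have EM : qmul (hopf u) M = qmul M qi.
  by rewrite /hopf -!qmulA -comm qmulA qmulVKl.
apply: (qmul_injr u0); rewrite E' -qmulA hopf_mul // qmulA E.
by rewrite qmulDl qmulDr EM qmulDl qmulNl -!qmulA opprD addrACA subrr add0r.
Qed.

(* With [u^-1 du] written as [c + j d], the derivative of [u i u^-1] is
   [2 u (j d i) u^-1], so the criterion amounts to [d] being of type (1,0). *)
Lemma integrable_hopf U (u : R4 -> R4) : open U ->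
  (forall x, U x -> differentiable u x) ->
  (forall x, U x -> differentiable (fun y => hopf (u y)) x) ->
  (forall x, U x -> u x != 0) ->
  (forall x h, U x -> wedge (u x) ('D_(qmul h (hopf (u x))) u x - qmul ('D_h u x) qi) = 0) ->
  integrable_on U (fun x => Rmat (hopf (u x))).
Proof.
move=> oU du dn u0 wu; apply: integrable_criterion => [x Ux|x Ux|x h Ux].
- by have [] := derive_Rmat 0 (dn x Ux).
- by apply: im_unit_sqr; apply: im_unit_hopf; exact: u0.
rewrite mul_Rmat; set n := hopf (u x).
have DR v : 'D_v (fun y => Rmat (hopf (u y))) x = Rmat ('D_v (fun y => hopf (u y)) x).
  by have [] := derive_Rmat v (dn x Ux).
rewrite !DR -RmatM; congr Rmat; set dn' := 'D_(qmul h n) _ x; set dn0 := 'D_h _ x.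
(* The derivative of the identity n u = u i. *)
have Dnu v : qmul ('D_v (fun y => hopf (u y)) x) (u x) = qmul ('D_v u x) qi - qmul n ('D_v u x).
  apply/(canRL (addrK _)).
  have [_ <-] := derive_qmul v (dn x Ux) (du x Ux).
  have [_] := derive_qmul v (du x Ux) (differentiable_cst qi x).
  rewrite derive_cst qmul0r addr0 => <-.
  by apply: near_eq_derive; apply: (near_of_open oU Ux) => y Uy; rewrite hopf_mul ?u0.
apply: hopf_derivative_algebra (u0 x Ux) (Dnu h) (Dnu (qmul h n)) (wu x h Ux).
Qed.

End Integrability.
End Hopf.

(** * Smoothness of the quaternionic operations *)

Section SmoothQuaternions.
Variable R : realType.
Local Notation C := R[i].
Local Notation R4 := 'rV[R]_4.
Implicit Types (U : set R4) (f g : R4 -> R4) (x v : R4).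

Definition rsmooth U f := forall i, smooth_on U (fun x => f x ord0 i : R^o).

Lemma rsmooth_smooth U f : open U -> rsmooth U f -> smooth_on U f.
Proof. by move=> oU sf; apply: smooth_mx => // i j; rewrite (ord1 i); exact: sf. Qed.

Lemma rsmooth_cst U (q : R4) : rsmooth U (fun=> q).
Proof. by move=> i; exact: smooth_cst. Qed.

Lemma rsmooth_id U : rsmooth U id.
Proof. by move=> i; exact: smooth_coord. Qed.

Lemma rsmooth_qmul U f g : open U -> rsmooth U f -> rsmooth U g ->
  rsmooth U (fun x => qmul (f x) (g x)).
Proof.
move=> oU sf sg; apply: forall_ord4.
- rewrite (_ : (fun x => _) = fun x => f x ord0 0 * g x ord0 0 - f x ord0 1 * g x ord0 1
     - f x ord0 2 * g x ord0 2 - f x ord0 3 * g x ord0 3).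
    by apply: smoothB => //; [apply: smoothB => //; [apply: smoothB => //|]|]; exact: smoothM.
  by apply/funext => x; rewrite qmulE.
- rewrite (_ : (fun x => _) = fun x => f x ord0 0 * g x ord0 1 + f x ord0 1 * g x ord0 0
     - f x ord0 2 * g x ord0 3 + f x ord0 3 * g x ord0 2).
    by apply: smoothD => //; [apply: smoothB => //; [apply: smoothD => //|]|]; exact: smoothM.
  by apply/funext => x; rewrite qmulE.
- rewrite (_ : (fun x => _) = fun x => f x ord0 0 * g x ord0 2 + f x ord0 1 * g x ord0 3
     + f x ord0 2 * g x ord0 0 - f x ord0 3 * g x ord0 1).
    by apply: smoothB => //; [apply: smoothD => //; [apply: smoothD => //|]|]; exact: smoothM.
  by apply/funext => x; rewrite qmulE.
- rewrite (_ : (fun x => _) = fun x => f x ord0 0 * g x ord0 3 - f x ord0 1 * g x ord0 2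
     + f x ord0 2 * g x ord0 1 + f x ord0 3 * g x ord0 0).
    by apply: smoothD => //; [apply: smoothD => //; [apply: smoothB => //|]|]; exact: smoothM.
  by apply/funext => x; rewrite qmulE.
Qed.

Lemma smooth_dot U f g : open U -> rsmooth U f -> rsmooth U g ->
  smooth_on U (fun x => dot (f x) (g x) : R^o).
Proof.
move=> oU sf sg.
rewrite (_ : (fun x => _) = fun x => f x ord0 0 * g x ord0 0 + f x ord0 1 * g x ord0 1
     + f x ord0 2 * g x ord0 2 + f x ord0 3 * g x ord0 3).
  by apply: smoothD => //; [apply: smoothD => //; [apply: smoothD => //|]|]; exact: smoothM.
by apply/funext => x; rewrite dotE.
Qed.

Lemma rsmooth_scale U (k : R4 -> R^o) f : open U -> smooth_on U k -> rsmooth U f ->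
  rsmooth U (fun x => k x *: f x).
Proof.
move=> oU sk sf i; rewrite (_ : (fun x => _) = fun x => k x * f x ord0 i).
  exact: smoothM.
by apply/funext => x; rewrite mxE.
Qed.

Lemma csmooth_z U f : rsmooth U f ->
  csmooth U (fun x => z1 (f x)) /\ csmooth U (fun x => z2 (f x)).
Proof. by move=> sf; split; split=> /=; exact: sf. Qed.

Lemma rsmooth_quat U (F G : R4 -> C) : csmooth U F -> csmooth U G ->
  rsmooth U (fun x => quat (F x) (G x)).
Proof.
move=> [f1 f2] [g1 g2]; apply: forall_ord4.
- by rewrite (_ : (fun x => _) = fun x => complex.Re (F x)) //; apply/funext => x; rewrite quatE.
- by rewrite (_ : (fun x => _) = fun x => complex.Im (F x)) //; apply/funext => x; rewrite quatE.
- by rewrite (_ : (fun x => _) = fun x => complex.Re (G x)) //; apply/funext => x; rewrite quatE.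
- by rewrite (_ : (fun x => _) = fun x => complex.Im (G x)) //; apply/funext => x; rewrite quatE.
Qed.

Lemma rsmooth_conj U f : open U -> rsmooth U f -> rsmooth U (fun x => qconj (f x)).
Proof.
move=> oU /csmooth_z [s1 s2]; apply: rsmooth_quat; first exact: csmooth_conj.
exact: csmoothN.
Qed.

Lemma rsmooth_inv U f : open U -> (forall x, U x -> f x != 0) -> rsmooth U f ->
  rsmooth U (fun x => qinv (f x)).
Proof.
move=> oU f0 sf; apply: rsmooth_scale => //; last exact: rsmooth_conj.
apply: smoothV => //; last exact: smooth_dot.
by move=> x /f0; rewrite dot_eq0.
Qed.

Lemma rsmooth_hopf U f : open U -> (forall x, U x -> f x != 0) -> rsmooth U f ->
  rsmooth U (fun x => hopf (f x)).
Proof.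
move=> oU f0 sf; apply: rsmooth_qmul => //; last exact: rsmooth_inv.
by apply: rsmooth_qmul => //; exact: rsmooth_cst.
Qed.

Lemma smooth_Rmat U f : open U -> rsmooth U f -> smooth_on U (fun x => Rmat (f x)).
Proof.
move=> oU sf; apply: smooth_mx => // i j.
rewrite (_ : (fun x => _) = fun x => qmul (delta_mx ord0 i) (f x) ord0 j).
  by apply: rsmooth_qmul => //; exact: rsmooth_cst.
by apply/funext => x; rewrite RmatE.
Qed.

Lemma rsmooth_sub U W f : U `<=` W -> rsmooth W f -> rsmooth U f.
Proof. by move=> UW sf i; apply: smooth_on_sub UW (sf i). Qed.

Lemma rsmooth_diff U f x : rsmooth U f -> U x -> differentiable f x.
Proof.
by move=> sf Ux; apply: differentiable_mx => i j; rewrite (ord1 i); apply: smooth_on_differentiable (sf j) Ux.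
Qed.

Lemma rsmooth_continuous U f x : rsmooth U f -> U x -> {for x, continuous f}.
Proof. by move=> sf Ux; apply: differentiable_continuous; exact: rsmooth_diff sf Ux. Qed.

Lemma cD_z f x v : differentiable f x ->
  [/\ cdiff (fun y => z1 (f y)) x, cD v (fun y => z1 (f y)) x = z1 ('D_v f x),
      cdiff (fun y => z2 (f y)) x & cD v (fun y => z2 (f y)) x = z2 ('D_v f x)].
Proof.
move=> df; have dfe i : differentiable (fun y => f y ord0 i : R^o) x by exact: differentiable_entry.
have Dfe i : 'D_v f x ord0 i = 'D_v (fun y => f y ord0 i : R^o) x.
  by apply: derive_entry; exact: diff_derivable.
by rewrite /cdiff /cD /z1 /z2 /= !Dfe; split.
Qed.

Lemma open_neq0 : open [set y : R4 | y != 0].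
Proof.
rewrite (_ : mkset _ = ~` [set 0]); last by apply/seteqP; split=> z /= /eqP.
by apply: closed_openC; apply: accessible_closed_set1; apply: hausdorff_accessible; exact: norm_hausdorff.
Qed.

Lemma open_preimage (W : topologicalType) U (F : R4 -> W) (D : set W) :
  open U -> (forall x, U x -> {for x, continuous F}) -> open D -> open (U `&` F @^-1` D).
Proof.
move=> oU cF oD; rewrite openE => x [Ux DFx]; apply: filterI.
  by apply: open_nbhs_nbhs.
by apply: cF => //; apply: open_nbhs_nbhs.
Qed.

(** Follows by differentiating y^-1 y = 1, which is constant near [y]. *)
Lemma derive_qinv (y h : R4) : y != 0 ->
  differentiable (@qinv R) y /\ 'D_h (@qinv R) y = - qmul (qinv y) (qmul h (qinv y)).
Proof.
move=> y0.
have oU := open_neq0.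
have sq : rsmooth [set y : R4 | y != 0] (@qinv R) by apply: rsmooth_inv => //; exact: rsmooth_id.
have dq : differentiable (@qinv R) y by exact: rsmooth_diff sq y0.
split=> //.
have [_] := derive_qmul h dq (rsmooth_diff (@rsmooth_id setT) (I : setT y)).
rewrite derive_id (_ : 'D_h (fun y0 => qmul (qinv y0) y0) y = 0); last first.
  rewrite -(derive_cst (qone R) y h); apply: near_eq_derive.
  by apply: (near_of_open oU y0) => z z0; rewrite qmulVl.
move=> E; apply: (qmul_injr y0); rewrite qmulNl -!qmulA qmulVl // qmul1r.
by apply/eqP; rewrite -addr_eq0; apply/eqP/esym.
Qed.

End SmoothQuaternions.

(** * Locality of orthogonal complex structures *)

Section OCSLocal.
Variable R : realType.
Local Notation R4 := 'rV[R]_4.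
Implicit Types (U : set R4) (K : R4 -> 'M[R]_4).

Lemma OCS_in_chart_eq U K K' : open U -> (forall x, U x -> K x = K' x) ->
  OCS_in_chart U K -> OCS_in_chart U K'.
Proof.
move=> oU KK' [[sK K2] iK oK dK]; split; [split|..].
- exact: smooth_on_eq sK.
- by move=> x Ux; rewrite -KK' // K2.
- move=> X Y sX sY x Ux; rewrite -(iK X Y sX sY x Ux).
  have vE Z : \near x, vf_act K' Z x = vf_act K Z x.
    by apply: (near_of_open oU Ux) => y Uy; rewrite /vf_act KK'.
  have vx Z : vf_act K' Z x = vf_act K Z x by rewrite /vf_act KK'.
  have DE Z v : 'D_v (vf_act K' Z) x = 'D_v (vf_act K Z) x by exact: near_eq_derive (vE Z).
  have VE (F F' : R4 -> R4) : F x = F' x -> vf_act K' F x = vf_act K F' x.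
    by rewrite /vf_act KK' // => ->.
  have L1 : lie_bracket (vf_act K' X) (vf_act K' Y) x = lie_bracket (vf_act K X) (vf_act K Y) x.
    rewrite /lie_bracket (vx X) (vx Y) (DE X) (DE Y); exact: erefl.
  have L2 : lie_bracket (vf_act K' X) Y x = lie_bracket (vf_act K X) Y x.
    rewrite /lie_bracket (vx X) (DE X); exact: erefl.
  have L3 : lie_bracket X (vf_act K' Y) x = lie_bracket X (vf_act K Y) x.
    rewrite /lie_bracket (vx Y) (DE Y); exact: erefl.
  rewrite /nijenhuis L1 (VE _ _ L2) (VE _ _ L3); exact: erefl.
- by move=> x Ux u v; rewrite -KK' // oK.
- by move=> x Ux; rewrite -KK' //; exact: dK.
Qed.

(** Needed because each explicit formula for a zero of the quadric is valid only on the open set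
    where that formula does not vanish. *)
Lemma OCS_in_chart_local U K :
  (forall x, U x -> exists2 W, W `<=` U /\ W x & OCS_in_chart W K) -> OCS_in_chart U K.
Proof.
move=> H; split; [split|..].
- by apply: smooth_on_local => x /H[W [WU Wx] [[sK _] _ _ _]]; exists W.
- by move=> x /H[W [WU Wx] [[_ K2] _ _ _]]; exact: K2.
- move=> X Y sX sY x /H[W [WU Wx] [_ iK _ _]].
  by apply: (iK X Y _ _ x Wx); apply: smooth_on_sub WU _.
- by move=> x /H[W [WU Wx] [_ _ oK _]]; exact: oK.
- by move=> x /H[W [WU Wx] [_ _ _ dK]]; exact: dK.
Qed.

Lemma OCS_hopf U (u : R4 -> R4) : open U -> rsmooth U u ->
  (forall x, U x -> u x != 0) ->
  (forall x h, U x -> wedge (u x) ('D_(qmul h (hopf (u x))) u x - qmul ('D_h u x) (qi R)) = 0) ->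
  OCS_in_chart U (fun x => Rmat (hopf (u x))).
Proof.
move=> oU su u0 wu.
have iu x : U x -> im_unit (hopf (u x)) by move=> /u0; exact: im_unit_hopf.
have sh : rsmooth U (fun x => hopf (u x)) by exact: rsmooth_hopf.
split; [split|..].
- exact: smooth_Rmat.
- by move=> x /iu; exact: im_unit_sqr.
- apply: integrable_hopf => // x Ux; [exact: rsmooth_diff su Ux|exact: rsmooth_diff sh Ux].
- by move=> x /iu Hx v w; rewrite /round_metric im_unit_orthogonal.
- by move=> x /iu; exact: im_unit_orientation.
Qed.

End OCSLocal.

(** * The quadric in a chart *)

Section Quadric.
Variable R : realType.
Local Notation C := R[i].
Local Notation R4 := 'rV[R]_4.
Variable A : 'M[C]_4.
Hypothesis symA : A^T = A.
Implicit Types (U : set R4) (p q u w h x y : R4) (v : 'rV[C]_4) (s b : bool) (t : C).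
Local Notation qone := (qone R).
Local Notation qi := (qi R).
Local Notation qj := (qj R).

Definition bil (v w : 'rV[C]_4) : C := (v *m A *m w^T) ord0 ord0.

Lemma bilC v (w : 'rV[C]_4) : bil v w = bil w v.
Proof.
rewrite /bil -[in LHS](trmxK (v *m A *m w^T)) [LHS]mxE !trmx_mul trmxK symA.
by rewrite mulmxA.
Qed.

Lemma bilDl v v' (w : 'rV[C]_4) : bil (v + v') w = bil v w + bil v' w.
Proof. by rewrite /bil !mulmxDl mxE. Qed.
Lemma bilZl (k : C) v (w : 'rV[C]_4) : bil (k *: v) w = k * bil v w.
Proof. by rewrite /bil -!scalemxAl mxE. Qed.
Lemma bilDr v (w w' : 'rV[C]_4) : bil v (w + w') = bil v w + bil v w'.
Proof. by rewrite ![bil v _]bilC bilDl. Qed.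
Lemma bilZr (k : C) v (w : 'rV[C]_4) : bil v (k *: w) = k * bil v w.
Proof. by rewrite ![bil v _]bilC bilZl. Qed.

Lemma bil_sum v (w : 'rV[C]_4) : bil v w = \sum_i \sum_j v ord0 i * A i j * w ord0 j.
Proof.
rewrite /bil mxE exchange_big; apply: eq_bigr => j _.
by rewrite !mxE mulr_suml.
Qed.

Definition cvec p q : 'rV[C]_4 := \row_(k < 4) nth 0 [:: z1 p; z2 p; z1 q; z2 q] k.

Lemma cvecE p q : (cvec p q ord0 0 = z1 p) * (cvec p q ord0 1 = z2 p) *
  (cvec p q ord0 2 = z1 q) * (cvec p q ord0 3 = z2 q).
Proof. by rewrite !mxE. Qed.

(* The fibre over the point with coordinate x, as a quaternionic line of H^2. *)
Definition emb b x u : 'rV[C]_4 := if b then cvec (qmul x u) u else cvec u (qmul x u).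

(** [pad b (qmul h u)] is the derivative of [emb b x u] when the base point [x] moves in the
    direction [h]. *)
Definition pad b q : 'rV[C]_4 := if b then cvec q 0 else cvec 0 q.

Lemma emb_lin b x u : emb b x u = z1 u *: emb b x qone + z2 u *: emb b x qj.
Proof.
by rewrite /emb; case: b; apply: row4_ext;
  rewrite !(cvecE, z1_qmul, z2_qmul, z1_quat, z2_quat, mxE); ring.
Qed.

Lemma pad_qi b q : pad b (qmul q qi) = ii R *: pad b q.
Proof.
by rewrite /pad; case: b; apply: row4_ext; rewrite !(cvecE, z1_qi, z2_qi, z1_0, z2_0, mxE) ?mulr0.
Qed.

Definition qf b x u w : C := bil (emb b x u) (emb b x w).
Definition q11 b x : C := qf b x qone qone.
Definition q12 b x : C := qf b x qone qj.
Definition q22 b x : C := qf b x qj qj.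

Lemma qfE b x u w : qf b x u w =
  z1 u * z1 w * q11 b x + (z1 u * z2 w + z2 u * z1 w) * q12 b x + z2 u * z2 w * q22 b x.
Proof.
rewrite /qf (emb_lin b x u) (emb_lin b x w) !(bilDl, bilDr) !(bilZl, bilZr).
rewrite (bilC (emb b x qj) (emb b x qone)) -/(qf _ _ _ _) /q11 /q12 /q22 /qf.
by ring.
Qed.

(** The determinant of the binary form, that is, minus a quarter of its usual discriminant; hence
    the equation t^2 = - disc below. *)
Definition disc b x : C := q11 b x * q22 b x - q12 b x * q12 b x.

(** Relative to the area form, the quadratic form is a traceless endomorphism with eigenvalues t and
    - t, where t^2 = - disc. An eigenvector is a zero of the form, and the sign of [t] records which
    of the two zeros it is. *)
Definition isroot b x t u := forall w, qf b x u w = - t * wedge u w.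

(** Two formulas for the same eigenvector; for t <> 0 they never vanish together. The vector
    [rootvec] may jump between them, but the complex line that it spans does not. *)
Definition rootv1 b x t : R4 := quat (- q12 b x + t) (q11 b x).
Definition rootv2 b x t : R4 := quat (q22 b x) (- q12 b x - t).
Definition rootvec b x t : R4 := if rootv1 b x t != 0 then rootv1 b x t else rootv2 b x t.

Lemma isroot1 b x t : t * t = - disc b x -> isroot b x t (rootv1 b x t).
Proof.
rewrite /disc opprB => E w; rewrite qfE /wedge z1_quat z2_quat.
transitivity (t * (z1 w * q11 b x + z2 w * q12 b x) - z2 w * (q12 b x * q12 b x - q11 b x * q22 b x)).
  by ring.
by rewrite -E; ring.
Qed.

Lemma isroot2 b x t : t * t = - disc b x -> isroot b x t (rootv2 b x t).
Proof.
rewrite /disc opprB => E w; rewrite qfE /wedge z1_quat z2_quat.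
transitivity (- t * (z1 w * q12 b x + z2 w * q22 b x) - z1 w * (q12 b x * q12 b x - q11 b x * q22 b x)).
  by ring.
by rewrite -E; ring.
Qed.

Lemma two_neq0 : (2 : C) != 0. Proof. by rewrite pnatr_eq0. Qed.

Lemma quat_eq0 (a c : C) : (quat a c == 0) = (a == 0) && (c == 0).
Proof.
apply/eqP/andP => [E|[/eqP -> /eqP ->]].
  have := congr1 (@z1 R) E; have := congr1 (@z2 R) E.
  by rewrite z1_quat z2_quat z1_0 z2_0 => -> ->; rewrite !eqxx.
by apply: quat_ext; rewrite ?z1_quat ?z2_quat ?z1_0 ?z2_0.
Qed.

Lemma rootv2_neq0 b x t : t * t = - disc b x -> t != 0 -> rootv1 b x t = 0 -> rootv2 b x t != 0.
Proof.
move=> E t0 /eqP; rewrite !quat_eq0 => /andP[/eqP e1 /eqP e2].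
apply/negP => /andP[/eqP e3 /eqP e4].
have /eqP : 2 * t = 0.
  rewrite (_ : 2 * t = (- q12 b x + t) - (- q12 b x - t)); last by ring.
  by rewrite e1 e4 subrr.
by rewrite mulf_eq0 (negPf two_neq0) (negPf t0).
Qed.

Lemma rootvec_neq0 b x t : t * t = - disc b x -> t != 0 -> rootvec b x t != 0.
Proof.
move=> E t0; rewrite /rootvec; case: ifPn => // /negPn /eqP; exact: rootv2_neq0.
Qed.

Lemma isrootvec b x t : t * t = - disc b x -> isroot b x t (rootvec b x t).
Proof. by move=> E; rewrite /rootvec; case: ifPn => _; [exact: isroot1|exact: isroot2]. Qed.

Lemma qfC b x u w : qf b x u w = qf b x w u.
Proof. exact: bilC. Qed.

Lemma wedgeC u w : wedge u w = - wedge w u.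
Proof. by rewrite /wedge; ring. Qed.

Lemma wedgexx u : wedge u u = 0.
Proof. by rewrite /wedge; ring. Qed.

(** The quadratic form is symmetric and the area form antisymmetric, so 2 t (u ^ w) = 0. *)
Lemma isroot_wedge b x t u w : t != 0 -> isroot b x t u -> isroot b x t w -> wedge u w = 0.
Proof.
move=> t0 ru rw; have := ru w; rewrite qfC rw wedgeC => E.
have /eqP : (2 * t) * wedge u w = 0.
  rewrite (_ : _ * _ = (- t * - wedge u w) - (- t * wedge u w)); last by ring.
  by rewrite E subrr.
by rewrite !mulf_eq0 (negPf two_neq0) (negPf t0) => /eqP.
Qed.

Lemma isroot_hopf b x t u w : t != 0 -> u != 0 -> w != 0 ->
  isroot b x t u -> isroot b x t w -> hopf w = hopf u.
Proof.
move=> t0 u0 w0 ru rw.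
by have [] : hopf w = hopf u /\ w != 0 by apply/wedge_eq0 => //; split=> //; exact: isroot_wedge ru rw.
Qed.

Lemma isroot_null b x t u : isroot b x t u -> qf b x u u = 0.
Proof. by move=> ru; rewrite ru wedgexx mulr0. Qed.

Lemma wedge_isroot b x t u w : u != 0 -> isroot b x t u -> wedge u w = 0 -> qf b x w w = 0.
Proof.
move=> u0 ru uw.
have [c ->] : exists c : C, w = qmul u (quat c 0).
  exists (z1 (qmul (qinv u) w)).
  by rewrite -(z2_qinv_mul uw) quatK qmulVKl.
have -> : qf b x (qmul u (quat c 0)) (qmul u (quat c 0)) = c * c * qf b x u u.
  by rewrite !qfE !(z1_qmul, z2_qmul) !(z1_quat, z2_quat); ring.
by rewrite (isroot_null ru) mulr0.
Qed.

Lemma null_isroot b x t u : t * t = - disc b x -> t != 0 -> qf b x u u = 0 ->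
  isroot b x t u \/ isroot b x (- t) u.
Proof.
rewrite /disc opprB => E t0 F.
set a := z1 u; set c := z2 u.
(* [X] and [Y] are the coefficients of the linear form q(u, .); being a root for s amounts to X = s
   c and Y = - s a. *)
set X := q11 b x * a + q12 b x * c; set Y := q12 b x * a + q22 b x * c.
have H (s : C) : X = s * c -> Y = - s * a -> isroot b x s u.
  move=> eX eY w; rewrite qfE /wedge -/a -/c.
  transitivity (z1 w * X + z2 w * Y); first by rewrite /X /Y; ring.
  by rewrite eX eY; ring.
have FX : a * X + c * Y = 0 by rewrite -F qfE -/a -/c /X /Y; ring.
(* Modulo t^2 = - disc, the products X^2 - t^2 c^2 and Y^2 - t^2 a^2 are multiples of q(u, u). *)
have e1 : (X - t * c) * (X + t * c) = 0.
  transitivity (q11 b x * qf b x u u + ((q12 b x * q12 b x - q11 b x * q22 b x) - t * t) * (c * c)).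
    by rewrite qfE -/a -/c /X; ring.
  by rewrite F E subrr mulr0 mul0r addr0.
have e2 : (Y - t * a) * (Y + t * a) = 0.
  transitivity (q22 b x * qf b x u u + ((q12 b x * q12 b x - q11 b x * q22 b x) - t * t) * (a * a)).
    by rewrite qfE -/a -/c /Y; ring.
  by rewrite F E subrr mulr0 mul0r addr0.
(* For c = 0 the first factorisation cannot tell the two signs apart, and the second one is used. *)
have [c0|c0] := eqVneq c 0.
  have [a0|a0] := eqVneq a 0.
    by left; apply: H; rewrite /X /Y a0 c0 !mulr0 addr0.
  have X0 : X = 0.
    move: FX; rewrite c0 mul0r addr0 => /eqP; rewrite mulf_eq0 (negPf a0) => /eqP //.
  move/eqP: e2; rewrite mulf_eq0 => /orP[/eqP e|/eqP e]; [right|left]; apply: H.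
  - by rewrite X0 c0 mulr0.
  - by apply/eqP; rewrite opprK -subr_eq0 e.
  - by rewrite X0 c0 mulr0.
  - by apply/eqP; rewrite mulNr -addr_eq0 e.
have Yc (s : C) : X = s * c -> Y = - s * a.
  move=> eX; apply: (mulfI c0); apply/eqP; rewrite -subr_eq0; apply/eqP.
  by rewrite -FX eX; ring.
move/eqP: e1; rewrite mulf_eq0 => /orP[/eqP e|/eqP e]; [left|right].
  by apply: H; [|apply: Yc]; apply/eqP; rewrite -subr_eq0 e.
by apply: H; [|apply: Yc]; apply/eqP; rewrite mulNr -addr_eq0 e.
Qed.

End Quadric.

(** * The zeros of the quadric as complex structures in one chart *)

Section QuadricChart.
Variable R : realType.
Local Notation C := R[i].
Local Notation R4 := 'rV[R]_4.
Variable A : 'M[C]_4.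
Hypothesis symA : A^T = A.
Implicit Types (U : set R4) (p q w h x y : R4) (s b : bool) (t : C).
Local Notation qi := (qi R).

Lemma csmooth_emb U (u : R4 -> R4) b i : open U -> rsmooth U u ->
  csmooth U (fun x => emb b x (u x) ord0 i).
Proof.
move=> oU su; have [s1 s2] := csmooth_z su.
have sm : rsmooth U (fun x => qmul x (u x)) by apply: rsmooth_qmul => //; exact: rsmooth_id.
have [s3 s4] := csmooth_z sm.
rewrite /emb; move: i; case: b; apply: forall_ord4; (apply: csmooth_eq oU _ _; first by move=> x _; rewrite cvecE).
all: by [].
Qed.

Lemma csmooth_qf U (u w : R4 -> R4) b : open U -> rsmooth U u -> rsmooth U w ->
  csmooth U (fun x => qf A b x (u x) (w x)).
Proof.
move=> oU su sw.
apply: (@csmooth_eq _ _ (fun x => \sum_i \sum_j emb b x (u x) ord0 i * A i j * emb b x (w x) ord0 j)) => //.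
  by move=> x _; rewrite /qf bil_sum.
apply: csmooth_sum => // i; apply: csmooth_sum => // j.
apply: csmoothM => //; last exact: csmooth_emb.
by apply: csmoothM => //; [exact: csmooth_emb|exact: csmooth_cst].
Qed.

Lemma csmooth_q U b : open U -> [/\ csmooth U (q11 A b), csmooth U (q12 A b) & csmooth U (q22 A b)].
Proof. by move=> oU; split; apply: csmooth_qf => //; exact: rsmooth_cst. Qed.

Lemma csmooth_disc U b : open U -> csmooth U (disc A b).
Proof.
move=> oU; have [s1 s2 s3] := csmooth_q b oU.
by apply: csmoothB => //; exact: csmoothM.
Qed.

Definition slit_dom b : set R4 := [set x | slit (disc A b x)].

Lemma open_slit_dom b : open (slit_dom b).
Proof.
have [s1 s2] := csmooth_disc b openT.
have oI : open (setT `&` (fun x => complex.Im (disc A b x)) @^-1` [set r : R | r != 0]).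
  apply: open_preimage; [exact: openT| |exact: open_neq].
  by move=> x _; apply: differentiable_continuous; exact: smooth_on_differentiable s2 _.
have oR : open (setT `&` (fun x => complex.Re (disc A b x)) @^-1` [set r : R | 0 < r]).
  apply: open_preimage; [exact: openT| |exact: open_gt].
  by move=> x _; apply: differentiable_continuous; exact: smooth_on_differentiable s1 _.
have -> : slit_dom b = (setT `&` (fun x => complex.Im (disc A b x)) @^-1` [set r : R | r != 0])
   `|` (setT `&` (fun x => complex.Re (disc A b x)) @^-1` [set r : R | 0 < r]).
  apply/seteqP; split=> x; rewrite /slit_dom /slit /=.
    by case/orP=> H; [left|right].
  by case=> [[_ ->]|[_ ->]]; rewrite ?orbT.
exact: openU.
Qed.

(** The root wanted is one of - disc, whereas it is disc that avoids the cut; hence the factor i. *)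
Definition tau b x : C := ii R * csqrt (disc A b x).
Definition stau s b x : C := if s then - tau b x else tau b x.

Lemma stau_sqr s b x : slit_dom b x -> stau s b x * stau s b x = - disc A b x.
Proof.
move=> sx; have -> : stau s b x * stau s b x = tau b x * tau b x.
  by rewrite /stau; case: s; rewrite ?mulrNN.
by rewrite /tau mulrACA ii_sqr csqrt_sqr // mulN1r.
Qed.

Lemma stau_neq0 s b x : slit_dom b x -> stau s b x != 0.
Proof.
move=> sx; have c0 : csqrt (disc A b x) != 0.
  by apply/eqP => E; have := csqrt_Re_gt0 sx; rewrite E ltxx.
by rewrite /stau; case: s; rewrite ?oppr_eq0 mulf_neq0 // ii_neq0.
Qed.

Lemma csmooth_stau s b : csmooth (slit_dom b) (stau s b).
Proof.
have oW := @open_slit_dom b.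
have st : csmooth (slit_dom b) (tau b).
  apply: csmoothM => //; first exact: csmooth_cst.
  by apply: csmooth_csqrt => //; exact: csmooth_disc.
by rewrite /stau; case: s => //; exact: csmoothN.
Qed.

Lemma wedge_scale_qi (u m : R4) : wedge u (qmul m qi) = ii R * wedge u m.
Proof. by rewrite /wedge z1_qi z2_qi; ring. Qed.

Lemma emb_hopf b (u h : R4) : u != 0 ->
  pad b (qmul (qmul h (hopf u)) u) = ii R *: pad b (qmul h u).
Proof. by move=> u0; rewrite -pad_qi -qmulA hopf_mul // qmulA. Qed.

Lemma ord4_cases (i : 'I_4) : [\/ i = 0, i = 1, i = 2 | i = 3].
Proof.
move: i; apply: forall_ord4; [exact: Or41|exact: Or42|exact: Or43|exact: Or44].
Qed.

Lemma cD_emb (u : R4 -> R4) b x h i : differentiable u x ->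
  cdiff (fun y => emb b y (u y) ord0 i) x /\
  cD h (fun y => emb b y (u y) ord0 i) x = (emb b x ('D_h u x) + pad b (qmul h (u x))) ord0 i.
Proof.
move=> du.
have did : differentiable (@id R4) x by exact: (rsmooth_diff (@rsmooth_id R setT) I).
have [dm Dm] := derive_qmul h did du; rewrite derive_id in Dm.
have [c1 D1 c2 D2] := cD_z h du.
have [c3 D3 c4 D4] := cD_z h dm; rewrite Dm in D3 D4.
have H (G F : R4 -> C) c : G = F -> cdiff F x -> cD h F x = c -> cdiff G x /\ cD h G x = c.
  by move=> ->.
have E : (emb b x ('D_h u x) + pad b (qmul h (u x))) ord0 i =
   emb b x ('D_h u x) ord0 i + pad b (qmul h (u x)) ord0 i by rewrite mxE.
rewrite {}E /emb /pad; case: b; have [Ei|Ei|Ei|Ei] := ord4_cases i; rewrite Ei.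
- apply: H c3 _; first by apply/funext => y; rewrite cvecE.
  by rewrite !cvecE D3 z1D addrC.
- apply: H c4 _; first by apply/funext => y; rewrite cvecE.
  by rewrite !cvecE D4 z2D addrC.
- apply: H c1 _; first by apply/funext => y; rewrite cvecE.
  by rewrite !cvecE D1 z1_0 addr0.
- apply: H c2 _; first by apply/funext => y; rewrite cvecE.
  by rewrite !cvecE D2 z2_0 addr0.
- apply: H c1 _; first by apply/funext => y; rewrite cvecE.
  by rewrite !cvecE D1 z1_0 addr0.
- apply: H c2 _; first by apply/funext => y; rewrite cvecE.
  by rewrite !cvecE D2 z2_0 addr0.
- apply: H c3 _; first by apply/funext => y; rewrite cvecE.
  by rewrite !cvecE D3 z1D addrC.
- apply: H c4 _; first by apply/funext => y; rewrite cvecE.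
  by rewrite !cvecE D4 z2D addrC.
Qed.

Lemma cD_qf (u : R4 -> R4) b x h : differentiable u x ->
  cD h (fun y => qf A b y (u y) (u y)) x =
  2 * bil A (emb b x (u x)) (emb b x ('D_h u x) + pad b (qmul h (u x))).
Proof.
move=> du; set V := emb b x (u x); set dV := _ + _.
have c1 i : cdiff (fun y => emb b y (u y) ord0 i) x by have [] := cD_emb b h i du.
have D1 i : cD h (fun y => emb b y (u y) ord0 i) x = dV ord0 i by have [] := cD_emb b h i du.
have -> : (fun y => qf A b y (u y) (u y)) =
   (fun y => \sum_i \sum_j emb b y (u y) ord0 i * A i j * emb b y (u y) ord0 j).
  by apply/funext => y; rewrite /qf bil_sum.
have c2 i j : cdiff (fun y => emb b y (u y) ord0 i * A i j * emb b y (u y) ord0 j) x.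
  by apply: cdiffM => //; apply: cdiffM => //; exact: cdiff_cst.
have c3 i : cdiff (fun y => \sum_j emb b y (u y) ord0 i * A i j * emb b y (u y) ord0 j) x.
  by have [] := cD_sum h (c2 i).
have [-> _] := cD_sum h c3.
rewrite mulr2n mulrDl !mul1r {1}(bilC symA) !bil_sum -big_split; apply: eq_bigr => i _.
have [-> _] := cD_sum h (c2 i).
rewrite -big_split; apply: eq_bigr => j _ /=.
rewrite (cDM h (cdiffM (c1 i) (cdiff_cst (A i j) x)) (c1 j)) (cDM h (c1 i) (cdiff_cst (A i j) x)).
by rewrite cD_cst !D1 mulr0 addr0.
Qed.

(* Differentiating A(v, v) = 0 along v = emb b x (u x). *)
Lemma isroot_derivative U (u : R4 -> R4) b (t : R4 -> C) x h : open U -> U x ->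
  (forall y, U y -> isroot A b y (t y) (u y)) -> differentiable u x ->
  t x * wedge (u x) ('D_h u x) = bil A (emb b x (u x)) (pad b (qmul h (u x))).
Proof.
move=> oU Ux ru du.
have E : cD h (fun y => qf A b y (u y) (u y)) x = 0.
  rewrite -(cD_cst h 0 x); apply: near_eq_cD; apply: (near_of_open oU Ux) => y Uy.
  exact: isroot_null (ru y Uy).
move/eqP: E; rewrite cD_qf // mulf_eq0 (negPf (two_neq0 R)) /= (bilDr symA).
have -> : bil A (emb b x (u x)) (emb b x ('D_h u x)) = - t x * wedge (u x) ('D_h u x).
  exact: (ru x Ux).
by rewrite mulNr addrC subr_eq0 => /eqP.
Qed.

(** Replacing h by h [hopf u] multiplies h u, and so the right-hand side of [isroot_derivative], by
    i, because the quadric is complex bilinear. Division by t <> 0 gives the (1,0) condition. *)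
Lemma wedge_holomorphic U (u : R4 -> R4) b (t : R4 -> C) x h : open U -> U x ->
  (forall y, U y -> isroot A b y (t y) (u y)) -> differentiable u x ->
  t x != 0 -> u x != 0 ->
  wedge (u x) ('D_(qmul h (hopf (u x))) u x - qmul ('D_h u x) qi) = 0.
Proof.
move=> oU Ux ru du t0 u0; apply: (mulfI t0).
have wB (a m m' : R4) : wedge a (m - m') = wedge a m - wedge a m'.
  by rewrite /wedge !(z1D, z2D, z1N, z2N); ring.
have e1 := isroot_derivative h oU Ux ru du.
have e2 := isroot_derivative (qmul h (hopf (u x))) oU Ux ru du.
rewrite emb_hopf // (bilZr symA) -e1 in e2.
by rewrite wB wedge_scale_qi mulrBr e2 mulrCA subrr mulr0.
Qed.

Lemma OCS_isroot U (u : R4 -> R4) b (t : R4 -> C) : open U -> rsmooth U u ->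
  (forall y, U y -> isroot A b y (t y) (u y)) ->
  (forall y, U y -> t y != 0) -> (forall y, U y -> u y != 0) ->
  OCS_in_chart U (fun x => Rmat (hopf (u x))).
Proof.
move=> oU su ru t0 u0; apply: OCS_hopf => // x h Ux.
apply: (wedge_holomorphic h oU Ux ru); [exact: rsmooth_diff su Ux|exact: t0|exact: u0].
Qed.

Definition Jloc s b x : 'M[R]_4 := Rmat (hopf (rootvec A b x (stau s b x))).

Lemma Jloc_isroot s b x u : slit_dom b x -> u != 0 -> isroot A b x (stau s b x) u ->
  Rmat (hopf u) = Jloc s b x.
Proof.
move=> Wx u0 ru; rewrite /Jloc; congr Rmat; apply: (isroot_hopf symA (stau_neq0 s Wx)) => //.
  by apply: rootvec_neq0; [exact: stau_sqr|exact: stau_neq0].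
by apply: isrootvec => //; exact: stau_sqr.
Qed.

(** The domains where [rootv1] and [rootv2] are nonzero cover everything, and on each of them the
    smooth formula gives the same matrix as [Jloc]. *)
Lemma Jloc_OCS s b : OCS_in_chart (slit_dom b) (Jloc s b).
Proof.
have oW := @open_slit_dom b.
have [s1 s2 s3] := csmooth_q b oW.
have st := csmooth_stau s b.
have sr1 : rsmooth (slit_dom b) (fun x => rootv1 A b x (stau s b x)).
  apply: rsmooth_quat => //; apply: csmoothD => //; exact: csmoothN.
have sr2 : rsmooth (slit_dom b) (fun x => rootv2 A b x (stau s b x)).
  apply: rsmooth_quat => //; apply: csmoothB => //; exact: csmoothN.
have H (u : R4 -> R4) : rsmooth (slit_dom b) u ->
    (forall y, slit_dom b y -> isroot A b y (stau s b y) (u y)) ->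
    open (slit_dom b `&` u @^-1` [set z | z != 0]) /\
    OCS_in_chart (slit_dom b `&` u @^-1` [set z | z != 0]) (Jloc s b).
  move=> su ru.
  have oU : open (slit_dom b `&` u @^-1` [set z | z != 0]).
    by apply: open_preimage => //; [move=> x; exact: rsmooth_continuous|exact: open_neq0].
  split=> //; apply: (@OCS_in_chart_eq _ _ (fun x => Rmat (hopf (u x)))) => //.
    by move=> x [Wx /= ux]; apply: Jloc_isroot => //; exact: ru.
  apply: (@OCS_isroot _ u b (stau s b)) => //.
  - by apply: rsmooth_sub su => x [].
  - by move=> y [Wy _]; exact: ru.
  - by move=> y [Wy _]; exact: stau_neq0.
  - by move=> y [].
have [_ O1] := H _ sr1 (fun y Wy => isroot1 symA (stau_sqr s Wy)).
have [_ O2] := H _ sr2 (fun y Wy => isroot2 symA (stau_sqr s Wy)).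
apply: OCS_in_chart_local => x Wx.
have [r0|r0] := eqVneq (rootv1 A b x (stau s b x)) 0.
  exists (slit_dom b `&` (fun x => rootv2 A b x (stau s b x)) @^-1` [set z | z != 0]) => //.
  split; [by move=> y []|split=> //].
  exact: rootv2_neq0 (stau_sqr s Wx) (stau_neq0 s Wx) r0.
exists (slit_dom b `&` (fun x => rootv1 A b x (stau s b x)) @^-1` [set z | z != 0]) => //.
Qed.

End QuadricChart.

(** * The two structures off the branch cut *)

Section SphereTopology.
Variable R : realType.
Local Notation R4 := 'rV[R]_4.
Implicit Types (x y : R4) (b : bool).

Lemma coord_le_norm x i : `|x ord0 i| <= `|x|.
Proof.
rewrite [leRHS]/Num.Def.normr /= mx_normrE.
exact: (le_bigmax _ (fun ij : 'I_1 * 'I_4 => `|x ij.1 ij.2|) (ord0, i)).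
Qed.

Lemma dot_le_norm x : dot x x <= 4 * `|x| ^+ 2.
Proof.
have H i : x ord0 i * x ord0 i <= `|x| ^+ 2.
  by rewrite -expr2 -real_normK ?num_real // ler_sqr ?nnegrE // coord_le_norm.
by rewrite dotE; have := (H 0, H 1, H 2, H 3) => -[[[h0 h1] h2] h3]; lra.
Qed.

Lemma norm_le_dot x : `|x| ^+ 2 <= dot x x.
Proof.
have [->|n0] := eqVneq (`|x|) 0; first by rewrite expr0n dot_ge0.
have [[i j] /= E] : exists i, `|x| = `|x i.1 i.2| by apply: mx_norm_neq0.
rewrite E real_normK ?num_real // dotE (ord1 i).
have := (sqr_ge0 (x ord0 0), sqr_ge0 (x ord0 1), sqr_ge0 (x ord0 2), sqr_ge0 (x ord0 3)).
rewrite !expr2 => -[[[h0 h1] h2] h3].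
by case: (ord4_cases j) => ->; lra.
Qed.

Lemma dot_qinv x : dot (qinv x) (qinv x) = (dot x x)^-1.
Proof.
have [->|x0] := eqVneq x 0; first by rewrite qinv0 dotE !mxE !mul0r !addr0 invr0.
have d0 : dot x x != 0 by rewrite dot_eq0.
apply: (mulfI d0); rewrite -dot_qmul qmulV // mulfV //.
by rewrite dotE !quatE /=; ring.
Qed.

Lemma chartT_neq0 y : y != 0 -> chart true y = pt (qinv y).
Proof. by move=> y0; rewrite /chart /inversion /pt (negPf y0). Qed.

Lemma chartT_0 : chart true (0 : R4) = infty R.
Proof. by rewrite /chart /inversion /pt eqxx. Qed.

Lemma chart_continuous b : continuous (@chart R b).
Proof.
move=> y; case: b; last exact: one_point_compactification_some_continuous.
have [->|y0] := eqVneq y 0.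
  rewrite /continuous_at chartT_0 => O [C [cC _] CO].
  have [M [Mr MC]] := compact_bounded cC.
  pose K := `|M| + 1.
  have K0 : 0 < K by rewrite /K ltr_wpDl.
  have CK x : C x -> `|x| <= K.
    by apply: MC; rewrite /K (le_lt_trans (ler_norm _)) // ltrDl.
  (* The norm is the maximum norm, and [dot x x] is at most four times its square. Applied to z and
     to z^-1, this gives 1 <= 4 |z| |z^-1|, which fails if |z| < 1 / (4 K) and |z^-1| <= K. *)
  apply/nbhs_ballP; exists (4 * K)^-1; first by rewrite /= invr_gt0 mulr_gt0.
  move=> z; rewrite -ball_normE /= sub0r normrN => zK.
  suff : O (chart true z) by [].
  have [->|z0] := eqVneq z 0; first by rewrite chartT_0; apply: CO; right.
  rewrite chartT_neq0 //; apply: CO; left; exists (qinv z) => //= Cz.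
  have qK := CK _ Cz.
  have d0 := dot_gt0 z0.
  have h1 : (dot z z)^-1 <= 4 * `|qinv z| ^+ 2 by rewrite -dot_qinv dot_le_norm.
  have h2 : dot z z <= 4 * `|z| ^+ 2 by exact: dot_le_norm.
  have z0' : 0 < `|z| by rewrite normr_gt0.
  have h3 : `|z| * (4 * K) < 1 by rewrite -ltr_pdivlMr ?mulr_gt0 // mul1r.
  have h4 : 1 <= dot z z * (4 * `|qinv z| ^+ 2).
    by rewrite -ler_pdivrMl // mulr1.
  have h5 : dot z z * (4 * `|qinv z| ^+ 2) <= (`|z| * (4 * `|qinv z|)) ^+ 2.
    rewrite (_ : (_ * _) ^+ 2 = 4 * `|z| ^+ 2 * (4 * `|qinv z| ^+ 2)); last by ring.
    by rewrite ler_wpM2r // mulr_ge0 // sqr_ge0.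
  have h6 : `|z| * (4 * `|qinv z|) < 1.
    by apply: le_lt_trans h3; rewrite ler_pM2l // ler_pM2l.
  have : (`|z| * (4 * `|qinv z|)) ^+ 2 < 1 by rewrite expr_lt1 // ?mulr_ge0.
  by rewrite ltNge (le_trans h4 h5).
rewrite /continuous_at chartT_neq0 //.
have [dq _] := derive_qinv 0 y0.
have cq : {for y, continuous (fun z : R4 => pt (qinv z))}.
  apply: (@continuous_comp _ _ _ (@qinv R) (@pt R)); first exact: differentiable_continuous.
  exact: one_point_compactification_some_continuous.
have ef : \near y, pt (qinv y) = chart true y.
  by apply: (near_of_open (@open_neq0 R) y0) => z z0; rewrite chartT_neq0.
exact: cvg_trans (near_eq_cvg ef) cq.
Qed.

Lemma open_chart (O : set (S4 R)) : (forall b, open (chart b @^-1` O)) -> open O.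
Proof.
move=> oO; rewrite openE => -[x|] Ox.
  have := oO false; rewrite openE => /(_ x Ox) /one_point_compactification_some_nbhs.
  by apply: filterS => z [w Hw <-].
have O0 : O (chart true 0) by rewrite chartT_0.
have := oO true; rewrite openE => /(_ 0 O0) /nbhs_ballP [e /= e0 He].
(* Outside this ball the inverse has norm below e, since |x| |x^-1| <= 1 for the maximum norm. *)
exists [set x | `|x| <= 2 / e].
  have cl : closed [set x : R4 | `|x| <= 2 / e].
    rewrite (_ : mkset _ = (fun x : R4 => `|x|) @^-1` [set r | r <= 2 / e]) //.
    by apply: closed_comp; [move=> x _; exact: norm_continuous|exact: closed_le].
  split=> //; apply: bounded_closed_compact => //.
  exists (2 / e); split; first exact: num_real.
  by move=> M HM x /= Hx; rewrite (le_trans Hx) // ltW.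
move=> _ [[x /= Hx <-]|-> //].
have x0 : x != 0.
  by apply/eqP => E; apply: Hx; rewrite E normr0 divr_ge0 // ltW.
have : O (chart true (qinv x)).
  apply: (He (qinv x)); rewrite -ball_normE /= sub0r normrN.
  have d0 := dot_gt0 x0.
  have n0 : 0 < `|x| by rewrite normr_gt0.
  have h1 : (`|qinv x| * `|x|) ^+ 2 <= 1.
    rewrite exprMn -(@mulVf _ (dot x x)) ?gt_eqF // -dot_qinv.
    by rewrite ler_pM ?sqr_ge0 ?norm_le_dot.
  have h2 : `|qinv x| * `|x| <= 1 by rewrite -(@expr_le1 _ 2) // mulr_ge0.
  move/negP: Hx; rewrite -ltNge => Hx.
  have h3 : 2 < `|x| * e by rewrite -ltr_pdivrMr.
  rewrite ltNge; apply/negP => h4.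
  have : `|x| * e <= `|x| * `|qinv x| by rewrite ler_pM2l.
  by rewrite (mulrC _ `|qinv x|); lra.
by rewrite chartT_neq0 ?qinv_neq0 // qinvK.
Qed.

End SphereTopology.

(** * Gluing the two charts *)

Section QuadricGlobal.
Variable R : realType.
Local Notation C := R[i].
Local Notation R4 := 'rV[R]_4.
Variable A : 'M[C]_4.
Hypothesis symA : A^T = A.
Implicit Types (U : set R4) (p q u w h x y : R4) (s b : bool) (t : C).
Local Notation qone := (qone R).
Local Notation qj := (qj R).

Lemma emb_chart y w : y != 0 -> emb true y w = emb false (qinv y) (qmul y w).
Proof. by move=> y0; rewrite /emb qmulKl. Qed.

Lemma qf_chart y u w : y != 0 ->
  qf A true y u w = qf A false (qinv y) (qmul y u) (qmul y w).
Proof. by move=> y0; rewrite /qf !emb_chart. Qed.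

Lemma dot_conj q : real_complex R (dot q q) = z1 q * conjc (z1 q) + z2 q * conjc (z2 q).
Proof. by apply: complex_ext; rewrite ?dotE !(cReD, cReM, cImD, cImM) /=; ring. Qed.

Lemma wedge_qmul y u w : wedge (qmul y u) (qmul y w) = real_complex R (dot y y) * wedge u w.
Proof.
by rewrite dot_conj /wedge !(z1_qmul, z2_qmul); ring.
Qed.

Lemma gram_disc b x u w :
  qf A b x u u * qf A b x w w - qf A b x u w * qf A b x u w = wedge u w ^+ 2 * disc A b x.
Proof. by rewrite !(qfE symA) /wedge /disc; ring. Qed.

(** The change of chart acts on the fibre by left multiplication by y, of complex determinant |y|^2.
    A Gram determinant scales by its square, which is positive, so the cut is well defined on the
    sphere. *)
Lemma disc_chart y : y != 0 ->
  disc A true y = real_complex R (dot y y ^+ 2) * disc A false (qinv y).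
Proof.
move=> y0; rewrite /disc /q11 /q22 /q12 !qf_chart // gram_disc wedge_qmul rmorphXn.
rewrite (_ : wedge qone qj = 1) ?mulr1 //.
by rewrite /wedge !(z1_quat, z2_quat); ring.
Qed.

(** Only its class modulo positive factors is independent of the chart, and [slit] sees nothing
    more. *)
Definition gdisc (p : S4 R) : C := if p is Some q then disc A false q else disc A true 0.

Definition branch_cut : set (S4 R) := [set p | ~~ slit (gdisc p)].

Lemma slit_chart b x : slit (gdisc (chart b x)) = slit (disc A b x).
Proof.
case: b => //; have [->|x0] := eqVneq x 0; first by rewrite chartT_0.
have d0 := dot_gt0 x0.
rewrite (chartT_neq0 x0) (disc_chart x0) slit_scale; [exact: erefl|exact: exprn_gt0].
Qed.

Lemma chart_slit_dom b : chart b @^-1` (~` branch_cut) = slit_dom A b.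
Proof.
apply/seteqP; split=> x; rewrite /slit_dom /branch_cut /= slit_chart.
  by move/negP; rewrite negbK.
by move=> ->.
Qed.

Lemma open_complement : open (~` branch_cut).
Proof. by apply: open_chart => b; rewrite chart_slit_dom; exact: open_slit_dom. Qed.

Definition Jglob s (p : S4 R) : 'M[R]_4 :=
  if p is Some q then Jloc A s false q else Jloc A s true 0.

(** The principal root commutes with positive scaling, so the labels of the two zeros agree in both
    charts; this is what makes each structure global. *)
Lemma tau_chart s y : y != 0 -> slit_dom A true y ->
  stau A s true y = real_complex R (dot y y) * stau A s false (qinv y).
Proof.
move=> y0 sy; have sq : slit (disc A false (qinv y)).
  by move: sy; rewrite /slit_dom /= -slit_chart chartT_neq0.
have E b x : stau A s b x = (if s then -1 else 1) * (ii R * csqrt (disc A b x)).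
  by rewrite /stau /tau; case: s; rewrite ?mulN1r ?mul1r.
rewrite !E disc_chart // csqrt_scale ?dot_gt0 //.
by ring.
Qed.

Lemma hopf_qmul y w : y != 0 -> w != 0 -> hopf (qmul y w) = qmul (qmul y (hopf w)) (qinv y).
Proof. by move=> y0 w0; rewrite /hopf qinvM // !qmulA. Qed.

Lemma mul_jacobian_qinv y h : y != 0 ->
  h *m jacobian (@qinv R) y = - qmul (qinv y) (qmul h (qinv y)).
Proof.
by move=> y0; have [dq Dq] := derive_qinv h y0; rewrite -deriveEjacobian.
Qed.

Lemma qmul_conjugate x h m : x != 0 ->
  qmul x (qmul (qmul (qmul (qinv x) (qmul h (qinv x))) (qmul (qmul x m) (qinv x))) x) = qmul h m.
Proof. by move=> x0; rewrite -!qmulA qmulVl // qmul1r qmulKl // qmulVKl. Qed.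

(** The zero w in the second chart is x w in the first one, and [hopf (x w)] is x (hopf w) x^-1. The
    differential of the inversion, h -> - x^-1 h x^-1, undoes this conjugation. *)
Lemma in_chart_Jglob s b x : slit_dom A b x -> in_chart b (Jglob s) x = Jloc A s b x.
Proof.
case: b => // sx; rewrite /in_chart; have [->|x0] // := eqVneq x 0.
have qx0 := qinv_neq0 x0.
have sq : slit_dom A false (qinv x).
  by move: sx; rewrite /slit_dom /= -slit_chart chartT_neq0.
rewrite /Jglob /pt.
set w := rootvec A true x (stau A s true x).
have w0 : w != 0 by apply: rootvec_neq0; [exact: stau_sqr|exact: stau_neq0].
have rw : isroot A true x (stau A s true x) w by apply: isrootvec => //; exact: stau_sqr.
have r2 : isroot A false (qinv x) (stau A s false (qinv x)) (qmul x w).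
  move=> v; rewrite -(qmulVKl v x0); move: (qmul (qinv x) v) => v'.
  by rewrite -(qf_chart w v' x0) (rw v') (tau_chart s x0 sx) (wedge_qmul x w v'); ring.
rewrite -(Jloc_isroot symA sq _ r2); last by rewrite qmul_eq0 negb_or x0.
rewrite /Jloc -/w; apply: mx4_ext => h.
rewrite !mulmxA mul_jacobian_qinv // !mul_Rmat mul_jacobian_qinv // qinvK hopf_qmul //.
by rewrite !qmulNl !qmulNr opprK qmul_conjugate.
Qed.

Lemma Jglob_OCS s : OCS (~` branch_cut) (Jglob s).
Proof.
split=> [|b]; first exact: open_complement.
rewrite chart_slit_dom; apply: OCS_in_chart_eq (@open_slit_dom _ A b) _ (Jloc_OCS symA s b).
by move=> x sx; rewrite in_chart_Jglob.
Qed.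

Lemma homog_neq0 (L : CP3 R) : homog L != 0.
Proof.
rewrite /homog; case: L => L /= dL; apply: contraTneq dL => /eqP.
by rewrite vpick0 => /eqP ->; rewrite dimv0.
Qed.

Lemma homogE (L : CP3 R) :
  homog L = cvec (quat (xi0 L) (xi12 L)) (quat (W1 L) (W2 L)).
Proof. by apply: row4_ext; rewrite cvecE ?z1_quat ?z2_quat. Qed.

Lemma Jloc_param b x u : slit_dom A b x -> u != 0 ->
  qf A b x u u = 0 <->
  has_parameter (Jloc A false b x) (z1 u) (z2 u) \/ has_parameter (Jloc A true b x) (z1 u) (z2 u).
Proof.
move=> sx u0.
have t0 s : stau A s b x != 0 by exact: stau_neq0.
have tt s := stau_sqr s sx.
have r0 s : rootvec A b x (stau A s b x) != 0 by exact: rootvec_neq0.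
have rr s : isroot A b x (stau A s b x) (rootvec A b x (stau A s b x)) by exact: isrootvec.
have H s : has_parameter (Jloc A s b x) (z1 u) (z2 u) <-> wedge (rootvec A b x (stau A s b x)) u = 0.
  by rewrite -[X in wedge _ X]quatK; apply: has_parameter_hopf; rewrite ?quatK.
split=> [F|]; last by case=> /H E; apply: (wedge_isroot symA (r0 _) (rr _) E).
have [ru|ru] := null_isroot symA (tt false) (t0 false) F; [left|right]; apply/H.
  exact: isroot_wedge (t0 false) (rr false) ru.
exact: isroot_wedge (t0 true) (rr true) ru.
Qed.

Lemma bil_mx_eq0 (v w : 'rV[C]_4) : v *m A *m w^T = 0 <-> bil A v w = 0.
Proof.
split=> [E|E]; first by rewrite /bil E mxE.
by apply/matrixP => i j; rewrite (ord1 i) (ord1 j) [RHS]mxE.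
Qed.

Lemma graph_Jglob :
  quadric A `&` @twistor_proj R @^-1` (~` branch_cut) =
  graph (~` branch_cut) (Jglob false) `|` graph (~` branch_cut) (Jglob true).
Proof.
have main (L : CP3 R) : (~` branch_cut) (twistor_proj L) ->
    (quadric A L <-> corresponds L (Jglob false (twistor_proj L)) \/
                     corresponds L (Jglob true (twistor_proj L))).
  rewrite /corresponds /quadric /= bil_mx_eq0 homogE.
  rewrite /twistor_proj; set u := quat (xi0 L) (xi12 L); set w := quat (W1 L) (W2 L).
  have uw0 : ~ (u = 0 /\ w = 0).
    move=> [e1 e2]; have := homog_neq0 L; rewrite homogE -/u -/w e1 e2 => /eqP; apply.
    by apply: row4_ext; rewrite cvecE ?z1_0 ?z2_0 mxE.
  (* For u = 0 the point lies over infinity, whose fibre is that of [chart true] at the origin. *)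
  have [u0|u0] := eqVneq u 0.
    have w0 : w != 0 by apply/eqP => w0; exact: uw0.
    move=> sx; have -> : cvec u w = emb true 0 w by rewrite /emb u0 qmul0l.
    have sx0 : slit_dom A true 0 by rewrite -chart_slit_dom -[_ 0]/((~` branch_cut) (chart true 0)) chartT_0.
    have := Jloc_param sx0 w0; rewrite z1_quat z2_quat. exact.
  move=> sx; have -> : cvec u w = emb false (qmul w (qinv u)) u by rewrite /emb qmulVKr.
  have sx0 : slit_dom A false (qmul w (qinv u)) by rewrite -chart_slit_dom.
  have := Jloc_param sx0 u0; rewrite z1_quat z2_quat; exact.
apply/seteqP; split=> L /=.
  by move=> [QL TL]; have /main [/(_ QL)] := TL; case=> H _; [left|right].
by case=> -[TL cL]; split=> //; apply/(main _ TL); auto.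
Qed.

(** Equal structures would make one nonzero w a root for both t and - t, so that its product with
    every vector under [wedge] would vanish. *)
Lemma Jglob_neq (p : S4 R) : (~` branch_cut) p -> Jglob false p <> Jglob true p.
Proof.
have H b x : slit_dom A b x -> Jloc A false b x <> Jloc A true b x.
  move=> sx /Rmat_inj E.
  have t0 s : stau A s b x != 0 by exact: stau_neq0.
  have tt s := stau_sqr s sx.
  have r0 s : rootvec A b x (stau A s b x) != 0 by exact: rootvec_neq0.
  have rr s : isroot A b x (stau A s b x) (rootvec A b x (stau A s b x)) by exact: isrootvec.
  set u := rootvec A b x (stau A false b x) in E.
  set w := rootvec A b x (stau A true b x) in E.
  have [uw _] : wedge u w = 0 /\ w != 0.
    by apply/(wedge_eq0 w (r0 false)); split; [exact/esym|exact: r0].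
  have F v : qf A b x w v = - stau A false b x * wedge w v.
    have [c ->] : exists c : C, w = qmul u (quat c 0).
      exists (z1 (qmul (qinv u) w)).
      by rewrite -(z2_qinv_mul uw) quatK qmulVKl // r0.
    transitivity (c * qf A b x u v).
      by rewrite !(qfE symA) !(z1_qmul, z2_qmul) !(z1_quat, z2_quat); ring.
    by rewrite (rr false) /wedge !(z1_qmul, z2_qmul) !(z1_quat, z2_quat); ring.
  have Z v : wedge w v = 0.
    have := F v; rewrite (rr true) => E2.
    have /eqP : (2 * stau A false b x) * wedge w v = 0.
      have -> : stau A false b x = - stau A true b x by rewrite /stau opprK.
      rewrite (_ : _ * _ = - stau A true b x * wedge w v - (- stau A false b x) * wedge w v).
        by rewrite E2 subrr.
      by rewrite /stau; ring.
    by rewrite mulf_eq0 => /orP[|/eqP //]; rewrite mulf_eq0 (negPf (two_neq0 R)) (negPf (t0 false)).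
  have /eqP := r0 true; apply; rewrite -/w; apply: quat_ext; rewrite ?z1_0 ?z2_0.
    by have := Z qj; rewrite /wedge z1_quat z2_quat mulr1 mulr0 subr0.
  by have := Z qone; rewrite /wedge z1_quat z2_quat mulr1 mulr0 sub0r => /eqP; rewrite oppr_eq0 => /eqP.
case: p => [x|] Tp; apply: H.
  by rewrite -chart_slit_dom.
by rewrite -chart_slit_dom -[_ 0]/((~` branch_cut) (chart true 0)) chartT_0.
Qed.

End QuadricGlobal.

(** * Normal form of the quadric *)

Section NormalForm.
Variable R : realType.
Local Notation C := R[i].
Implicit Types (v w e f g : 'rV[C]_4) (a b c d k : C).

Lemma rcM (x y : R) : real_complex R (x * y) = real_complex R x * real_complex R y.
Proof. exact: rmorphM. Qed.
Lemma rcB (x y : R) : real_complex R (x - y) = real_complex R x - real_complex R y.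
Proof. exact: rmorphB. Qed.
Lemma rcD (x y : R) : real_complex R (x + y) = real_complex R x + real_complex R y.
Proof. exact: rmorphD. Qed.
Lemma rcV (x : R) : real_complex R x^-1 = (real_complex R x)^-1.
Proof. exact: fmorphV. Qed.
Lemma rc_eq0 (x : R) : (real_complex R x == 0) = (x == 0).
Proof. exact: fmorph_eq0. Qed.

Lemma quadratic_cast (S n x : R) : S * x ^+ 2 + n * x - 1 = 0 ->
  real_complex R S * real_complex R x ^+ 2 = 1 - real_complex R n * real_complex R x.
Proof.
move=> /eqP; rewrite subr_eq0 => /eqP E; rewrite -[1]/(real_complex R 1) -E rcD !expr2 !rcM.
by ring.
Qed.

(** Right multiplication by j on C^4 = H^2, an antilinear map of square -1. Its invariant complex
    planes are the twistor lines. *)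
Definition rmulj v : 'rV[C]_4 := \row_(k < 4) nth 0
  [:: - conjc (v ord0 1); conjc (v ord0 0); - conjc (v ord0 3); conjc (v ord0 2)] k.

Lemma rmuljE v : (rmulj v ord0 0 = - conjc (v ord0 1)) * (rmulj v ord0 1 = conjc (v ord0 0)) *
  (rmulj v ord0 2 = - conjc (v ord0 3)) * (rmulj v ord0 3 = conjc (v ord0 2)).
Proof. by rewrite !mxE. Qed.

Lemma rmuljD v w : rmulj (v + w) = rmulj v + rmulj w.
Proof. by apply: row4_ext; rewrite !(rmuljE, mxE) ?conjD ?opprD. Qed.
Lemma rmuljZ k v : rmulj (k *: v) = conjc k *: rmulj v.
Proof. by apply: row4_ext; rewrite !(rmuljE, mxE) ?conjM ?mulrN. Qed.
Lemma rmuljK v : rmulj (rmulj v) = - v.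
Proof. by apply: row4_ext; rewrite !(rmuljE, mxE) ?conjN ?conjcK. Qed.

Definition jmx : 'M[C]_4 := \matrix_(i, j) rmulj (delta_mx ord0 i) ord0 j.

Lemma rmulj_mx v : rmulj v = map_mx (@conjc R) v *m jmx.
Proof.
have jE i j : jmx i j = rmulj (delta_mx ord0 i) ord0 j by rewrite mxE.
have e0 : (0 -i* 0 : C) = 0 by rewrite oppr0.
have e1 : (1 -i* 0 : C) = 1 by rewrite oppr0.
by apply: row4_ext; rewrite [RHS]mxE sum_ord4 !jE !(rmuljE, mxE) /= ?e0 ?e1; ring.
Qed.

Section Form.
Variable A : 'M[C]_4.
Hypothesis symA : A^T = A.
Local Notation B := (bil A).

Lemma bilNl v w : B (- v) w = - B v w.
Proof. by rewrite -scaleN1r bilZl mulN1r. Qed.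
Lemma bilNr v w : B v (- w) = - B v w.
Proof. by rewrite -scaleN1r (bilZr symA) mulN1r. Qed.

(** A Takagi factorisation in dimension two: a complex symmetric form is diagonal in some basis v,
    jv of the quaternionic line. In terms of w = conj c it is one complex equation, solved
    explicitly. *)
Lemma quaternionic_line_diag g : exists c, B (g + c *: rmulj g) (rmulj (g + c *: rmulj g)) = 0.
Proof.
set a := B g g; set b := B g (rmulj g); set d := B (rmulj g) (rmulj g).
have E (w : C) : B (g + conjc w *: rmulj g) (rmulj (g + conjc w *: rmulj g)) =
   - a * w + (1 - w * conjc w) * b + conjc w * d.
  rewrite rmuljD rmuljZ rmuljK conjcK !(bilDl, bilDr symA) !(bilZl, bilZr symA) bilNr bilNr.
  by rewrite (bilC symA (rmulj g) g) -/a -/b -/d; ring.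
suff [w Ew] : exists w : C, - a * w + (1 - w * conjc w) * b + conjc w * d = 0.
  by exists (conjc w); rewrite E.
pose N (z : C) := complex.Re z ^+ 2 + complex.Im z ^+ 2.
have NE (z : C) : z * conjc z = real_complex R (N z).
  by apply: complex_ext; rewrite ?cReM ?cImM cRe_conj cIm_conj /N /=; ring.
have [n0|n0] := eqVneq (N d - N a) 0.
  have [a0|a0] := eqVneq a 0.
    have d0 : d = 0.
      move: n0; rewrite a0 /N /= expr0n /= addr0 subr0 => /eqP; rewrite paddr_eq0 ?sqr_ge0 //.
      by rewrite !sqrf_eq0 => /andP[/eqP e1 /eqP e2]; apply: complex_ext.
    by exists 1; rewrite a0 d0 conjc1; ring.
  (* When |a| = |d|, a unimodular s with s^2 = d / a kills the middle term and makes the outer two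
     cancel. *)
  pose s := sqrtc (d / a).
  have ss : s * s = d / a by rewrite -expr2 sqr_sqrtc.
  have Na0 : real_complex R (N a) != 0 by rewrite -NE mulf_neq0 // conjc_eq0.
  have s1 : s * conjc s = 1.
    have : N s = 1.
      have : N s * N s = 1.
        apply: (@complexI R); rewrite rcM -!NE.
        rewrite (_ : _ * _ = (s * s) * conjc (s * s)); last by rewrite conjM; ring.
        rewrite ss conjM conjc_inv.
        rewrite mulrACA -invfM.
        rewrite (NE d) (NE a) (_ : N d = N a) ?divff //.
        by apply/eqP; rewrite -subr_eq0 n0.
      move/eqP; rewrite -expr2 sqrf_eq1 => /orP[/eqP // | /eqP E1].
      have : 0 <= N s by rewrite addr_ge0 // sqr_ge0.
      by rewrite E1 ler0N1.
    by move=> N1; rewrite NE N1.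
  exists s; rewrite s1 subrr mul0r addr0.
  have -> : d = a * (s * s) by rewrite ss mulrCA divff // mulr1.
  by rewrite (_ : conjc s * _ = a * s * (s * conjc s)); [rewrite s1; ring|ring].
set n := N d - N a in n0.
(* For w = x s with x real and |w|^2 = 1 - n x, the equation is x times n b - a s + conj(s) d = 0,
   which this s satisfies. It remains to find x with |s|^2 x^2 = 1 - n x. *)
pose s := - (conjc a * b + conjc b * d).
have [x Hx] : exists x : R, N s * x ^+ 2 + n * x - 1 = 0.
  have S0 : 0 <= N s by rewrite addr_ge0 // sqr_ge0.
  pose r := Num.sqrt (n ^+ 2 + 4 * N s).
  have rr : r ^+ 2 = n ^+ 2 + 4 * N s by rewrite sqr_sqrtr // addr_ge0 ?sqr_ge0 // mulr_ge0.
  have r0 : 0 <= r by exact: sqrtr_ge0.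
  (* With the sign of n, the denominator n + e r is nonzero even when s = 0 and the equation for x
     is only linear. *)
  pose e : R := if 0 < n then 1 else -1.
  have ee : e ^+ 2 = 1 by rewrite /e; case: ifP => _; rewrite ?sqrrN expr1n.
  have D0 : n + e * r != 0.
    rewrite /e; case: ifPn => Hn; first by rewrite mul1r gt_eqF //; lra.
    by rewrite mulN1r lt_eqF //; move: n0 Hn; rewrite neq_lt => /orP[]; lra.
  exists (2 / (n + e * r)).
  have -> : N s = (r ^+ 2 - n ^+ 2) / 4 by rewrite rr; field.
  have -> : r ^+ 2 = (e * r) ^+ 2 by rewrite exprMn ee mul1r.
  by field.
have HxC := quadratic_cast Hx.
exists (real_complex R x * s).
rewrite conjM conjc_real.
rewrite (_ : _ * s * (_ * _) = (s * conjc s) * real_complex R x ^+ 2); last by ring.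
rewrite NE HxC.
have -> : real_complex R n = d * conjc d - a * conjc a by rewrite rcB -!NE.
rewrite /s conjN conjD !conjM !conjcK; ring.
Qed.

End Form.
End NormalForm.

(** * Diagonalisation compatible with right multiplication by j *)

Section DiagonalBasis.
Variable R : realType.
Local Notation C := R[i].
Implicit Types (v w e f g : 'rV[C]_4) (a b c d k : C).
Variable A : 'M[C]_4.
Hypothesis symA : A^T = A.
Hypothesis detA : \det A != 0.
Local Notation B := (bil A).
Local Notation J := (@rmulj R).

Lemma unitA : A \in unitmx.
Proof. by rewrite unitmxE unitfE. Qed.

Lemma bil_nondegenerate v : (forall w, B v w = 0) -> v = 0.
Proof.
move=> H; have E : v *m A = 0.
  apply/rowP => i; have := H (delta_mx ord0 i).
  by rewrite /bil trmx_delta -colE mxE => ->; rewrite mxE.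
by rewrite -(mulmxK unitA v) E mul0mx.
Qed.

Lemma conj_jmx : map_mx (@conjc R) (jmx R) = jmx R.
Proof.
apply/matrixP => i j; have jE : jmx R i j = rmulj (delta_mx ord0 i) ord0 j by rewrite mxE.
rewrite mxE jE; have [->|->|->|->] := ord4_cases j; rewrite !rmuljE ?conjN conjcK !mxE.
all: by rewrite conjc_nat.
Qed.

Lemma bil_rmulj v w : B (J v) (J w) = conjc ((v *m (jmx R *m map_mx (@conjc R) A *m (jmx R)^T) *m w^T) ord0 ord0).
Proof.
rewrite /bil !rmulj_mx.
have -> : forall M : 'M[C]_1, conjc (M ord0 ord0) = map_mx (@conjc R) M ord0 ord0 by move=> M; rewrite mxE.
rewrite !map_mxM /= -!map_trmx conj_jmx.
rewrite (_ : map_mx (@conjc R) (map_mx (@conjc R) A) = A); last first.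
  by apply/matrixP => i j; rewrite !mxE conjcK.
by rewrite trmx_mul !mulmxA.
Qed.

Lemma rmulj_eq0 v : (J v == 0) = (v == 0).
Proof.
have J0 : J 0 = 0 by apply: row4_ext; rewrite rmuljE !mxE ?conjc0 ?oppr0.
apply/eqP/eqP => [E|->//]; apply/eqP; rewrite -oppr_eq0 -rmuljK E J0 //.
Qed.

(** [v] is an eigenvector of the bilinear form conj B(j., j.) relative to B. For such v, the
    B-orthogonal of v and jv is stable under j, so the diagonalisation can proceed one quaternionic
    line at a time. *)
Definition jeigen k v := forall w, B (J v) (J w) = conjc (k * B v w).

(** An eigenvector exists because the field is algebraically closed; eigenvalue zero would put jv in
    the kernel of B. *)
Lemma exists_jeigen : exists v k, [/\ v != 0, k != 0 & jeigen k v].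
Proof.
pose M := jmx R *m map_mx (@conjc R) A *m (jmx R)^T.
have [k /eigenvalueP [v Ev v0]] := eigenvalue_closed (M *m invmx A) isT.
exists v, k.
have EM : v *m M = k *: (v *m A).
  by rewrite -(mulmxKV unitA (v *m M)) -[v *m M *m _]mulmxA Ev -scalemxAl.
have jE : jeigen k v.
  by move=> w; rewrite bil_rmulj -/M EM -scalemxAl mxE.
split=> //; apply/eqP => k0; move/eqP: v0; apply.
have : J v = 0.
  apply: bil_nondegenerate => w.
  by have := jE (J (- w)); rewrite rmuljK opprK k0 mul0r conjc0.
by move=> /eqP; rewrite rmulj_eq0 => /eqP.
Qed.

Lemma jeigen_right k v w : k != 0 -> jeigen k v -> B v (J w) = - (conjc (B (J v) w) / k).
Proof.
move=> k0 jE; have := jE (J w); rewrite rmuljK (bilNr symA) => /(congr1 (@conjc R)).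
rewrite conjcK conjN => /esym E; apply: (mulfI k0); rewrite E mulrN; congr (- _).
by rewrite mulrCA divff // mulr1.
Qed.

(** Applying j to the relation and substituting back gives (1 + |c|^2) v = 0. *)
Lemma rmulj_indep v c : v + c *: J v = 0 -> v = 0.
Proof.
move=> E; have E1 : v = - c *: J v by apply/eqP; rewrite scaleNr -addr_eq0 E.
have E2 : J v = conjc c *: v.
  rewrite {1}E1 rmuljZ rmuljK conjN scalerN scaleNr opprK //.
move: E; rewrite E2 scalerA -{1}(scale1r v) -scalerDl => /eqP; rewrite scaler_eq0 => /orP[/eqP E|/eqP //].
have := congr1 (@complex.Re R) E; rewrite cReD cReM cRe_conj cIm_conj /=.
move: (complex.Re c) (complex.Im c) => {E E1 E2} x y.
by have [] := (sqr_ge0 x, sqr_ge0 y); rewrite !expr2 => ? ? ?; exfalso; lra.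
Qed.

(** If B(v, jv) <> 0, the eigenvector relation used twice forces |k| = 1. Then jv is an eigenvector
    for the same k, and so is every vector of the quaternionic line; [quaternionic_line_diag] picks
    a suitable one. *)
Lemma jeigen_diag : exists v k, [/\ v != 0, k != 0, jeigen k v & B v (J v) = 0].
Proof.
have [v [k [v0 k0 jE]]] := exists_jeigen.
have [E|E] := eqVneq (B v (J v)) 0; first by exists v, k.
have [c Ec] := quaternionic_line_diag symA v.
exists (v + c *: J v), k; split=> //.
  by apply: contra v0 => /eqP /rmulj_indep ->.
have E1 : - B v (J v) = conjc k * conjc (B v (J v)).
  by have := jE (J v); rewrite rmuljK (bilNr symA) (bilC symA) conjM.
have E2 : - conjc (B v (J v)) = k * B v (J v).
  by have := congr1 (@conjc R) E1; rewrite conjN conjM !conjcK.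
have kk : k * conjc k = 1.
  have x0 : B v (J v) * conjc (B v (J v)) != 0 by rewrite mulf_neq0 // conjc_eq0.
  apply: (mulIf x0); rewrite mul1r.
  transitivity ((conjc k * conjc (B v (J v))) * (k * B v (J v))); first by ring.
  by rewrite -E1 -E2; ring.
have kV : conjc k = k^-1 by apply: (mulfI k0); rewrite kk divff.
have jE' : jeigen k (J v).
  move=> w; rewrite rmuljK bilNl (jeigen_right _ k0 jE) opprK conjM kV mulrC.
  by [].
move=> w; rewrite rmuljD rmuljZ !bilDl !bilZl jE jE' !(conjM, conjD).
by ring.
Qed.

Hypothesis no_lines : forall v, v != 0 -> ~ [/\ B v v = 0, B v (J v) = 0 & B (J v) (J v) = 0].

Lemma exists_orthogonal e : exists2 v, v != 0 & B e v = 0 /\ B (J e) v = 0.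
Proof.
pose M : 'M[C]_(4, 1 + 1) := A *m (col_mx e (J e))^T.
have : kermx M != 0.
  by rewrite kermx_eq0 /row_free; apply/negP => /eqP E; have := rank_leq_col M; rewrite E.
move/rowV0Pn => [v /sub_kermxP vM v0]; exists v => //.
have H g : v *m A *m g^T = 0 -> B g v = 0 by move=> E; rewrite bilC // /bil E mxE.
move: vM; rewrite /M tr_col_mx mul_mx_row mul_mx_row -[0]row_mx0 => /eq_row_mx [E1 E2].
by split; apply: H; rewrite -mulmxA.
Qed.

Definition basis_mx e f : 'M[C]_4 := \matrix_(i < 4) nth 0 [:: e; J e; f; J f] i.

Lemma mul_basis_mx e f (u : 'rV[C]_4) : u *m basis_mx e f =
  u ord0 0 *: e + u ord0 1 *: J e + u ord0 2 *: f + u ord0 3 *: J f.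
Proof. by rewrite mulmx_sum_row sum_ord4 !rowK. Qed.

Record diag_basis e f : Prop := DiagBasis {
  db_ee : B e e != 0; db_jj : B (J e) (J e) != 0;
  db_ff : B f f != 0; db_kk : B (J f) (J f) != 0;
  db_ej : B e (J e) = 0; db_fk : B f (J f) = 0;
  db_ef : B e f = 0; db_ek : B e (J f) = 0;
  db_jf : B (J e) f = 0; db_jk : B (J e) (J f) = 0 }.

(** After e, the vector f is found in the j-stable orthogonal of e and je by adjusting any nonzero
    vector within its quaternionic line. Nondegeneracy keeps f and jf from being isotropic. *)
Lemma exists_diag_basis : exists e f, diag_basis e f /\ basis_mx e f \in unitmx.
Proof.
have [e [k [e0 k0 jE ej]]] := jeigen_diag.
(* Otherwise je is isotropic too, and the quaternionic line of e is a twistor line inside the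
   quadric. *)
have ee : B e e != 0.
  apply/eqP => E; apply: (no_lines e0); split=> //.
  by rewrite jE E mulr0 conjc0.
have jj : B (J e) (J e) != 0 by rewrite jE conjc_eq0 mulf_neq0.
have [g g0 [eg jg]] := exists_orthogonal e.
have ek : B e (J g) = 0 by rewrite (jeigen_right _ k0 jE) jg conjc0 mul0r oppr0.
have jk : B (J e) (J g) = 0 by rewrite jE eg mulr0 conjc0.
have [c Ec] := quaternionic_line_diag symA g.
set f := g + c *: J g in Ec.
have f0 : f != 0 by apply: contra g0 => /eqP /rmulj_indep ->.
have ef : B e f = 0 by rewrite (bilDr symA) (bilZr symA) eg ek mulr0 addr0.
have jf : B (J e) f = 0 by rewrite (bilDr symA) (bilZr symA) jg jk mulr0 addr0.
have ekf : B e (J f) = 0 by rewrite (jeigen_right _ k0 jE) jf conjc0 mul0r oppr0.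
have jkf : B (J e) (J f) = 0 by rewrite jE ef mulr0 conjc0.
have uE : basis_mx e f \in unitmx.
  rewrite -row_free_unit; apply: inj_row_free => u; rewrite mul_basis_mx => E.
  have u0 : u ord0 0 = 0.
    have := congr1 (B e) E; rewrite !(bilDr symA) !(bilZr symA) ej ef ekf !mulr0 !addr0.
    by rewrite -[0 in X in _ = X](scale0r e) (bilZr symA) mul0r => /eqP; rewrite mulf_eq0 (negPf ee) orbF => /eqP.
  have u1 : u ord0 1 = 0.
    have := congr1 (B (J e)) E; rewrite !(bilDr symA) !(bilZr symA) (bilC symA (J e) e) ej jf jkf !mulr0 !addr0 add0r.
    by rewrite -[0 in X in _ = X](scale0r e) (bilZr symA) mul0r => /eqP; rewrite mulf_eq0 (negPf jj) orbF => /eqP.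
  move: E; rewrite u0 u1 !scale0r !add0r => E.
  have [u2|u2] := eqVneq (u ord0 2) 0.
    have u3 : u ord0 3 = 0.
      move: E; rewrite u2 scale0r add0r => /eqP; rewrite scaler_eq0 => /orP[/eqP //|].
      by rewrite rmulj_eq0 (negPf f0).
    by apply: row4_ext; rewrite mxE.
  have : f + (u ord0 3 / u ord0 2) *: J f = 0.
    apply: (@scalerI _ _ (u ord0 2)) => //.
    by rewrite scaler0 scalerDr scalerA mulrCA divff // mulr1.
  by move/rmulj_indep => F; move/eqP: f0.
have span v : B v e = 0 -> B v (J e) = 0 -> B v f = 0 -> B v (J f) = 0 -> v = 0.
  move=> h1 h2 h3 h4; apply: bil_nondegenerate => w.
  rewrite -(mulmxKV uE w) mul_basis_mx !(bilDr symA) !(bilZr symA) h1 h2 h3 h4.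
  by rewrite !mulr0 !addr0.
exists e, f; split=> //; split=> //.
- apply/eqP => E; move/eqP: f0; apply; apply: span => //; by rewrite bilC.
- apply/eqP => E; have /eqP : J f = 0 by apply: span => //; rewrite bilC.
  by rewrite rmulj_eq0 (negPf f0).
Qed.

End DiagonalBasis.

(** * Scaling the diagonal coefficients *)

Section Normalisation.
Variable R : realType.
Local Notation C := R[i].
Local Notation R4 := 'rV[R]_4.
Local Notation rc := (real_complex R).
Implicit Types (v w e f g : 'rV[C]_4) (a b c d k : C) (p q h x y : R4).
Local Notation J := (@rmulj R).

Lemma rc_sqr_norm a : a * conjc a = rc (complex.Re a ^+ 2 + complex.Im a ^+ 2).
Proof. by apply: complex_ext; rewrite ?cReM ?cImM cRe_conj cIm_conj /=; ring. Qed.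

Lemma sqr_norm_gt0 a : a != 0 -> 0 < complex.Re a ^+ 2 + complex.Im a ^+ 2.
Proof.
move=> a0; rewrite lt0r addr_ge0 ?sqr_ge0 // andbT -rc_eq0 -rc_sqr_norm.
by rewrite mulf_neq0 // conjc_eq0.
Qed.

(* Rescaling a basis vector e by alpha multiplies B(e, e) by alpha^2 and
   B(je, je) by conj(alpha)^2. *)
Lemma scale_to_unit a b : a != 0 -> b != 0 -> exists al u (l : R),
  [/\ al != 0, 0 < l, u * conjc u = 1, al * al * a = rc l * u & conjc al * conjc al * b = u / rc l].
Proof.
(* A fourth root of b / a gives al0^2 a and conj(al0)^2 b the same phase. *)
move=> a0 b0; pose al0 := sqrtc (sqrtc (b / a)).
have E4 : (al0 * al0) * (al0 * al0) = b / a by rewrite -!expr2 !sqr_sqrtc.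
have al00 : al0 != 0.
  apply/eqP => E; move/eqP: E4; rewrite E !mul0r eq_sym mulf_eq0 invr_eq0.
  by rewrite (negPf a0) (negPf b0).
set N := complex.Re al0 ^+ 2 + complex.Im al0 ^+ 2.
have N0 : 0 < N by exact: sqr_norm_gt0.
pose a1 := al0 * al0 * a.
have a10 : a1 != 0 by rewrite !mulf_neq0.
have Eb : conjc al0 * conjc al0 * b = rc N * rc N * a1.
  have -> : b = (al0 * al0) * (al0 * al0) * a by rewrite E4 divfK.
  by rewrite -rc_sqr_norm /a1; ring.
pose r := Num.sqrt (complex.Re a1 ^+ 2 + complex.Im a1 ^+ 2).
have r0 : 0 < r by rewrite sqrtr_gt0 sqr_norm_gt0.
have rr : rc r * rc r = a1 * conjc a1.
  by rewrite -rcM -expr2 sqr_sqrtr ?rc_sqr_norm // ltW // sqr_norm_gt0.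
have rc0 : rc r != 0 by rewrite rc_eq0 gt_eqF.
have Nc0 : rc N != 0 by rewrite rc_eq0 gt_eqF.
(* The real factor that makes the product of the two moduli equal to one. *)
pose rho := Num.sqrt (r * N)^-1.
have rho0 : 0 < rho by rewrite sqrtr_gt0 invr_gt0 mulr_gt0.
have rhorho : rc rho * rc rho = (rc r * rc N)^-1.
  by rewrite -rcM -expr2 sqr_sqrtr ?rcV ?rcM // invr_ge0 ltW // mulr_gt0.
exists (rc rho * al0), (a1 / rc r), N^-1; split.
- by rewrite mulf_neq0 // rc_eq0 gt_eqF.
- by rewrite invr_gt0.
- rewrite conjM conjc_inv conjc_real mulrACA -invfM rr divff //.
  by rewrite mulf_neq0 // conjc_eq0.
- transitivity (rc rho * rc rho * a1); first by rewrite /a1; ring.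
  by rewrite rhorho rcV invfM; ring.
- rewrite conjM conjc_real.
  transitivity (rc rho * rc rho * (conjc al0 * conjc al0 * b)); first by ring.
  by rewrite rhorho Eb rcV invrK; field; rewrite Nc0 rc0.
Qed.

(** The scaling of each basis vector leaves one phase per pair, mu and nu. The common scalar k makes
    the two phases conjugate, and a factor i on the second vector is available to avoid imaginary
    ones. *)
Lemma simultaneous_normalisation a b c d : a != 0 -> b != 0 -> c != 0 -> d != 0 ->
  exists k al be om (l m : R), [/\ k != 0, al != 0 /\ be != 0, 0 < l /\ 0 < m,
    om * conjc om = 1 /\ complex.Re om != 0 &
    [/\ k * (al * al * a) = rc l * om, k * (conjc al * conjc al * b) = om / rc l,
        k * (be * be * c) = rc m * conjc om & k * (conjc be * conjc be * d) = conjc om / rc m]].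
Proof.
move=> a0 b0 c0 d0.
have [al [mu [l [al0 l0 mu1 Ea Eb]]]] := scale_to_unit a0 b0.
have [be [nu [m [be0 m0 nu1 Ec [Ed mn]]]]] : exists be nu (m : R),
  [/\ be != 0, 0 < m, nu * conjc nu = 1, be * be * c = rc m * nu &
      conjc be * conjc be * d = nu / rc m /\ mu + nu != 0].
  have [be [nu [m [be0 m0 nu1 Ec Ed]]]] := scale_to_unit c0 d0.
  have [E|E] := eqVneq (mu + nu) 0; last by exists be, nu, m.
  (* A factor i changes nu to - nu, so that the sum of the phases becomes 2 mu instead of 0. *)
  exists (ii R * be), (- nu), m; split=> //.
  - by rewrite mulf_neq0 // ii_neq0.
  - by rewrite conjN mulrNN.
  - transitivity ((ii R * ii R) * (be * be * c)); first by ring.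
    by rewrite ii_sqr Ec; ring.
  split.
    rewrite conjM conj_ii.
    transitivity ((ii R * ii R) * (conjc be * conjc be * d)); first by ring.
    by rewrite ii_sqr Ed; ring.
  have mu0 : mu != 0 by apply/eqP => M; move/eqP: mu1; rewrite M mul0r eq_sym oner_eq0.
  have -> : nu = - mu by apply/eqP; rewrite -addr_eq0 addrC E.
  rewrite opprK -mulr2n -mulr_natl mulf_neq0 //; exact: two_neq0.
(* The unit numbers k mu and k nu are then inverse, hence conjugate, and their sum 2 Re(k mu) is
   nonzero because mu + nu is. *)
pose k := sqrtc (mu * nu)^-1.
have kk : k * k = (mu * nu)^-1 by rewrite -expr2 sqr_sqrtc.
have mu0 : mu != 0 by apply/eqP => M; move/eqP: mu1; rewrite M mul0r eq_sym oner_eq0.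
have nu0 : nu != 0 by apply/eqP => M; move/eqP: nu1; rewrite M mul0r eq_sym oner_eq0.
have k0 : k != 0.
  by apply/eqP => E; move/eqP: kk; rewrite E mul0r eq_sym invr_eq0 mulf_eq0 (negPf mu0) (negPf nu0).
have kN : k * conjc k = 1.
  have : (k * conjc k) * (k * conjc k) = 1.
    transitivity ((k * k) * conjc (k * k)); first by rewrite conjM; ring.
    by rewrite kk conjc_inv -invfM conjM mulrACA mu1 nu1 mulr1 invr1.
  rewrite rc_sqr_norm -rcM => /(@complexI R) /eqP.
  rewrite -expr2 sqrf_eq1 => /orP[/eqP -> //|/eqP E].
  by have : 0 <= complex.Re k ^+ 2 + complex.Im k ^+ 2; [rewrite addr_ge0 ?sqr_ge0|rewrite E ler0N1].
have om1 : (k * mu) * conjc (k * mu) = 1 by rewrite conjM mulrACA kN mu1 mulr1.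
have om2 : (k * mu) * (k * nu) = 1 by rewrite mulrACA kk mulVf // mulf_neq0.
have om0 : k * mu != 0 by rewrite mulf_neq0.
have kn : k * nu = conjc (k * mu) by apply: (mulfI om0); rewrite om1 om2.
exists k, al, be, (k * mu), l, m; split=> //; split=> //.
- apply/negP => /eqP E.
  have : (k * mu) + conjc (k * mu) = 0.
    by apply: complex_ext; rewrite ?cReD ?cImD ?cRe_conj ?cIm_conj ?E /=; ring.
  by rewrite -kn -mulrDr => /eqP; rewrite mulf_eq0 (negPf k0) (negPf mn).
- by rewrite Ea; ring.
- by rewrite Eb; ring.
- by rewrite Ec -kn; ring.
- by rewrite Ed -kn; ring.
Qed.

Section Frame.
Variable A : 'M[C]_4.
Hypothesis symA : A^T = A.
Local Notation B := (bil A).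

Lemma diag_basis_unit e f : diag_basis A e f -> basis_mx e f \in unitmx.
Proof.
case=> ee jj ff kk ej fk ef ek jf jk.
rewrite -row_free_unit; apply: inj_row_free => u; rewrite mul_basis_mx => E.
have B0 v : B v 0 = 0 by rewrite -(scale0r v) (bilZr symA) mul0r.
have E0 v : u ord0 0 * B v e + u ord0 1 * B v (J e) + u ord0 2 * B v f + u ord0 3 * B v (J f) = 0.
  by rewrite -!(bilZr symA) -!(bilDr symA) E B0.
have [[S1 S2] S3] := (bilC symA (J e) e, bilC symA f e, bilC symA f (J e)).
have [[S4 S5] S6] := (bilC symA (J f) e, bilC symA (J f) (J e), bilC symA (J f) f).
apply: row4_ext; rewrite mxE; apply/eqP.
- have /eqP := E0 e; rewrite ej ef ek !mulr0 !addr0.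
  by rewrite mulf_eq0 (negPf ee) orbF.
- have /eqP := E0 (J e); rewrite S1 ej jf jk !mulr0 !addr0 add0r.
  by rewrite mulf_eq0 (negPf jj) orbF.
- have /eqP := E0 f; rewrite S2 S3 ef jf fk !mulr0 !addr0 !add0r.
  by rewrite mulf_eq0 (negPf ff) orbF.
- have /eqP := E0 (J f); rewrite S4 S5 S6 ek jk fk !mulr0 !add0r.
  by rewrite mulf_eq0 (negPf kk) orbF.
Qed.

Definition qa v : R4 := quat (v ord0 0) (v ord0 1).
Definition qb v : R4 := quat (v ord0 2) (v ord0 3).

Lemma cvec_ab v : cvec (qa v) (qb v) = v.
Proof. by apply: row4_ext; rewrite cvecE ?z1_quat ?z2_quat. Qed.

Lemma cvec_inj p q p' q' : cvec p q = cvec p' q' -> p = p' /\ q = q'.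
Proof.
move=> E; have H i := congr1 (fun v : 'rV[C]_4 => v ord0 i) E.
by split; apply: quat_ext; [have := H 0|have := H 1|have := H 2|have := H 3]; rewrite !cvecE.
Qed.

(** A change to a basis e, je, f, jf is left multiplication by a quaternionic 2 x 2 matrix, so it
    descends to a Moebius transformation of HP^1. *)
Lemma mul_frame e f p q : cvec p q *m basis_mx e f =
  cvec (qmul (qa e) p + qmul (qa f) q) (qmul (qb e) p + qmul (qb f) q).
Proof.
rewrite mul_basis_mx; apply: row4_ext;
  rewrite !(cvecE, z1D, z2D, z1_qmul, z2_qmul, z1_quat, z2_quat, rmuljE, mxE); ring.
Qed.

End Frame.
End Normalisation.

(** * Quaternionic frames *)

Section NormalFrame.
Variable R : realType.
Local Notation C := R[i].
Local Notation R4 := 'rV[R]_4.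
Local Notation rc := (real_complex R).
Implicit Types (v w e f g : 'rV[C]_4) (a b c d k : C) (p q h x y : R4).
Local Notation J := (@rmulj R).
Variable A : 'M[C]_4.
Hypothesis symA : A^T = A.

Lemma rmulj_mul_basis e f v : J (v *m basis_mx e f) = J v *m basis_mx e f.
Proof.
rewrite !mul_basis_mx !rmuljD !rmuljZ !rmuljK !rmuljE.
rewrite !scalerN !scaleNr.
by apply: row4_ext; rewrite !mxE; ring.
Qed.

(** Matrices of quaternionic frames are those commuting with j; this is how the inverse of such a
    matrix is seen to be one as well. *)
Lemma rmulj_commute_basis (E : 'M[C]_4) :
  (forall v, J (v *m E) = J v *m E) -> E = basis_mx (row 0 E) (row 2 E).
Proof.
move=> H; apply/row_matrixP => i; rewrite rowK.
have [->|->|->|->] := ord4_cases i => //=.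
- rewrite !rowE H; congr (_ *m _).
  by apply: row4_ext; rewrite rmuljE !mxE /= ?conjc0 ?oppr0 ?conjc1.
- rewrite !rowE H; congr (_ *m _).
  by apply: row4_ext; rewrite rmuljE !mxE /= ?conjc0 ?oppr0 ?conjc1.
Qed.

Lemma inverse_basis e f : basis_mx e f \in unitmx ->
  exists e' f', basis_mx e' f' *m basis_mx e f = 1%:M /\ basis_mx e f *m basis_mx e' f' = 1%:M.
Proof.
move=> uE; pose E' := invmx (basis_mx e f).
exists (row 0 E'), (row 2 E'); rewrite -rmulj_commute_basis; first by rewrite mulVmx // mulmxV.
move=> v; rewrite -[LHS](mulmxK uE); rewrite -/E'; congr (_ *m _).
by rewrite -rmulj_mul_basis mulmxKV.
Qed.

Definition diag_form (l m : R) (om : C) (h1 h2 k1 k2 : R4) : C :=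
  rc l * om * (z1 h1 * z1 k1) + om / rc l * (z2 h1 * z2 k1)
  + rc m * conjc om * (z1 h2 * z1 k2) + conjc om / rc m * (z2 h2 * z2 k2).

Record normal_frame (B : 'M[C]_4) e f e' f' (l m : R) (om : C) : Prop := NormalFrame {
  nf_left : basis_mx e' f' *m basis_mx e f = 1%:M;
  nf_right : basis_mx e f *m basis_mx e' f' = 1%:M;
  nf_l : 0 < l; nf_m : 0 < m;
  nf_om : om * conjc om = 1; nf_re : complex.Re om != 0;
  nf_form : forall h1 h2 k1 k2 : R4, bil B (cvec h1 h2 *m basis_mx e f) (cvec k1 k2 *m basis_mx e f)
    = diag_form l m om h1 h2 k1 k2 }.

Lemma exists_normal_frame : \det A != 0 ->
  (forall v, v != 0 -> ~ [/\ bil A v v = 0, bil A v (J v) = 0 & bil A (J v) (J v) = 0]) ->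
  exists k e f e' f' l m om, k != 0 /\ normal_frame (k *: A) e f e' f' l m om.
Proof.
move=> detA nl; have [e0 [f0 [db _]]] := exists_diag_basis symA detA nl.
have [ee jj ff kk ej fk ef ek jf jk] := db.
have [k [al [be [om [l [m [k0 [al0 be0] [l0 m0] [om1 omR] [E1 E2 E3 E4]]]]]]]] :=
  simultaneous_normalisation ee jj ff kk.
have bilk v w : bil (k *: A) v w = k * bil A v w.
  by rewrite /bil -scalemxAr -scalemxAl mxE.
have symkA : (k *: A)^T = k *: A by rewrite linearZ /= symA.
pose e := al *: e0; pose f := be *: f0.
have nz (x y : C) : x != 0 -> y != 0 -> k * (x * (x * y)) != 0.
  by move=> x0 y0; rewrite !mulf_neq0.
have db' : diag_basis (k *: A) e f.
  split; rewrite bilk /e /f ?rmuljZ !(bilZl, bilZr symA) ?ej ?fk ?ef ?ek ?jf ?jk ?mulr0 //.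
  - exact: nz.
  - by apply: nz; rewrite ?conjc_eq0.
  - exact: nz.
  - by apply: nz; rewrite ?conjc_eq0.
have F1 : bil (k *: A) e e = rc l * om.
  by rewrite bilk /e !(bilZl, bilZr symA) -E1; ring.
have F2 : bil (k *: A) (J e) (J e) = om / rc l.
  by rewrite bilk /e rmuljZ !(bilZl, bilZr symA) -E2; ring.
have F3 : bil (k *: A) f f = rc m * conjc om.
  by rewrite bilk /f !(bilZl, bilZr symA) -E3; ring.
have F4 : bil (k *: A) (J f) (J f) = conjc om / rc m.
  by rewrite bilk /f rmuljZ !(bilZl, bilZr symA) -E4; ring.
clearbody e f.
have [e' [f' [EE' E'E]]] := inverse_basis (diag_basis_unit symkA db').
exists k, e, f, e', f', l, m, om; split=> //; split=> // h1 h2 k1 k2.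
have [_ _ _ _ ej' fk' ef' ek' jf' jk'] := db'.
rewrite !mul_basis_mx !cvecE !(bilDl, bilDr symkA) !(bilZl, bilZr symkA).
rewrite (bilC symkA (J e) e) (bilC symkA f e) (bilC symkA (J f) e) (bilC symkA f (J e)).
rewrite (bilC symkA (J f) (J e)) (bilC symkA (J f) f) ej' fk' ef' ek' jf' jk'.
by rewrite F1 F2 F3 F4 /diag_form; ring.
Qed.

End NormalFrame.

(** * The branch cut in normal coordinates *)

Section Moebius.
Variable R : realType.
Local Notation C := R[i].
Local Notation R4 := 'rV[R]_4.
Local Notation rc := (real_complex R).
Implicit Types (e f : 'rV[C]_4) (a c d k : C) (p q h x y w u : R4) (b : bool).
Variables (A : 'M[C]_4) (e f e' f' : 'rV[C]_4) (l m : R) (om : C).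
Hypothesis symA : A^T = A.
Hypothesis nf : normal_frame A e f e' f' l m om.
Local Notation qone := (qone R).
Local Notation qj := (qj R).

(** In these parameters, where l = s t and m = s / t, the discriminant splits into three squares. *)
Let t := Num.sqrt (l / m).
Let s := Num.sqrt (l * m).

Lemma nf_sqrt : [/\ 0 < t, 0 < s, l = s * t & m = s / t].
Proof.
have [l0 m0] := (nf_l nf, nf_m nf).
have t0 : 0 < t by rewrite sqrtr_gt0 divr_gt0.
have s0 : 0 < s by rewrite sqrtr_gt0 mulr_gt0.
have tt : t ^+ 2 = l / m by rewrite sqr_sqrtr // ltW // divr_gt0.
have ss : s ^+ 2 = l * m by rewrite sqr_sqrtr // ltW // mulr_gt0.
have E : l = s * t.
  apply/eqP; rewrite -(@eqrXn2 _ 2) // ?ltW ?mulr_gt0 // exprMn tt ss; apply/eqP; field.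
  by rewrite gt_eqF.
split=> //; apply/eqP; rewrite -(@eqrXn2 _ 2) // ?ltW ?divr_gt0 // expr_div_n tt ss; apply/eqP; field.
by rewrite !gt_eqF.
Qed.

(* The discriminant of the quadric on the fibre over the point with normal
   coordinates [h1, h2], as a function of zeta = h2 conj(h1) and n_i = |h_i|^2. *)
Definition sum_sq (zeta : R4) (n1 n2 : R) : C :=
  (rc t * conjc (z1 zeta) + z1 zeta / rc t) ^+ 2
  + (rc s * conjc (z2 zeta) + z2 zeta / rc s) ^+ 2
  + (om * rc n1 - conjc om * rc n2) ^+ 2.

Definition hdisc h1 h2 : C :=
  diag_form l m om h1 h2 h1 h2 * diag_form l m om (qmul h1 qj) (qmul h2 qj) (qmul h1 qj) (qmul h2 qj)
  - diag_form l m om h1 h2 (qmul h1 qj) (qmul h2 qj) ^+ 2.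

Lemma hdiscE h1 h2 : hdisc h1 h2 = sum_sq (qmul h2 (qconj h1)) (dot h1 h1) (dot h2 h2).
Proof.
have [t0 s0 El Em] := nf_sqrt.
have om0 : om != 0.
  by apply/eqP => E; have /eqP := nf_om nf; rewrite E mul0r eq_sym oner_eq0.
have omV : conjc om = om^-1 by apply: (mulfI om0); rewrite (nf_om nf) divff.
have T0 : rc t != 0 by rewrite rc_eq0 gt_eqF.
have S0 : rc s != 0 by rewrite rc_eq0 gt_eqF.
rewrite /hdisc /sum_sq /diag_form El Em !rcM rcV omV !dot_conj.
rewrite !(z1_qmul, z2_qmul, z1_quat, z2_quat) !(conjD, conjM, conjN, conjcK).
move: (z1 h1) (z2 h1) (z1 h2) (z2 h2) => a1 a2 a3 a4.
(* Conjugates are now independent variables and conj om has become om^-1, so a rational identity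
   remains. *)
move: (conjc a1) (conjc a2) (conjc a3) (conjc a4) => c1 c2 c3 c4.
move: (rc t) (rc s) T0 S0 => T S T0 S0.
by field; rewrite T0 S0 om0.
Qed.

Definition delta w : C := sum_sq w 1 (dot w w).

Lemma hdisc_delta w h : hdisc h (qmul w h) = rc (dot h h ^+ 2) * delta w.
Proof.
rewrite hdiscE /delta /sum_sq -qmulA qmul_conj qmulZr qmul1r z1Z z2Z dot_qmul.
rewrite !conjM !conjc_real mulr1 expr2 !rcM.
by ring.
Qed.

(** With [fibre_q], homogeneous coordinates in HP^1 of the point of coordinate [y] in chart [b];
    [nc1] and [nc2] are its coordinates in the normal frame. *)
Definition fibre_p b y := if b then y else qone.
Definition fibre_q b y := if b then qone else y.

Lemma emb_one b y : emb b y qone = cvec (fibre_p b y) (fibre_q b y).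
Proof. by case: b; rewrite /emb /= qmul1r. Qed.

Lemma emb_qj b y : emb b y qj = cvec (qmul (fibre_p b y) qj) (qmul (fibre_q b y) qj).
Proof. by case: b; rewrite /emb /= qmul1l. Qed.

Definition nc1 b y := qmul (qa e') (fibre_p b y) + qmul (qa f') (fibre_q b y).
Definition nc2 b y := qmul (qb e') (fibre_p b y) + qmul (qb f') (fibre_q b y).

Lemma disc_frame b y : disc A b y = hdisc (nc1 b y) (nc2 b y).
Proof.
have E1 : emb b y qone = cvec (nc1 b y) (nc2 b y) *m basis_mx e f.
  by rewrite /nc1 /nc2 -mul_frame -mulmxA (nf_left nf) mulmx1 emb_one.
have E2 : emb b y qj = cvec (qmul (nc1 b y) qj) (qmul (nc2 b y) qj) *m basis_mx e f.
  rewrite /nc1 /nc2 !qmulDl -!qmulA -mul_frame -mulmxA (nf_left nf) mulmx1.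
  exact: emb_qj.
by rewrite /disc /q11 /q12 /q22 /qf E1 E2 !(nf_form nf) -expr2.
Qed.

Definition wcoord b y := qmul (nc2 b y) (qinv (nc1 b y)).

(** Where [nc1] vanishes, at normal coordinate infinity, the discriminant is a positive multiple of
    conj(om)^2, which is off the cut because Re om <> 0. *)
Lemma slit_disc b y : slit (disc A b y) = (nc1 b y == 0) || slit (delta (wcoord b y)).
Proof.
rewrite disc_frame; have [h0|h0] := eqVneq (nc1 b y) 0 => /=.
  rewrite h0 hdiscE /sum_sq.
  have n0 : nc2 b y != 0.
    apply/eqP => h0'; have : cvec (fibre_p b y) (fibre_q b y) = 0.
      rewrite -[LHS]mulmx1 -(nf_left nf) mulmxA mul_frame -/(nc1 b y) -/(nc2 b y) h0 h0'.
      rewrite (_ : cvec 0 0 = 0) ?mul0mx //.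
      by apply: row4_ext; rewrite cvecE ?z1_0 ?z2_0 mxE.
    move=> E; have := congr1 (fun v : 'rV[C]_4 => v ord0 0) E.
    have := congr1 (fun v : 'rV[C]_4 => v ord0 2) E; rewrite !cvecE !mxE /fibre_p /fibre_q.
    by case: (b) => Z2 Z0; [move: Z2|move: Z0]; rewrite z1_quat => /eqP; rewrite oner_eq0.
  have -> : qconj (0 : R4) = 0 by apply: row4_ext; rewrite qconjE !mxE ?oppr0.
  rewrite qmul0r z1_0 z2_0 !conjc0 !mulr0 !mul0r !addr0 expr0n /= !add0r.
  rewrite (_ : dot 0 0 = 0) ?mulr0 ?sub0r ?sqrrN; last by rewrite dotE !mxE; ring.
  have n20 := dot_gt0 n0.
  rewrite (_ : _ ^+ 2 = rc (dot (nc2 b y) (nc2 b y) ^+ 2) * (conjc om * conjc om)); last first.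
    by rewrite expr2 rcM; ring.
  rewrite slit_scale ?exprn_gt0 //.
  by rewrite slit_sqr // cRe_conj (nf_re nf).
by rewrite -[nc2 b y](qmulVKr _ h0) hdisc_delta slit_scale // exprn_gt0 // dot_gt0.
Qed.

Definition num1 w := qa e + qmul (qa f) w.
Definition num2 w := qb e + qmul (qb f) w.

Lemma numE w : cvec (num1 w) (num2 w) = cvec qone w *m basis_mx e f.
Proof. by rewrite mul_frame !qmul1r. Qed.

Definition moebius w : S4 R :=
  if num1 w == 0 then infty R else pt (qmul (num2 w) (qinv (num1 w))).

Definition chart_den b w := if b then num2 w else num1 w.
Definition chart_num b w := if b then num1 w else num2 w.
Definition mcoord b w := qmul (chart_num b w) (qinv (chart_den b w)).

Lemma num_neq0 w : num1 w != 0 \/ num2 w != 0.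
Proof.
have [E1|] := eqVneq (num1 w) 0; last by left.
have [E2|] := eqVneq (num2 w) 0; last by right.
have := numE w; rewrite E1 E2 => E.
have : cvec qone w = 0.
  rewrite -[LHS]mulmx1 -(nf_right nf) mulmxA -E (_ : cvec 0 0 = 0) ?mul0mx //.
  by apply: row4_ext; rewrite cvecE ?z1_0 ?z2_0 mxE.
move=> /(congr1 (fun v : 'rV[C]_4 => v ord0 0)); rewrite cvecE z1_quat mxE => /eqP.
by rewrite oner_eq0.
Qed.

Lemma moebius_chart b w : chart_den b w != 0 -> moebius w = chart b (mcoord b w).
Proof.
case: b => d0; rewrite /moebius; last by rewrite -[num1 w]/(chart_den false w) (negPf d0).
have [E|n0] := eqVneq (num1 w) 0; first by rewrite /mcoord [chart_num _ _]E qmul0l chartT_0.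
rewrite chartT_neq0 ?qmul_eq0 ?negb_or ?n0 ?qinv_neq0 //.
by rewrite qinvM ?qinv_neq0 // qinvK.
Qed.

Lemma chart_inj b : injective (@chart R b).
Proof.
case: b => x y; last by case.
have [->|x0] := eqVneq x 0; have [->|y0] := eqVneq y 0 => //.
- by rewrite chartT_0 chartT_neq0.
- by rewrite chartT_0 chartT_neq0.
by rewrite !chartT_neq0 // => -[] /(congr1 (@qinv R)); rewrite !qinvK.
Qed.

Lemma coord_chart b x : Defs.coord b (chart b x) = x.
Proof.
case: b => //; have [->|x0] := eqVneq x 0; first by rewrite chartT_0.
by rewrite chartT_neq0 // /Defs.coord /inversion /pt (negPf (qinv_neq0 x0)) qinvK.
Qed.

Lemma range_moebius b w : range (chart b) (moebius w) <-> chart_den b w != 0.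
Proof.
split=> [[x _]|d0]; last by exists (mcoord b w) => //; rewrite -moebius_chart.
case: b => E; apply/eqP => d0; move: E; rewrite /moebius.
  have n2 : num2 w = 0 by [].
  have n1 : num1 w != 0 by have [//|] := num_neq0 w; rewrite n2 eqxx.
  rewrite (negPf n1) n2 qmul0l.
  have [->|x0] := eqVneq x 0; first by rewrite chartT_0.
  by rewrite chartT_neq0 // => -[] /eqP; rewrite (negPf (qinv_neq0 x0)).
by rewrite (_ : num1 w = 0) ?eqxx.
Qed.

Lemma wcoord_mcoord b w : chart_den b w != 0 ->
  nc1 b (mcoord b w) != 0 /\ wcoord b (mcoord b w) = w.
Proof.
move=> d0.
have E : cvec (qmul (num1 w) (qinv (chart_den b w))) (qmul (num2 w) (qinv (chart_den b w))) =
         cvec (fibre_p b (mcoord b w)) (fibre_q b (mcoord b w)).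
  by move: d0; rewrite /mcoord; case: b => /= d0; rewrite qmulV.
have [F1 F2] : nc1 b (mcoord b w) = qinv (chart_den b w) /\
               nc2 b (mcoord b w) = qmul w (qinv (chart_den b w)).
  apply: cvec_inj; rewrite /nc1 /nc2 -mul_frame -E.
  rewrite /num1 /num2 !qmulDl -!qmulA.
  rewrite -[in LHS](qmul1l (qinv (chart_den b w))).
  have -> : cvec (qmul (qa e) (qmul qone (qinv (chart_den b w))) + qmul (qa f) (qmul w (qmul qone (qinv (chart_den b w)))))
      (qmul (qb e) (qmul qone (qinv (chart_den b w))) + qmul (qb f) (qmul w (qmul qone (qinv (chart_den b w))))) =
      cvec (qinv (chart_den b w)) (qmul w (qinv (chart_den b w))) *m basis_mx e f.
    by rewrite mul_frame !qmul1l.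
  by rewrite -mulmxA (nf_right nf) mulmx1.
rewrite /wcoord F1 F2 qinv_neq0 //; split=> //.
by rewrite -qmulA qmulV ?qmul1r // qinv_neq0.
Qed.

Lemma num_scale p q : p != 0 ->
  cvec (qmul (num1 (qmul q (qinv p))) p) (qmul (num2 (qmul q (qinv p))) p) = cvec p q *m basis_mx e f.
Proof. by move=> p0; rewrite mul_frame /num1 /num2 !qmulDl -!qmulA qmulVl // qmul1r. Qed.

Lemma moebius_wcoord b y : nc1 b y != 0 -> moebius (wcoord b y) = chart b y.
Proof.
move=> h0.
have [E1 E2] : qmul (num1 (wcoord b y)) (nc1 b y) = fibre_p b y /\
               qmul (num2 (wcoord b y)) (nc1 b y) = fibre_q b y.
  apply: cvec_inj; rewrite num_scale //.
  by rewrite /nc1 /nc2 -mul_frame -mulmxA (nf_left nf) mulmx1.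
have d0 : chart_den b (wcoord b y) != 0.
  apply/eqP => d0; have : qmul (chart_den b (wcoord b y)) (nc1 b y) = qone.
    by rewrite /chart_den; move: E1 E2; case: (b).
  rewrite d0 qmul0l => /(congr1 (@z1 R)); rewrite z1_0 z1_quat => /eqP.
  by rewrite eq_sym oner_eq0.
rewrite (moebius_chart d0); congr chart.
rewrite /mcoord; have -> : chart_num b (wcoord b y) = qmul y (qinv (nc1 b y)).
  apply: (qmul_injr h0); rewrite qmulVKr //.
  by rewrite /chart_num; move: E1 E2; case: (b).
have -> : chart_den b (wcoord b y) = qinv (nc1 b y).
  apply: (qmul_injr h0); rewrite qmulVl //.
  by rewrite /chart_den; move: E1 E2; case: (b).
by rewrite qinvK qmulVKr.
Qed.

(** Infinity in the normal coordinate is off the cut, so the affine coordinate w reaches all of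
    it. *)
Lemma branch_cut_moebius : branch_cut A = moebius @` [set w | ~~ slit (delta w)].
Proof.
have every (P : S4 R) : exists b y, P = @chart R b y.
  case: P => [y|]; first by exists false, y.
  by exists true, 0; rewrite chartT_0.
apply/seteqP; split=> p.
  have [b [y ->]] := every p.
  rewrite -[branch_cut A _]/(is_true (~~ slit (gdisc A (chart b y)))) (slit_chart symA) slit_disc negb_or => /andP[h0 H].
  by exists (wcoord b y) => //; rewrite moebius_wcoord.
move=> [w /= H <-].
have [b d0] : exists b, chart_den b w != 0.
  by have [H0|H0] := num_neq0 w; [exists false|exists true].
have [h0 E] := wcoord_mcoord d0.
by rewrite (moebius_chart d0) -[branch_cut A _]/(is_true (~~ slit (gdisc A (chart b (mcoord b w))))) (slit_chart symA) slit_disc negb_or h0 E.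
Qed.

End Moebius.

(** * Solid tori *)

Section TorusEmbedding.
Variable R : realType.
Local Notation C := R[i].
Local Notation R4 := 'rV[R]_4.
Implicit Types (U : set R4) (p q h x y w u v : R4) (b : bool).

Lemma derive_comp0 (F G : R4 -> R4) x v :
  differentiable F x -> differentiable G (F x) -> 'D_v F x = 0 -> 'D_v (G \o F) x = 0.
Proof.
move=> dF dG D0; rewrite (deriveE v (differentiable_comp dF dG)).
have E := deriveE v dF; rewrite D0 in E.
rewrite (diff_comp dF dG) (_ : (_ \o _) v = 'd G (F x) ('d F x v)); last exact: erefl.
exact: (etrans (congr1 ('d G (F x)) (esym E)) (linear0 ('d G (F x)))).
Qed.

Definition circle_sq x : R := x ord0 0 * x ord0 0 + x ord0 1 * x ord0 1.

(** The radial retraction of a neighbourhood of the solid torus onto S^1 x R^2. Parametrisations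
    factor through it, which extends them to an open set of R^4. *)
Definition circle_retract x : R4 :=
  quat (x ord0 0 / Num.sqrt (circle_sq x) +i* (x ord0 1 / Num.sqrt (circle_sq x)))
       (x ord0 2 +i* x ord0 3).

Lemma smooth_circle_sq U : open U -> smooth_on U (fun x => circle_sq x : R^o).
Proof. by move=> oU; apply: smoothD => //; apply: smoothM => //; exact: smooth_coord. Qed.

Lemma open_circle_sq : open [set x | 0 < circle_sq x].
Proof.
rewrite (_ : mkset _ = setT `&` circle_sq @^-1` [set r : R | 0 < r]); last by rewrite setTI.
apply: open_preimage; [exact: openT| |exact: open_gt].
move=> x _; apply: differentiable_continuous.
exact: (smooth_on_differentiable (smooth_circle_sq openT)).
Qed.

Lemma circle_sqrt_neq0 x : 0 < circle_sq x -> Num.sqrt (circle_sq x) != 0.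
Proof. by move=> c0; rewrite sqrtr_eq0 -ltNge. Qed.

Lemma smooth_circle_inv U : open U -> (forall x, U x -> 0 < circle_sq x) ->
  smooth_on U (fun x => (Num.sqrt (circle_sq x))^-1 : R^o).
Proof.
move=> oU cU; apply: smoothV => //; first by move=> x /cU; exact: circle_sqrt_neq0.
by apply: smooth_sqrt => //; exact: smooth_circle_sq.
Qed.

Lemma smooth_circle_coord U i : open U -> (forall x, U x -> 0 < circle_sq x) ->
  smooth_on U (fun x => x ord0 i / Num.sqrt (circle_sq x) : R^o).
Proof.
by move=> oU cU; apply: smoothM => //; [exact: smooth_coord|exact: smooth_circle_inv].
Qed.

Lemma rsmooth_retract U : open U -> (forall x, U x -> 0 < circle_sq x) -> rsmooth U circle_retract.
Proof.
move=> oU cU; apply: rsmooth_quat; split=> /=; try exact: smooth_coord.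
  exact: smooth_circle_coord.
exact: smooth_circle_coord.
Qed.

Lemma solid_torus_circle x : solid_torus x -> circle_sq x = 1.
Proof. by case=> + _; rewrite /circle_sq -!expr2. Qed.

Lemma retract_id x : solid_torus x -> circle_retract x = x.
Proof.
move=> /solid_torus_circle E; rewrite /circle_retract E sqrtr1 !divr1.
by apply: row4_ext; rewrite quatE.
Qed.

(** For v tangent to S^1 x R^2 the derivative of the radius vanishes, so normalising the radius has
    no first-order effect. *)
Lemma derive_retract x v : solid_torus x -> solid_torus_tangent x v ->
  'D_v circle_retract x = v.
Proof.
move=> Tx tv; have c1 := solid_torus_circle Tx.
have oW := open_circle_sq; have Wx : [set x | 0 < circle_sq x] x by rewrite /= c1.
have sN := rsmooth_retract oW (fun _ H => H).
have dN := rsmooth_diff sN Wx.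
have ds y : differentiable (fun x => circle_sq x : R^o) y.
  exact: (smooth_on_differentiable (smooth_circle_sq openT) (I : setT y)).
have Ds : 'D_v (fun x => circle_sq x : R^o) x = 0.
  have dc i : derivable (fun y : R4 => y ord0 i : R^o) x v.
    by apply: diff_derivable; exact: differentiable_coord.
  rewrite (_ : (fun x => _) = (fun y : R4 => y ord0 0 : R^o) * (fun y : R4 => y ord0 0 : R^o)
     + (fun y : R4 => y ord0 1 : R^o) * (fun y : R4 => y ord0 1 : R^o)) //.
  rewrite (deriveD (derivableM (dc 0) (dc 0)) (derivableM (dc 1) (dc 1))).
  rewrite (deriveM (dc 0) (dc 0)) (deriveM (dc 1) (dc 1)) !derive_coord.
  move: tv; rewrite /solid_torus_tangent /= /GRing.scale /= => tv.
  by rewrite -[RHS](addr0 0) -{1}tv -tv; ring.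
have Dr : 'D_v (fun x => (Num.sqrt (circle_sq x))^-1 : R^o) x = 0.
  rewrite deriveV; last first.
  - by apply: diff_derivable; apply: differentiable_sqrt => //; rewrite c1.
  - by apply: circle_sqrt_neq0; rewrite c1.
  by rewrite (derive_sqrt_comp v oW) // Ds !mulr0 scaler0.
have dr : derivable (fun x => (Num.sqrt (circle_sq x))^-1 : R^o) x v.
  apply: diff_derivable; apply: (smooth_on_differentiable (smooth_circle_inv oW (fun _ H => H))) => //.
have Dc i : 'D_v (fun x => x ord0 i / Num.sqrt (circle_sq x) : R^o) x = v ord0 i.
  have dc : derivable (fun y : R4 => y ord0 i : R^o) x v.
    by apply: diff_derivable; exact: differentiable_coord.
  rewrite (deriveM dc dr) Dr derive_coord c1 sqrtr1 invr1 scaler0 add0r.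
  by rewrite /GRing.scale /= mul1r.
have DE i : 'D_v circle_retract x ord0 i = 'D_v (fun y => circle_retract y ord0 i : R^o) x.
  by apply: derive_entry; exact: diff_derivable.
apply: row4_ext; rewrite DE.
- by rewrite -(Dc 0); congr ('D_v _ x); apply/funext => y; rewrite quatE.
- by rewrite -(Dc 1); congr ('D_v _ x); apply/funext => y; rewrite quatE.
- by rewrite -(derive_coord x v 2); congr ('D_v _ x); apply/funext => y; rewrite quatE.
- by rewrite -(derive_coord x v 3); congr ('D_v _ x); apply/funext => y; rewrite quatE.
Qed.

Lemma rsmoothD U (F G : R4 -> R4) : open U -> rsmooth U F -> rsmooth U G ->
  rsmooth U (fun x => F x + G x).
Proof.
move=> oU sF sG i; apply: smooth_on_eq (smoothD oU (sF i) (sG i)) => // x _.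
by rewrite mxE.
Qed.

Lemma circle_coords x : 0 < circle_sq x ->
  (x ord0 0 / Num.sqrt (circle_sq x)) ^+ 2 + (x ord0 1 / Num.sqrt (circle_sq x)) ^+ 2 = 1.
Proof.
move=> h; have S : Num.sqrt (circle_sq x) ^+ 2 = circle_sq x by rewrite sqr_sqrtr // ltW.
rewrite !expr_div_n -mulrDl S /circle_sq -!expr2 divff //.
by move: h; rewrite /circle_sq -!expr2 => /gt_eqF ->.
Qed.

(** * From a parametrisation in normal coordinates to an embedding in the sphere *)

Section Embedding.
Variables (A : 'M[C]_4) (e f e' f' : 'rV[C]_4) (l m : R) (om : C).
Hypothesis nf : normal_frame A e f e' f' l m om.
Local Notation chart_den := (chart_den e f).
Local Notation chart_num := (chart_num e f).
Local Notation mcoord := (mcoord e f).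
Local Notation moebius := (moebius e f).
Local Notation wcoord := (wcoord e' f').
Local Notation nc1 := (nc1 e' f').

Lemma rsmooth_num U (wp : R4 -> R4) b : open U -> rsmooth U wp ->
  rsmooth U (fun x => chart_den b (wp x)) /\ rsmooth U (fun x => chart_num b (wp x)).
Proof.
move=> oU sw.
have H (p q : R4) : rsmooth U (fun x => p + qmul q (wp x)).
  by apply: rsmoothD => //; [exact: rsmooth_cst|apply: rsmooth_qmul => //; exact: rsmooth_cst].
by case: b; split; exact: H.
Qed.

Lemma rsmooth_wcoord b : open [set y | nc1 b y != 0] /\ rsmooth [set y | nc1 b y != 0] (wcoord b).
Proof.
have sp U : rsmooth U (fibre_p b) by rewrite /fibre_p; case: (b); [exact: rsmooth_id|exact: rsmooth_cst].
have sq U : rsmooth U (fibre_q b) by rewrite /fibre_q; case: (b); [exact: rsmooth_cst|exact: rsmooth_id].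
have H U (p q : R4) : open U -> rsmooth U (fun y => qmul p (fibre_p b y) + qmul q (fibre_q b y)).
  by move=> oU; apply: rsmoothD => //; apply: rsmooth_qmul => //; exact: rsmooth_cst.
have oV : open [set y | nc1 b y != 0].
  rewrite (_ : mkset _ = setT `&` nc1 b @^-1` [set z | z != 0]); last by rewrite setTI.
  apply: open_preimage; [exact: openT| |exact: open_neq0].
  move=> y _; exact: (rsmooth_continuous (H _ _ _ openT) (I : setT y)).
split=> //; apply: rsmooth_qmul => //; first exact: H.
by apply: rsmooth_inv => //; exact: H.
Qed.

Lemma torus_embedding U (wp L : R4 -> R4) : open U -> @solid_torus R `<=` U ->
  (forall x, U x -> 0 < circle_sq x) -> rsmooth U wp ->
  (forall x, U x -> differentiable L (wp x)) ->
  (forall x, U x -> L (wp x) = circle_retract x) ->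
  embedded_solid_torus (moebius @` (wp @` (@solid_torus R))).
Proof.
move=> oU TU cU sw dL LE.
pose V b := U `&` (fun x => chart_den b (wp x)) @^-1` [set z | z != 0].
have oV b : open (V b).
  have [sd _] := rsmooth_num b oU sw.
  by apply: open_preimage => //; [move=> x; exact: rsmooth_continuous|exact: open_neq0].
have sV b : rsmooth (V b) (fun x => mcoord b (wp x)).
  have swV : rsmooth (V b) wp by apply: rsmooth_sub sw => x [].
  have [sd sn] := rsmooth_num b (oV b) swV.
  by apply: rsmooth_qmul => //; apply: rsmooth_inv => // x [].
have EV b : U `&` (moebius \o wp) @^-1` range (chart b) = V b.
  by apply/seteqP; split=> x [Ux /=] H; split=> //; apply/(range_moebius nf).
have fV b x : V b x -> (moebius \o wp) x = chart b (mcoord b (wp x)).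
  by move=> [Ux d0]; rewrite /= (moebius_chart d0).
have cV b x : V b x -> Defs.coord b ((moebius \o wp) x) = mcoord b (wp x).
  by move=> Vx; rewrite (fV b) // coord_chart.
exists U, (moebius \o wp); split=> //; last by rewrite image_comp.
- split=> [x Ux|b].
    have [b Vx] : exists b, V b x.
      by have [H0|H0] := num_neq0 nf (wp x); [exists false|exists true].
    have cm : {for x, continuous (fun x => chart b (mcoord b (wp x)))}.
      apply: (@continuous_comp _ _ _ (fun x => mcoord b (wp x)) (@chart R b)).
        exact: rsmooth_continuous (sV b) Vx.
      exact: chart_continuous.
    have fE : \near x, chart b (mcoord b (wp x)) = (moebius \o wp) x.
      by apply: (near_of_open (oV b) Vx) => y Vy; rewrite (fV b).
    suff : (moebius \o wp) @ x --> chart b (mcoord b (wp x)) by rewrite -(fV b x Vx).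
    exact: cvg_trans (near_eq_cvg fE) cm.
  rewrite EV; apply: smooth_on_eq (rsmooth_smooth (oV b) (sV b)) => // x Vx.
  by rewrite /= -(cV b).
- move=> x y; rewrite !inE => Tx Ty E.
  rewrite -(retract_id Tx) -(retract_id Ty) -!LE; [|exact: TU..].
  congr L.
  have [b d0] : exists b, chart_den b (wp x) != 0.
    by have [H0|H0] := num_neq0 nf (wp x); [exists false|exists true].
  have d1 : chart_den b (wp y) != 0 by apply/(range_moebius nf); rewrite -[moebius _]E; apply/(range_moebius nf).
  have [_ <-] := wcoord_mcoord nf d0; have [_ <-] := wcoord_mcoord nf d1.
  congr wcoord; apply: (@chart_inj R b).
  by rewrite -(moebius_chart d0) -(moebius_chart d1).
- move=> b x v Tx rx tv D0.
  have Ux := TU x Tx.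
  have Vx : V b x by rewrite -EV.
  have D1 : 'D_v (fun x => mcoord b (wp x)) x = 0.
    rewrite -D0; apply: near_eq_derive; apply: (near_of_open (oV b) Vx) => y Vy.
    by rewrite /= -(cV b).
  have [_ d0] := Vx; have [n0 Ew] := wcoord_mcoord nf d0.
  have [oW sW] := rsmooth_wcoord b.
  have dm : differentiable (fun x => mcoord b (wp x)) x by exact: rsmooth_diff (sV b) Vx.
  have dW : differentiable (wcoord b) (mcoord b (wp x)) by exact: rsmooth_diff sW n0.
  have dLW : differentiable (L \o wcoord b) (mcoord b (wp x)).
    by apply: differentiable_comp => //; rewrite Ew; exact: dL.
  have := derive_comp0 dm dLW D1.
  rewrite (_ : 'D_v _ x = 'D_v circle_retract x); first by rewrite derive_retract.
  apply: near_eq_derive; apply: (near_of_open (oV b) Vx) => y [Uy dy] /=.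
  by have [_ ->] := wcoord_mcoord nf dy; exact: LE.
Qed.

End Embedding.
End TorusEmbedding.

Lemma sqr_lt1_gtN1 (R : realType) (y : R) : y ^+ 2 < 1 -> 0 < 1 + y.
Proof. by move=> h; nra. Qed.

(** * The cut as a subset of R^4 *)

Section SolidTorusParam.
Variable R : realType.
Local Notation C := R[i].
Local Notation R4 := 'rV[R]_4.
Implicit Types (U : set R4) (x w : R4).

(** Each pair a, b will be (t + 1/t) / 2 and (t - 1/t) / 2 for one of the two scale parameters of
    the normal form, and c + i s will be om. *)
Variables a1 b1 a2 b2 c s : R.
Hypothesis a1_gt0 : 0 < a1.
Hypothesis a2_gt0 : 0 < a2.
Hypothesis ab1 : a1 ^+ 2 = 1 + b1 ^+ 2.
Hypothesis ab2 : a2 ^+ 2 = 1 + b2 ^+ 2.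
Hypothesis cs1 : c ^+ 2 + s ^+ 2 = 1.
Hypothesis c_neq0 : c != 0.

(* With P = (2 a1 w0, 2 a2 w2, c (1 - |w|^2)) and Q = (-2 b1 w1, -2 b2 w3, s (1 + |w|^2)),
   the discriminant is (P + iQ)^2, so it lies on the cut iff P.Q = 0 and |P| <= |Q|. *)
Definition cut_dot w : R :=
  - 4 * a1 * b1 * w ord0 0 * w ord0 1 - 4 * a2 * b2 * w ord0 2 * w ord0 3
  + c * s * (1 - dot w w) * (1 + dot w w).
Definition cut_gap w : R :=
  4 * b1 ^+ 2 * w ord0 1 ^+ 2 + 4 * b2 ^+ 2 * w ord0 3 ^+ 2 + s ^+ 2 * (1 + dot w w) ^+ 2
  - (4 * a1 ^+ 2 * w ord0 0 ^+ 2 + 4 * a2 ^+ 2 * w ord0 2 ^+ 2 + c ^+ 2 * (1 - dot w w) ^+ 2).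
Definition cut_set : set R4 := [set w | cut_dot w = 0 /\ 0 <= cut_gap w].

(** Stereographic projection of the unit sphere of R^5 from X5 = -1. It turns 1 + |w|^2 and 1 -
    |w|^2 into 2 / (1 + X5) and 2 X5 / (1 + X5), which lowers the degree of the equations of the cut
    to two. *)
Definition stereo (X1 X2 X3 X4 X5 : R) : R4 :=
  quat (X1 / (1 + X5) +i* (X2 / (1 + X5))) (X3 / (1 + X5) +i* (X4 / (1 + X5))).

Lemma smoothX2 U (f : R4 -> R^o) : open U -> smooth_on U f -> smooth_on U (fun x => f x ^+ 2 : R^o).
Proof. by move=> oU sf; apply: (smoothM oU sf sf). Qed.

Lemma smooth_sqrtV U (f : R4 -> R^o) : open U -> smooth_on U f -> (forall x, U x -> 0 < f x) ->
  smooth_on U (fun x => (Num.sqrt (f x))^-1 : R^o).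
Proof.
move=> oU sf f0; apply: smoothV => // [x /f0|]; first by rewrite -sqrtr_gt0 => /gt_eqF ->.
exact: smooth_sqrt.
Qed.

Lemma open_pos (f : R4 -> R^o) : smooth_on setT f -> open [set w | 0 < f w].
Proof.
move=> sf; rewrite (_ : mkset _ = setT `&` f @^-1` [set r : R | 0 < r]); last by rewrite setTI.
apply: open_preimage; [exact: openT| |exact: open_gt].
by move=> w _; apply: differentiable_continuous; exact: (smooth_on_differentiable sf).
Qed.

Lemma stereo_dot X1 X2 X3 X4 X5 : X1 ^+ 2 + X2 ^+ 2 + X3 ^+ 2 + X4 ^+ 2 + X5 ^+ 2 = 1 ->
  1 + X5 != 0 -> dot (stereo X1 X2 X3 X4 X5) (stereo X1 X2 X3 X4 X5) = (1 - X5) / (1 + X5).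
Proof.
move=> S y0; rewrite dotE !quatE /=.
transitivity ((X1 ^+ 2 + X2 ^+ 2 + X3 ^+ 2 + X4 ^+ 2) / (1 + X5) ^+ 2); first by field.
rewrite (_ : X1 ^+ 2 + X2 ^+ 2 + X3 ^+ 2 + X4 ^+ 2 = (1 - X5) * (1 + X5)); first by field.
rewrite (_ : X1 ^+ 2 + X2 ^+ 2 + X3 ^+ 2 + X4 ^+ 2 = 1 - X5 ^+ 2); first by ring.
by rewrite -S; ring.
Qed.

Lemma stereo_surj w : exists X1 X2 X3 X4 X5,
  [/\ X1 ^+ 2 + X2 ^+ 2 + X3 ^+ 2 + X4 ^+ 2 + X5 ^+ 2 = 1, 0 < 1 + X5 &
      w = stereo X1 X2 X3 X4 X5].
Proof.
have N0 : 0 < 1 + dot w w by rewrite ltr_pwDl // dot_ge0.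
have N1 : 1 + dot w w != 0 by rewrite gt_eqF.
pose X i : R := 2 * w ord0 i / (1 + dot w w).
have E : 1 + (1 - dot w w) / (1 + dot w w) = 2 / (1 + dot w w) by field.
exists (X 0), (X 1), (X 2), (X 3), ((1 - dot w w) / (1 + dot w w)); split.
- transitivity ((4 * (w ord0 0 * w ord0 0 + w ord0 1 * w ord0 1 + w ord0 2 * w ord0 2
    + w ord0 3 * w ord0 3) + (1 - dot w w) ^+ 2) / (1 + dot w w) ^+ 2); first by rewrite /X; field.
  by rewrite -dotE; field.
- by rewrite E divr_gt0.
- rewrite /stereo E /X; apply: row4_ext; rewrite quatE /=; field.
  all: by rewrite N1.
Qed.

Lemma cut_stereo X1 X2 X3 X4 X5 (w := stereo X1 X2 X3 X4 X5) :
  X1 ^+ 2 + X2 ^+ 2 + X3 ^+ 2 + X4 ^+ 2 + X5 ^+ 2 = 1 -> 0 < 1 + X5 ->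
  cut_dot w = 4 / (1 + X5) ^+ 2 * (c * s * X5 - a1 * b1 * X1 * X2 - a2 * b2 * X3 * X4) /\
  cut_gap w = 4 / (1 + X5) ^+ 2 * (b1 ^+ 2 * X2 ^+ 2 + b2 ^+ 2 * X4 ^+ 2 + s ^+ 2
     - (a1 ^+ 2 * X1 ^+ 2 + a2 ^+ 2 * X3 ^+ 2 + c ^+ 2 * X5 ^+ 2)).
Proof.
move=> S y0; have y1 : 1 + X5 != 0 by rewrite gt_eqF.
rewrite /cut_dot /cut_gap /w stereo_dot // !quatE /=.
by split; field.
Qed.

(** Up to the common factor 2 / (1 + X5), P is (a1 X1, a2 X3, c X5) and Q is (- b1 X2, - b2 X4,
    s). *)
Lemma cut_setP X1 X2 X3 X4 X5 :
  X1 ^+ 2 + X2 ^+ 2 + X3 ^+ 2 + X4 ^+ 2 + X5 ^+ 2 = 1 -> 0 < 1 + X5 ->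
  cut_set (stereo X1 X2 X3 X4 X5) <->
  c * s * X5 = a1 * b1 * X1 * X2 + a2 * b2 * X3 * X4 /\
  a1 ^+ 2 * X1 ^+ 2 + a2 ^+ 2 * X3 ^+ 2 + c ^+ 2 * X5 ^+ 2 <=
  b1 ^+ 2 * X2 ^+ 2 + b2 ^+ 2 * X4 ^+ 2 + s ^+ 2.
Proof.
move=> S y0; have [E1 E2] := cut_stereo S y0.
have k0 : 0 < 4 / (1 + X5) ^+ 2 by rewrite divr_gt0 // exprn_gt0.
rewrite /cut_set /= E1 E2 pmulr_rge0 // subr_ge0; split=> -[H1 H2]; split=> //.
  by move/eqP: H1; rewrite mulf_eq0 gt_eqF //= => /eqP; lra.
by rewrite H1; ring.
Qed.

Lemma rsmooth_stereo U (X1 X2 X3 X4 X5 : R4 -> R^o) : open U ->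
  smooth_on U X1 -> smooth_on U X2 -> smooth_on U X3 -> smooth_on U X4 -> smooth_on U X5 ->
  (forall x, U x -> 1 + X5 x != 0) ->
  rsmooth U (fun x => stereo (X1 x) (X2 x) (X3 x) (X4 x) (X5 x)).
Proof.
move=> oU s1 s2 s3 s4 s5 n5.
have sV : smooth_on U (fun x => (1 + X5 x)^-1 : R^o).
  by apply: smoothV => //; apply: smoothD => //; exact: smooth_cst.
by apply: rsmooth_quat; split=> /=; apply: smoothM.
Qed.

(** * Parametrisation of the cut when the phase is not real *)

Section GeneralPhase.
Hypothesis s_neq0 : s != 0.

(* Here Q is a graph over its third coordinate, so the plane orthogonal to Q is
   parametrised by the first two coordinates of P; write P = (g y2, g y3, g r k).
   Then r^2 is the positive root of a quadratic equation. *)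
Let A (y2 y3 : R) := y2 ^+ 2 / a1 ^+ 2 + y3 ^+ 2 / a2 ^+ 2.
Let K (c0 c1 y2 y3 : R) := (b1 * c0 * y2 + b2 * c1 * y3) / s.
Let Bt (c0 c1 : R) := b1 ^+ 2 * c0 ^+ 2 + b2 ^+ 2 * c1 ^+ 2.
Let N (y2 y3 : R) := 1 - s ^+ 2 * A y2 y3.
Let M (c0 c1 y2 y3 : R) := 1 - K c0 c1 y2 y3 ^+ 2 + Bt c0 c1 * A y2 y3
   + s ^+ 2 * K c0 c1 y2 y3 ^+ 2 / c ^+ 2.
Let D (c0 c1 y2 y3 : R) := M c0 c1 y2 y3 ^+ 2
   + 4 * (K c0 c1 y2 y3 ^+ 2 * (1 + Bt c0 c1 / c ^+ 2)) * N y2 y3.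
Let Ur (c0 c1 y2 y3 : R) := 2 * N y2 y3 / (M c0 c1 y2 y3 + Num.sqrt (D c0 c1 y2 y3)).
Let Rr (c0 c1 y2 y3 : R) := Num.sqrt (Ur c0 c1 y2 y3).
Let G2 (c0 c1 y2 y3 : R) := (Ur c0 c1 y2 y3 * Bt c0 c1 + s ^+ 2) / (1 + Ur c0 c1 y2 y3 * K c0 c1 y2 y3 ^+ 2).
Let Gr (c0 c1 y2 y3 : R) := Num.sqrt (G2 c0 c1 y2 y3).

(** If k = 0 then D = M^2 with M > 0; otherwise D > M^2, so sqrt D exceeds |M|. *)
Lemma disc_gt0 (c0 c1 y2 y3 : R) : 0 < N y2 y3 -> 0 < D c0 c1 y2 y3 /\
  0 < M c0 c1 y2 y3 + Num.sqrt (D c0 c1 y2 y3).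
Proof.
move=> n0; have B0 : 0 <= Bt c0 c1.
  by rewrite /Bt addr_ge0 // mulr_ge0 // sqr_ge0.
have A0 : 0 <= A y2 y3 by rewrite /A addr_ge0 // divr_ge0 // sqr_ge0.
have q0 : 0 < 1 + Bt c0 c1 / c ^+ 2 by rewrite ltr_pwDl // divr_ge0 // sqr_ge0.
have [k0|k0] := eqVneq (K c0 c1 y2 y3) 0.
  have M0 : 0 < M c0 c1 y2 y3.
    by rewrite /M k0 expr0n /= mulr0 mul0r addr0 subr0 ltr_pwDl // mulr_ge0.
  have D0 : 0 < D c0 c1 y2 y3 by rewrite /D k0 expr0n /= mul0r mulr0 mul0r addr0 exprn_gt0.
  by split=> //; rewrite ltr_pwDl // sqrtr_ge0.
have H : M c0 c1 y2 y3 ^+ 2 < D c0 c1 y2 y3.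
  have k2 : 0 < K c0 c1 y2 y3 ^+ 2 by rewrite exprn_even_gt0.
  by rewrite /D ltrDl; apply: mulr_gt0 => //; apply: mulr_gt0 => //; exact: mulr_gt0.
have D0 : 0 < D c0 c1 y2 y3 by apply: le_lt_trans H; exact: sqr_ge0.
split=> //; rewrite -ltrBlDl sub0r.
apply: le_lt_trans (ler_norm _) _.
by rewrite normrN -sqrtr_sqr ltr_sqrt.
Qed.

(** The scale g satisfies g^2 (1 + r^2 k^2) = |Q|^2, which turns |P| <= |Q| into y2^2 + y3^2 <= 1.
    Eliminating g^2 from the sphere equation leaves a quadratic in u = r^2 with nonnegative leading
    coefficient and constant term - N < 0. Its positive root is written 2 N / (M + sqrt D), which
    stays smooth where the leading coefficient vanishes. *)
Lemma root_facts (c0 c1 y2 y3 : R) : 0 < N y2 y3 ->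
  let u := Ur c0 c1 y2 y3 in let k := K c0 c1 y2 y3 in let g2 := G2 c0 c1 y2 y3 in
  [/\ 0 < u, 0 < g2, g2 * (1 + u * k ^+ 2) = u * Bt c0 c1 + s ^+ 2 &
      u + g2 * A y2 y3 + u * g2 * k ^+ 2 / c ^+ 2 = 1].
Proof.
move=> n0 u k g2; have [D0 MD0] := disc_gt0 c0 c1 n0.
have B0 : 0 <= Bt c0 c1 by rewrite /Bt addr_ge0 // mulr_ge0 // sqr_ge0.
have u0 : 0 < u by rewrite divr_gt0 // mulr_gt0.
have d0 : 0 < 1 + u * k ^+ 2 by rewrite ltr_pwDl // mulr_ge0 ?sqr_ge0 // ltW.
have d1 : 1 + u * k ^+ 2 != 0 by rewrite gt_eqF.
have g20 : 0 < g2.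
  apply: divr_gt0 => //; apply: ltr_wpDl; first by apply: mulr_ge0 => //; exact: ltW.
  by rewrite exprn_even_gt0.
have g2E : g2 * (1 + u * k ^+ 2) = u * Bt c0 c1 + s ^+ 2 by rewrite /g2 /G2 -/u -/k divfK.
have quad : k ^+ 2 * (1 + Bt c0 c1 / c ^+ 2) * u ^+ 2 + M c0 c1 y2 y3 * u - N y2 y3 = 0.
  rewrite /u /Ur; set S := Num.sqrt _.
  have SS : S ^+ 2 = D c0 c1 y2 y3 by rewrite sqr_sqrtr // ltW.
  have MS0 : M c0 c1 y2 y3 + S != 0 by rewrite gt_eqF.
  have nn0 : N y2 y3 != 0 by rewrite gt_eqF.
  set q := k ^+ 2 * _; set mm := M _ _ _ _; set nn := N _ _.
  have Eq : q * (4 * nn) = S ^+ 2 - mm ^+ 2 by rewrite SS /D -/k -/q -/mm -/nn; ring.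
  have -> : q = (S ^+ 2 - mm ^+ 2) / (4 * nn) by rewrite -Eq mulfK // mulf_neq0.
  by field; rewrite nn0 MS0.
split=> //.
apply: (mulIf d1); rewrite mul1r.
transitivity (u * (1 + u * k ^+ 2) + (g2 * (1 + u * k ^+ 2)) * (A y2 y3 + u * k ^+ 2 / c ^+ 2)).
  by ring.
rewrite g2E; apply/eqP; rewrite -subr_eq0 -quad /M /N -/k; apply/eqP; ring.
Qed.

Lemma root_unique (c0 c1 y2 y3 r g : R) : 0 < N y2 y3 -> 0 < r -> 0 < g ->
  let k := K c0 c1 y2 y3 in
  g ^+ 2 * (1 + r ^+ 2 * k ^+ 2) = r ^+ 2 * Bt c0 c1 + s ^+ 2 ->
  r ^+ 2 + g ^+ 2 * A y2 y3 + r ^+ 2 * g ^+ 2 * k ^+ 2 / c ^+ 2 = 1 ->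
  r = Rr c0 c1 y2 y3 /\ g = Gr c0 c1 y2 y3.
Proof.
move=> n0 r0 g0 k E1 E2.
have [u0 _ _ _] := root_facts c0 c1 n0.
have B0 : 0 <= Bt c0 c1 by rewrite /Bt addr_ge0 // mulr_ge0 // sqr_ge0.
have [D0 MD0] := disc_gt0 c0 c1 n0.
have d0 : 0 < 1 + r ^+ 2 * k ^+ 2 by rewrite ltr_pwDl // mulr_ge0 ?sqr_ge0.
set q := k ^+ 2 * (1 + Bt c0 c1 / c ^+ 2).
have q0 : 0 <= q by rewrite mulr_ge0 ?sqr_ge0 // addr_ge0 // divr_ge0 // sqr_ge0.
set mm := M c0 c1 y2 y3; set nn := N y2 y3 in n0 *.
have quad : q * (r ^+ 2) ^+ 2 + mm * r ^+ 2 - nn = 0.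
  have : r ^+ 2 * (1 + r ^+ 2 * k ^+ 2)
     + (g ^+ 2 * (1 + r ^+ 2 * k ^+ 2)) * (A y2 y3 + r ^+ 2 * k ^+ 2 / c ^+ 2) = 1 + r ^+ 2 * k ^+ 2.
    by rewrite -[RHS]mul1r -{3}E2; ring.
  rewrite E1 => /eqP; rewrite -subr_eq0 => /eqP <-.
  by rewrite /q /mm /nn /M /N -/k; ring.
set S := Num.sqrt (D c0 c1 y2 y3) in MD0.
have SS : S ^+ 2 = mm ^+ 2 + 4 * q * nn by rewrite sqr_sqrtr ?ltW.
have Er : r ^+ 2 = Ur c0 c1 y2 y3.
  have MS0 : mm + S != 0 by rewrite gt_eqF.
  apply: (mulIf MS0); rewrite /Ur -/mm -/S -/nn divfK //.
  have S0 : 0 <= S by exact: sqrtr_ge0.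
  have h1 : (2 * q * r ^+ 2 + mm) ^+ 2 = S ^+ 2.
    rewrite SS (_ : nn = q * (r ^+ 2) ^+ 2 + mm * r ^+ 2); first by ring.
    exact: esym (subr0_eq quad).
  (* Fixes the sign of the square root: q r^2 + M is positive because its product with r^2 is N. *)
  have h2 : 0 <= 2 * q * r ^+ 2 + mm.
    have : 0 < (q * r ^+ 2 + mm) * r ^+ 2.
      by rewrite (_ : _ * _ = nn) //; apply/eqP; rewrite -subr_eq0 -quad; apply/eqP; ring.
    rewrite pmulr_lgt0 ?exprn_gt0 // => h; rewrite (_ : _ + _ = q * r ^+ 2 + (q * r ^+ 2 + mm)); last by ring.
    apply: addr_ge0; last exact: ltW.
    by apply: mulr_ge0 => //; exact: sqr_ge0.
  have h3 : 2 * q * r ^+ 2 + mm = S.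
    by apply/eqP; rewrite -(@eqrXn2 _ 2) // h1.
  rewrite -h3 (_ : nn = q * (r ^+ 2) ^+ 2 + mm * r ^+ 2); first by ring.
  exact: esym (subr0_eq quad).
split; first by rewrite /Rr -Er sqrtr_sqr gtr0_norm.
rewrite /Gr /G2 -Er -/k -E1 mulfK ?gt_eqF //.
by rewrite sqrtr_sqr gtr0_norm.
Qed.

Let c0 x := x ord0 0 / Num.sqrt (circle_sq x).
Let c1 x := x ord0 1 / Num.sqrt (circle_sq x).
Let U : set R4 := [set x | 0 < circle_sq x] `&` [set x | 0 < N (x ord0 2) (x ord0 3)].
Let k x := K (c0 x) (c1 x) (x ord0 2) (x ord0 3).
Let r x := Rr (c0 x) (c1 x) (x ord0 2) (x ord0 3).
Let g x := Gr (c0 x) (c1 x) (x ord0 2) (x ord0 3).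

Definition torus_param x : R4 :=
  stereo (g x * x ord0 2 / a1) (r x * c0 x) (g x * x ord0 3 / a2) (r x * c1 x) (r x * g x * k x / c).

Definition torus_w13 w : R := w ord0 1 * w ord0 1 + w ord0 3 * w ord0 3.
(** This is |Q|^2 - P3^2, equal to g^2 up to the stereographic factor on the image of [torus_param].
    Dividing P1 and P2 by its root recovers y2 and y3, while (w1, w3) gives the circle
    coordinate. *)
Definition torus_gap w : R := 4 * b1 ^+ 2 * w ord0 1 ^+ 2 + 4 * b2 ^+ 2 * w ord0 3 ^+ 2
  + s ^+ 2 * (1 + dot w w) ^+ 2 - c ^+ 2 * (1 - dot w w) ^+ 2.
Definition torus_coord w : R4 :=
  quat (w ord0 1 / Num.sqrt (torus_w13 w) +i* (w ord0 3 / Num.sqrt (torus_w13 w)))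
       (2 * a1 * w ord0 0 / Num.sqrt (torus_gap w) +i* (2 * a2 * w ord0 2 / Num.sqrt (torus_gap w))).

Lemma smooth_N V : open V -> smooth_on V (fun x => N (x ord0 2) (x ord0 3) : R^o).
Proof.
move=> oV; apply: smoothB => //; first exact: smooth_cst.
apply: smoothM => //; first exact: smooth_cst.
apply: smoothD => //; apply: smoothM => //; try exact: smooth_cst.
  by apply: smoothX2 => //; exact: smooth_coord.
by apply: smoothX2 => //; exact: smooth_coord.
Qed.

Lemma open_torus_domain : open U.
Proof.
apply: openI; first exact: open_circle_sq.
exact: (open_pos (smooth_N openT)).
Qed.

Lemma circle_sum x : 0 < circle_sq x -> (r x * c0 x) ^+ 2 + (r x * c1 x) ^+ 2 = r x ^+ 2.
Proof.
move=> /circle_coords; rewrite -/(c0 x) -/(c1 x); move: (c0 x) (c1 x) (r x) => a b d E.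
by rewrite -[RHS]mulr1 -E; ring.
Qed.

Lemma torus_param_facts x : U x ->
  [/\ 0 < r x, 0 < g x, r x ^+ 2 + g x ^+ 2 * A (x ord0 2) (x ord0 3)
     + r x ^+ 2 * g x ^+ 2 * k x ^+ 2 / c ^+ 2 = 1 &
     g x ^+ 2 * (1 + r x ^+ 2 * k x ^+ 2) = r x ^+ 2 * Bt (c0 x) (c1 x) + s ^+ 2].
Proof.
move=> [_ n0]; have [u0 g0 E1 E2] := root_facts (c0 x) (c1 x) n0.
have r2 : r x ^+ 2 = Ur (c0 x) (c1 x) (x ord0 2) (x ord0 3) by rewrite sqr_sqrtr // ltW.
have g2 : g x ^+ 2 = G2 (c0 x) (c1 x) (x ord0 2) (x ord0 3) by rewrite sqr_sqrtr // ltW.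
by rewrite r2 g2; split=> //; rewrite sqrtr_gt0.
Qed.

Lemma torus_param_sphere x : U x ->
  (g x * x ord0 2 / a1) ^+ 2 + (r x * c0 x) ^+ 2 + (g x * x ord0 3 / a2) ^+ 2
  + (r x * c1 x) ^+ 2 + (r x * g x * k x / c) ^+ 2 = 1 /\ 0 < 1 + r x * g x * k x / c.
Proof.
move=> Ux; have [r0 g0 E _] := torus_param_facts Ux.
have [h0 _] := Ux; have cc : c0 x ^+ 2 + c1 x ^+ 2 = 1 := circle_coords h0.
have a10 : a1 != 0 by rewrite gt_eqF.
have a20 : a2 != 0 by rewrite gt_eqF.
have S : (g x * x ord0 2 / a1) ^+ 2 + (r x * c0 x) ^+ 2 + (g x * x ord0 3 / a2) ^+ 2
  + (r x * c1 x) ^+ 2 + (r x * g x * k x / c) ^+ 2 = 1.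
  rewrite -E -[X in _ = X + _ + _]mulr1 -cc /A.
  move: (c0 x) (c1 x) (k x) (g x) (r x) (x ord0 2) (x ord0 3) => ? ? ? ? ? ? ?.
  by field; rewrite a10 a20 c_neq0.
split=> //; move: S; set X5 := _ / c => S.
have h : X5 ^+ 2 < 1.
  have p : 0 < (r x * c0 x) ^+ 2 + (r x * c1 x) ^+ 2 by rewrite circle_sum // exprn_gt0.
  have q1 := sqr_ge0 (g x * x ord0 2 / a1); have q2 := sqr_ge0 (g x * x ord0 3 / a2).
  move: p q1 q2 S; move: (_ ^+ 2) (_ ^+ 2) (_ ^+ 2) (_ ^+ 2) (_ ^+ 2) => ? ? ? ? ?; lra.
exact: sqr_lt1_gtN1 h.
Qed.

Lemma rsmooth_torus_param : rsmooth U torus_param.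
Proof.
have oU := open_torus_domain.
have sc0 : smooth_on U (c0 : R4 -> R^o) by apply: smooth_circle_coord => // x [].
have sc1 : smooth_on U (c1 : R4 -> R^o) by apply: smooth_circle_coord => // x [].
have sx i : smooth_on U (fun x => x ord0 i : R^o) by exact: smooth_coord.
have cst0 (a : R) : smooth_on U (fun=> a : R^o) by exact: smooth_cst.
have sk : smooth_on U (k : R4 -> R^o).
  by apply: smoothM => //; apply: smoothD => //; apply: smoothM => //; apply: smoothM.
have sN : smooth_on U (fun x => N (x ord0 2) (x ord0 3) : R^o) by exact: smooth_N.
have sA : smooth_on U (fun x => A (x ord0 2) (x ord0 3) : R^o).
  by apply: smoothD => //; apply: smoothM => //; apply: smoothX2.
have sB : smooth_on U (fun x => Bt (c0 x) (c1 x) : R^o).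
  by apply: smoothD => //; apply: smoothM => //; apply: smoothX2.
have sM : smooth_on U (fun x => M (c0 x) (c1 x) (x ord0 2) (x ord0 3) : R^o).
  apply: smoothD => //.
    apply: smoothD => //; last exact: smoothM.
    by apply: smoothB => //; exact: smoothX2.
  by apply: smoothM => //; apply: smoothM => //; exact: smoothX2.
have sD : smooth_on U (fun x => D (c0 x) (c1 x) (x ord0 2) (x ord0 3) : R^o).
  apply: smoothD => //; first exact: smoothX2.
  apply: smoothM => //; apply: smoothM => //; apply: smoothM => //; first exact: smoothX2.
  by apply: smoothD => //; exact: smoothM.
have sU : smooth_on U (fun x => Ur (c0 x) (c1 x) (x ord0 2) (x ord0 3) : R^o).
  apply: smoothM => //; first exact: smoothM.
  apply: smoothV => // [x [_ n0]|].
    by have [_ h] := disc_gt0 (c0 x) (c1 x) n0; rewrite gt_eqF.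
  apply: smoothD => //; apply: smooth_sqrt => // x [_ n0].
  by have [h _] := disc_gt0 (c0 x) (c1 x) n0.
have sr : smooth_on U (r : R4 -> R^o).
  by apply: smooth_sqrt => // x [_ n0]; have [h _ _ _] := root_facts (c0 x) (c1 x) n0.
have sg : smooth_on U (g : R4 -> R^o).
  apply: smooth_sqrt => // [x [_ n0]|]; first by have [_ h _ _] := root_facts (c0 x) (c1 x) n0.
  apply: smoothM => //; first by apply: smoothD => //; exact: smoothM.
  apply: smoothV => // [x [_ n0]|].
    have [u0 _ _ _] := root_facts (c0 x) (c1 x) n0.
    by rewrite gt_eqF // ltr_pwDl // mulr_ge0 ?sqr_ge0 // ltW.
  by apply: smoothD => //; apply: smoothM => //; exact: smoothX2.
apply: rsmooth_stereo => //.
- by apply: smoothM => //; exact: smoothM.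
- exact: smoothM.
- by apply: smoothM => //; exact: smoothM.
- exact: smoothM.
- by apply: smoothM => //; apply: smoothM => //; exact: smoothM.
- by move=> x /torus_param_sphere[_ h]; rewrite gt_eqF.
Qed.

Lemma torus_w13_stereo X1 X2 X3 X4 X5 :
  torus_w13 (stereo X1 X2 X3 X4 X5) = (X2 ^+ 2 + X4 ^+ 2) / (1 + X5) ^+ 2.
Proof. by rewrite /torus_w13 !quatE /= mulrDl -!expr_div_n !expr2. Qed.

Lemma torus_gap_stereo X1 X2 X3 X4 X5 :
  X1 ^+ 2 + X2 ^+ 2 + X3 ^+ 2 + X4 ^+ 2 + X5 ^+ 2 = 1 -> 0 < 1 + X5 ->
  torus_gap (stereo X1 X2 X3 X4 X5) =
  (b1 ^+ 2 * X2 ^+ 2 + b2 ^+ 2 * X4 ^+ 2 + s ^+ 2 - c ^+ 2 * X5 ^+ 2) * (2 / (1 + X5)) ^+ 2.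
Proof.
move=> S y0; have y1 : 1 + X5 != 0 by rewrite gt_eqF.
by rewrite /torus_gap stereo_dot // !quatE /=; field.
Qed.

Lemma torus_param_gap x : U x ->
  b1 ^+ 2 * (r x * c0 x) ^+ 2 + b2 ^+ 2 * (r x * c1 x) ^+ 2 + s ^+ 2
    - c ^+ 2 * (r x * g x * k x / c) ^+ 2 = g x ^+ 2.
Proof.
move=> Ux; have [_ _ _ E] := torus_param_facts Ux.
transitivity (r x ^+ 2 * Bt (c0 x) (c1 x) + s ^+ 2 - r x ^+ 2 * g x ^+ 2 * k x ^+ 2).
  rewrite /Bt; move: (c0 x) (c1 x) (k x) (g x) (r x) => ? ? ? ? ?.
  by field.
by rewrite -E; move: (k x) (g x) (r x) => ? ? ?; ring.
Qed.

Lemma torus_coordK x : U x -> torus_coord (torus_param x) = circle_retract x.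
Proof.
move=> Ux; have [r0 g0 _ _] := torus_param_facts Ux.
have [S y0] := torus_param_sphere Ux; have [h0 _] := Ux.
have E1 : Num.sqrt (torus_w13 (torus_param x)) = r x / (1 + r x * g x * k x / c).
  rewrite torus_w13_stereo circle_sum // -expr_div_n sqrtr_sqr.
  by rewrite ger0_norm // divr_ge0 // ltW.
have E2 : Num.sqrt (torus_gap (torus_param x)) = g x * (2 / (1 + r x * g x * k x / c)).
  rewrite torus_gap_stereo // torus_param_gap // -exprMn sqrtr_sqr.
  by rewrite ger0_norm // mulr_ge0 ?divr_ge0 // ltW.
rewrite /torus_coord E1 E2 /circle_retract -/(c0 x) -/(c1 x) /torus_param /stereo.
move: y0; move: (1 + _) => y y0.
have [a10 a20 y1 r1 g1] : [/\ a1 != 0, a2 != 0, y != 0, r x != 0 & g x != 0] by rewrite !gt_eqF.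
move: (c0 x) (c1 x) (g x) (r x) g1 r1 => ? ? ? ? g1 r1.
apply: row4_ext; rewrite !quatE /=; field.
all: by rewrite ?a10 ?a20 ?y1 ?r1 ?g1.
Qed.

Lemma torus_coord_diff x : U x -> differentiable torus_coord (torus_param x).
Proof.
move=> Ux; have [r0 g0 _ _] := torus_param_facts Ux.
have [S y0] := torus_param_sphere Ux; have [h0 _] := Ux.
pose W := [set w | 0 < torus_w13 w] `&` [set w | 0 < torus_gap w].
have cst0 V (a : R) : smooth_on V (fun=> a : R^o) by exact: smooth_cst.
have s13 V : open V -> smooth_on V (fun w => torus_w13 w : R^o).
  by move=> oV; apply: smoothD => //; apply: smoothM => //; exact: smooth_coord.
have sdot V : open V -> smooth_on V (fun w => dot w w : R^o).
  by move=> oV; apply: smooth_dot => //; exact: rsmooth_id.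
have sgap V : open V -> smooth_on V (fun w => torus_gap w : R^o).
  move=> oV; apply: smoothB => //; last first.
    by apply: smoothM => //; apply: smoothX2 => //; apply: smoothB => //; exact: sdot.
  apply: smoothD => //; last first.
    by apply: smoothM => //; apply: smoothX2 => //; apply: smoothD => //; exact: sdot.
  by apply: smoothD => //; apply: smoothM => //; apply: smoothX2 => //; exact: smooth_coord.
have oW : open W by apply: openI; apply: open_pos; [apply: s13|apply: sgap]; exact: openT.
have Wx : W (torus_param x).
  split=> /=.
    rewrite torus_w13_stereo circle_sum //.
    by rewrite divr_gt0 // exprn_gt0.
  by rewrite torus_gap_stereo // torus_param_gap // mulr_gt0 // exprn_gt0 // divr_gt0.
apply: (@rsmooth_diff _ W) => //.
apply: rsmooth_quat; split=> /=; apply: smoothM => //.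
- exact: smooth_coord.
- by apply: smooth_sqrtV => // [|w []//]; exact: s13.
- exact: smooth_coord.
- by apply: smooth_sqrtV => // [|w []//]; exact: s13.
- by apply: smoothM => //; exact: smooth_coord.
- by apply: smooth_sqrtV => // [|w []//]; exact: sgap.
- by apply: smoothM => //; exact: smooth_coord.
- by apply: smooth_sqrtV => // [|w []//]; exact: sgap.
Qed.

(** Both a1 and a2 are at least 1, so [A] is at most 1 on the disc, while c <> 0 gives s^2 < 1. *)
Lemma torus_A_lt1 (y2 y3 : R) : y2 ^+ 2 + y3 ^+ 2 <= 1 -> 0 < N y2 y3.
Proof.
move=> h.
have le1 (a b y : R) : 0 < a -> a ^+ 2 = 1 + b ^+ 2 -> y ^+ 2 / a ^+ 2 <= y ^+ 2.
  move=> a0 ab; rewrite ler_pdivrMr ?exprn_gt0 // ab mulrDr mulr1 lerDl.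
  by rewrite mulr_ge0 ?sqr_ge0.
have A1 : A y2 y3 <= 1 by apply: le_trans h; apply: lerD; [exact: le1 a1_gt0 ab1|exact: le1 a2_gt0 ab2].
have A0 : 0 <= A y2 y3 by rewrite /A addr_ge0 // divr_ge0 // sqr_ge0.
have s2 : s ^+ 2 < 1 by rewrite -cs1 ltrDr exprn_even_gt0.
have s20 := sqr_ge0 s.
rewrite /N subr_gt0; apply: le_lt_trans s2.
by rewrite -[leRHS]mulr1; apply: ler_wpM2l.
Qed.

Lemma solid_torus_domain : @solid_torus R `<=` U.
Proof.
move=> x Tx; split; first by rewrite /= (solid_torus_circle Tx).
by case: Tx => _; exact: torus_A_lt1.
Qed.

Lemma torus_param_cut x : solid_torus x -> cut_set (torus_param x).
Proof.
move=> Tx; have Ux := solid_torus_domain Tx.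
have [S y0] := torus_param_sphere Ux; have [r0 g0 _ E] := torus_param_facts Ux.
have a10 : a1 != 0 by rewrite gt_eqF.
have a20 : a2 != 0 by rewrite gt_eqF.
apply/(cut_setP S y0); split.
  rewrite /k /K; move: (c0 x) (c1 x) (g x) (r x) => ? ? ? ?.
  by field; rewrite a10 a20 c_neq0.
rewrite -subr_ge0.
have -> : b1 ^+ 2 * (r x * c0 x) ^+ 2 + b2 ^+ 2 * (r x * c1 x) ^+ 2 + s ^+ 2 -
    (a1 ^+ 2 * (g x * x ord0 2 / a1) ^+ 2 + a2 ^+ 2 * (g x * x ord0 3 / a2) ^+ 2 +
     c ^+ 2 * (r x * g x * k x / c) ^+ 2) = g x ^+ 2 * (1 - (x ord0 2 ^+ 2 + x ord0 3 ^+ 2)).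
  transitivity (b1 ^+ 2 * (r x * c0 x) ^+ 2 + b2 ^+ 2 * (r x * c1 x) ^+ 2 + s ^+ 2 -
     c ^+ 2 * (r x * g x * k x / c) ^+ 2 - g x ^+ 2 * (x ord0 2 ^+ 2 + x ord0 3 ^+ 2)).
    move: (c0 x) (c1 x) (g x) (r x) (k x) => ? ? ? ? ?.
    by field; rewrite a10 a20 c_neq0.
  by rewrite torus_param_gap //; move: (g x) => ?; ring.
by rewrite mulr_ge0 ?sqr_ge0 // subr_ge0; case: Tx.
Qed.

Lemma torus_param_surj w : cut_set w -> exists2 x, solid_torus x & torus_param x = w.
Proof.
have [X1 [X2 [X3 [X4 [X5 [S y0 ->]]]]]] := stereo_surj w.
move=> /(cut_setP S y0)[E1 E2].
have a10 : a1 != 0 by rewrite gt_eqF.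
have a20 : a2 != 0 by rewrite gt_eqF.
have s2 : s ^+ 2 < 1 by rewrite -cs1 ltrDr exprn_even_gt0.
have cs0 : c * s != 0 by rewrite mulf_neq0.
have lea (a b y : R) : a ^+ 2 = 1 + b ^+ 2 -> y ^+ 2 <= a ^+ 2 * y ^+ 2.
  by move=> ->; rewrite mulrDl mul1r lerDl mulr_ge0 ?sqr_ge0.
have le1 := lea _ _ X1 ab1; have le2 := lea _ _ X3 ab2.
(* If X2 = X4 = 0, orthogonality gives X5 = 0, and then 1 = X1^2 + X3^2 <= |P|^2 <= s^2 < 1. *)
have r0 : 0 < X2 ^+ 2 + X4 ^+ 2.
  rewrite lt_neqAle addr_ge0 ?sqr_ge0 // andbT eq_sym paddr_eq0 ?sqr_ge0 //.
  rewrite !sqrf_eq0; apply/negP => /andP[/eqP X20 /eqP X40].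
  have X50 : X5 = 0.
    by apply: (mulfI cs0); rewrite E1 X20 X40; ring.
  move: S E2 le1 le2 s2; rewrite X20 X40 X50 !expr0n /= !mulr0 !addr0 !add0r.
  move: (X1 ^+ 2) (X3 ^+ 2) (a1 ^+ 2 * _) (a2 ^+ 2 * _) (s ^+ 2) => ? ? ? ? ?; lra.
set gg := b1 ^+ 2 * X2 ^+ 2 + b2 ^+ 2 * X4 ^+ 2 + s ^+ 2 - c ^+ 2 * X5 ^+ 2.
have gg1 : a1 ^+ 2 * X1 ^+ 2 + a2 ^+ 2 * X3 ^+ 2 <= gg by rewrite /gg lerBrDr.
(* If |Q|^2 = P3^2, then X1 = X3 = 0, so X5 = 0 by orthogonality, and |Q|^2 >= s^2 > 0 gives a
   contradiction. *)
have g0 : 0 < gg.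
  rewrite lt_neqAle (le_trans _ gg1) ?andbT; last first.
    by apply: addr_ge0; [apply: le_trans le1|apply: le_trans le2]; exact: sqr_ge0.
  apply/eqP => gg0; move: gg1; rewrite -gg0 => gg1.
  have [X10 X30] : X1 = 0 /\ X3 = 0.
    have H : X1 ^+ 2 + X3 ^+ 2 == 0.
      by rewrite eq_le addr_ge0 ?sqr_ge0 // andbT (le_trans _ gg1) // lerD.
    by move: H; rewrite paddr_eq0 ?sqr_ge0 // !sqrf_eq0 => /andP[/eqP -> /eqP ->].
  have X50 : X5 = 0 by apply: (mulfI cs0); rewrite E1 X10 X30; ring.
  have : 0 < gg.
    rewrite /gg X50 expr0n /= mulr0 subr0 ltr_wpDl ?exprn_even_gt0 //.
    by rewrite addr_ge0 // mulr_ge0 ?sqr_ge0.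
  by rewrite -gg0 ltxx.
set rr := Num.sqrt (X2 ^+ 2 + X4 ^+ 2); set g' := Num.sqrt gg.
have rr0 : 0 < rr by rewrite sqrtr_gt0.
have g'0 : 0 < g' by rewrite sqrtr_gt0.
have rr2 : rr ^+ 2 = X2 ^+ 2 + X4 ^+ 2 by rewrite sqr_sqrtr // ltW.
have g'2 : g' ^+ 2 = gg by rewrite sqr_sqrtr // ltW.
have rr1 : rr != 0 by rewrite gt_eqF.
have g'1 : g' != 0 by rewrite gt_eqF.
clearbody rr g'.
(* The preimage is dictated by [torus_coord]. *)
pose x := quat ((X2 / rr) +i* (X4 / rr)) ((a1 * X1 / g') +i* (a2 * X3 / g')).
have x01 : (X2 / rr) ^+ 2 + (X4 / rr) ^+ 2 = 1.
  by rewrite !expr_div_n -mulrDl -rr2 divff // expf_neq0.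
have x23 : (a1 * X1 / g') ^+ 2 + (a2 * X3 / g') ^+ 2 <= 1.
  rewrite !expr_div_n -mulrDl ler_pdivrMr ?exprn_gt0 // mul1r g'2.
  by rewrite !exprMn.
have Tx : solid_torus x by split; rewrite !quatE.
have csq := solid_torus_circle Tx.
have n0 := torus_A_lt1 x23.
have c0E : c0 x = X2 / rr by rewrite /c0 csq sqrtr1 divr1 quatE.
have c1E : c1 x = X4 / rr by rewrite /c1 csq sqrtr1 divr1 quatE.
have kE : K (X2 / rr) (X4 / rr) (a1 * X1 / g') (a2 * X3 / g') = c * X5 / (rr * g').
  apply: (mulfI s_neq0); rewrite /K.
  transitivity ((a1 * b1 * X1 * X2 + a2 * b2 * X3 * X4) / (rr * g')); first by field; rewrite rr1 g'1.
  by rewrite -E1; field; rewrite rr1 g'1.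
have H1 : g' ^+ 2 * (1 + rr ^+ 2 * K (X2 / rr) (X4 / rr) (a1 * X1 / g') (a2 * X3 / g') ^+ 2) =
    rr ^+ 2 * Bt (X2 / rr) (X4 / rr) + s ^+ 2.
  rewrite kE; transitivity (g' ^+ 2 + c ^+ 2 * X5 ^+ 2); first by field; rewrite rr1 g'1.
  rewrite g'2 /gg /Bt; field.
  by rewrite rr1.
have H2 : rr ^+ 2 + g' ^+ 2 * A (a1 * X1 / g') (a2 * X3 / g')
    + rr ^+ 2 * g' ^+ 2 * K (X2 / rr) (X4 / rr) (a1 * X1 / g') (a2 * X3 / g') ^+ 2 / c ^+ 2 = 1.
  rewrite kE -[RHS]S /A; transitivity (rr ^+ 2 + X1 ^+ 2 + X3 ^+ 2 + X5 ^+ 2).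
    by field; rewrite a10 a20 c_neq0 rr1 g'1.
  by rewrite rr2; ring.
(* The two relations determine the positive pair (r, g), so the radii read off from the point are
   those used by [torus_param]. *)
have [F1 F2] := root_unique n0 rr0 g'0 H1 H2.
exists x => //.
have [x2 x3] : x ord0 2 = a1 * X1 / g' /\ x ord0 3 = a2 * X3 / g' by rewrite !quatE.
rewrite /torus_param /r /g /k c0E c1E x2 x3 -F1 -F2 kE /stereo.
have E5 : rr * g' * (c * X5 / (rr * g')) / c = X5 by field; rewrite c_neq0 rr1 g'1.
rewrite E5; have y1 : 1 + X5 != 0 by rewrite gt_eqF.
by congr quat; congr (_ +i* _); field; rewrite ?a10 ?a20 ?y1 ?rr1 ?g'1.
Qed.

Lemma embedded_torus_general (A0 : 'M[C]_4) (e f e' f' : 'rV[C]_4) (l m : R) (om : C) :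
  normal_frame A0 e f e' f' l m om -> embedded_solid_torus (moebius e f @` cut_set).
Proof.
move=> nf; rewrite (_ : cut_set = torus_param @` @solid_torus R).
  by apply: (torus_embedding nf open_torus_domain solid_torus_domain _ rsmooth_torus_param
    torus_coord_diff torus_coordK) => x [].
apply/seteqP; split=> [w /torus_param_surj[x]|w [x Tx <-]]; first by exists x.
exact: torus_param_cut.
Qed.

End GeneralPhase.
End SolidTorusParam.

(** * Parametrisation of the cut when the phase is real *)

Section RealPhase.
Variable R : realType.
Local Notation C := R[i].
Local Notation R4 := 'rV[R]_4.
Implicit Types (x w : R4).

Variables a1 b1 a2 b2 c : R.
Hypothesis a1_gt0 : 0 < a1.
Hypothesis a2_gt0 : 0 < a2.
Hypothesis b1_neq0 : b1 != 0.
Hypothesis b2_neq0 : b2 != 0.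
Hypothesis cc1 : c ^+ 2 = 1.
Local Notation cut_set := (cut_set a1 b1 a2 b2 c 0).

(* Here P.Q = 0 only constrains the first two coordinates of P; with the circle
   coordinates (c0, c1), write P = r (- b2 c1 y2, b1 c0 y2, sqrt Bt y3). *)
Let c0 x := x ord0 0 / Num.sqrt (circle_sq x).
Let c1 x := x ord0 1 / Num.sqrt (circle_sq x).
Let Bt (t0 t1 : R) := b1 ^+ 2 * t0 ^+ 2 + b2 ^+ 2 * t1 ^+ 2.
Let E (t0 t1 y2 y3 : R) := 1 + y2 ^+ 2 * (b2 ^+ 2 * t1 ^+ 2 / a1 ^+ 2 + b1 ^+ 2 * t0 ^+ 2 / a2 ^+ 2)
  + Bt t0 t1 * y3 ^+ 2.
Let Rr (t0 t1 y2 y3 : R) := (Num.sqrt (E t0 t1 y2 y3))^-1.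
Let U : set R4 := [set x | 0 < circle_sq x].
Let r x := Rr (c0 x) (c1 x) (x ord0 2) (x ord0 3).
Let q x := Num.sqrt (Bt (c0 x) (c1 x)).

Definition torus_param0 x : R4 :=
  stereo (- (r x * b2 * c1 x * x ord0 2 / a1)) (r x * c0 x)
         (r x * b1 * c0 x * x ord0 2 / a2) (r x * c1 x) (r x * q x * x ord0 3 / c).

Definition torus_gap0 w : R := b1 ^+ 2 * w ord0 1 ^+ 2 + b2 ^+ 2 * w ord0 3 ^+ 2.
(** Recovers y2 as the component of (P1, P2) along the direction orthogonal to (Q1, Q2), and y3 as
    P3 / |Q|. *)
Definition torus_coord0 w : R4 :=
  quat (w ord0 1 / Num.sqrt (torus_w13 w) +i* (w ord0 3 / Num.sqrt (torus_w13 w)))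
       ((b1 * a2 * w ord0 1 * w ord0 2 - b2 * a1 * w ord0 3 * w ord0 0) / torus_gap0 w
        +i* (c / 2 * (1 - dot w w) / Num.sqrt (torus_gap0 w))).

(** Says that Q does not vanish; both b1 and b2 must be nonzero, since either circle coordinate may
    vanish. *)
Lemma Bt_gt0 (t0 t1 : R) : t0 ^+ 2 + t1 ^+ 2 = 1 -> 0 < Bt t0 t1.
Proof.
move=> t; have B1 : 0 < b1 ^+ 2 by rewrite exprn_even_gt0.
have B2 : 0 < b2 ^+ 2 by rewrite exprn_even_gt0.
have [t00|t00] := eqVneq t0 0.
  by move: t; rewrite /Bt t00 expr0n /= mulr0 !add0r => ->; rewrite mulr1.
apply: ltr_pwDl; first by apply: mulr_gt0 => //; rewrite exprn_even_gt0.
by rewrite mulr_ge0 ?sqr_ge0.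
Qed.

Lemma E_gt0 (t0 t1 y2 y3 : R) : 0 < E t0 t1 y2 y3.
Proof.
rewrite /E -addrA; apply: ltr_pwDl => //; rewrite /Bt.
by repeat first [exact: sqr_ge0 | apply: addr_ge0 | apply: divr_ge0 | apply: mulr_ge0].
Qed.

Lemma torus_param0_facts x : U x ->
  [/\ 0 < r x, 0 < q x, q x ^+ 2 = Bt (c0 x) (c1 x) &
     r x ^+ 2 * E (c0 x) (c1 x) (x ord0 2) (x ord0 3) = 1].
Proof.
move=> Ux; have B0 := Bt_gt0 (circle_coords Ux).
have E0 := E_gt0 (c0 x) (c1 x) (x ord0 2) (x ord0 3).
split; first by rewrite invr_gt0 sqrtr_gt0.
- by rewrite sqrtr_gt0.
- by rewrite sqr_sqrtr // ltW.
by rewrite /r /Rr exprVn sqr_sqrtr ?ltW // mulVf // gt_eqF.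
Qed.

Lemma circle_sum0 x : U x -> (r x * c0 x) ^+ 2 + (r x * c1 x) ^+ 2 = r x ^+ 2.
Proof.
move=> /circle_coords; rewrite -/(c0 x) -/(c1 x); move: (c0 x) (c1 x) (r x) => a b d H.
by rewrite -[RHS]mulr1 -H; ring.
Qed.

Lemma c_neq0_real : c != 0.
Proof. by apply/eqP => H; move: cc1; rewrite H expr0n /= => /eqP; rewrite eq_sym oner_eq0. Qed.

Lemma torus_param0_sphere x : U x ->
  (- (r x * b2 * c1 x * x ord0 2 / a1)) ^+ 2 + (r x * c0 x) ^+ 2
  + (r x * b1 * c0 x * x ord0 2 / a2) ^+ 2 + (r x * c1 x) ^+ 2
  + (r x * q x * x ord0 3 / c) ^+ 2 = 1 /\ 0 < 1 + r x * q x * x ord0 3 / c.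
Proof.
move=> Ux; have [r0 q0 q2 e] := torus_param0_facts Ux.
have cc : c0 x ^+ 2 + c1 x ^+ 2 = 1 := circle_coords Ux.
have a10 : a1 != 0 by rewrite gt_eqF.
have a20 : a2 != 0 by rewrite gt_eqF.
have S5 : (r x * q x * x ord0 3 / c) ^+ 2 = r x ^+ 2 * Bt (c0 x) (c1 x) * x ord0 3 ^+ 2.
  rewrite -q2; move: (q x) (r x) (x ord0 3) => ? ? ?.
  by rewrite !expr_div_n cc1 divr1; ring.
have S : (- (r x * b2 * c1 x * x ord0 2 / a1)) ^+ 2 + (r x * c0 x) ^+ 2
  + (r x * b1 * c0 x * x ord0 2 / a2) ^+ 2 + (r x * c1 x) ^+ 2
  + (r x * q x * x ord0 3 / c) ^+ 2 = 1.
  rewrite S5 -e /E -[X in _ = _ * (X + _ + _)]cc.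
  move: (c0 x) (c1 x) (r x) (x ord0 2) (x ord0 3) => ? ? ? ? ?.
  by rewrite /Bt; field; rewrite a10 a20.
split=> //; apply: sqr_lt1_gtN1.
have p : 0 < (r x * c0 x) ^+ 2 + (r x * c1 x) ^+ 2 by rewrite circle_sum0 // exprn_gt0.
have q1 := sqr_ge0 (- (r x * b2 * c1 x * x ord0 2 / a1)).
have q3 := sqr_ge0 (r x * b1 * c0 x * x ord0 2 / a2).
move: p q1 q3 S; move: (_ ^+ 2) (_ ^+ 2) (_ ^+ 2) (_ ^+ 2) (_ ^+ 2) => ? ? ? ? ?; lra.
Qed.

Lemma rsmooth_torus_param0 : rsmooth U torus_param0.
Proof.
have oU : open U by exact: open_circle_sq.
have sc0 : smooth_on U (c0 : R4 -> R^o) by apply: smooth_circle_coord.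
have sc1 : smooth_on U (c1 : R4 -> R^o) by apply: smooth_circle_coord.
have sx i : smooth_on U (fun x => x ord0 i : R^o) by exact: smooth_coord.
have cst0 (a : R) : smooth_on U (fun=> a : R^o) by exact: smooth_cst.
have sB : smooth_on U (fun x => Bt (c0 x) (c1 x) : R^o).
  by apply: smoothD => //; apply: smoothM => //; apply: smoothX2.
have sE : smooth_on U (fun x => E (c0 x) (c1 x) (x ord0 2) (x ord0 3) : R^o).
  apply: smoothD => //; last by apply: smoothM => //; exact: smoothX2.
  apply: smoothD => //; apply: smoothM => //; first exact: smoothX2.
  by apply: smoothD => //; apply: smoothM => //; apply: smoothM => //; exact: smoothX2.
have sr : smooth_on U (r : R4 -> R^o).
  have E0 x := E_gt0 (c0 x) (c1 x) (x ord0 2) (x ord0 3).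
  apply: smoothV => // [x _|]; first by rewrite gt_eqF // sqrtr_gt0.
  exact: smooth_sqrt.
have sq : smooth_on U (q : R4 -> R^o).
  by apply: smooth_sqrt => // x /circle_coords; exact: Bt_gt0.
apply: rsmooth_stereo => //.
- by apply: smoothN => //; repeat (apply: smoothM => //).
- exact: smoothM.
- by repeat (apply: smoothM => //).
- exact: smoothM.
- by repeat (apply: smoothM => //).
- by move=> x /torus_param0_sphere[_ h]; rewrite gt_eqF.
Qed.

Lemma torus_gap0_stereo X1 X2 X3 X4 X5 :
  torus_gap0 (stereo X1 X2 X3 X4 X5) = (b1 ^+ 2 * X2 ^+ 2 + b2 ^+ 2 * X4 ^+ 2) / (1 + X5) ^+ 2.
Proof. by rewrite /torus_gap0 !quatE /= mulrDl !expr_div_n !mulrA. Qed.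

Lemma torus_param0_gap x : U x ->
  b1 ^+ 2 * (r x * c0 x) ^+ 2 + b2 ^+ 2 * (r x * c1 x) ^+ 2 = (r x * q x) ^+ 2.
Proof.
move=> Ux; have [_ _ q2 _] := torus_param0_facts Ux.
transitivity (r x ^+ 2 * Bt (c0 x) (c1 x)).
  by rewrite /Bt; move: (c0 x) (c1 x) (r x) => ? ? ?; ring.
by rewrite -q2; move: (q x) (r x) => ? ?; ring.
Qed.

Lemma torus_coord0K x : U x -> torus_coord0 (torus_param0 x) = circle_retract x.
Proof.
move=> Ux; have [r0 q0 q2 _] := torus_param0_facts Ux.
have [S y0] := torus_param0_sphere Ux.
have E1 : Num.sqrt (torus_w13 (torus_param0 x)) = r x / (1 + r x * q x * x ord0 3 / c).
  rewrite torus_w13_stereo circle_sum0 // -expr_div_n sqrtr_sqr.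
  by rewrite ger0_norm // divr_ge0 // ltW.
have E0 : torus_gap0 (torus_param0 x) = (r x * q x / (1 + r x * q x * x ord0 3 / c)) ^+ 2.
  by rewrite torus_gap0_stereo torus_param0_gap // -expr_div_n.
have E2 : Num.sqrt (torus_gap0 (torus_param0 x)) = r x * q x / (1 + r x * q x * x ord0 3 / c).
  by rewrite E0 sqrtr_sqr ger0_norm // divr_ge0 ?mulr_ge0 // ltW.
have y1 : 1 + r x * q x * x ord0 3 / c != 0 by rewrite gt_eqF.
rewrite /torus_coord0 E1 E2 E0 /circle_retract -/(c0 x) -/(c1 x).
rewrite [dot _ _]stereo_dot //.
have [a10 a20 r1 q1] : [/\ a1 != 0, a2 != 0, r x != 0 & q x != 0] by rewrite !gt_eqF.
have c0' := c_neq0_real.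
rewrite /torus_param0 /stereo.
move: y1 q2 r1 q1; rewrite /Bt.
move: (c0 x) (c1 x) (q x) (r x) => d0 d1 q' r' y1 q2 r1 q1.
apply: row4_ext; rewrite !quatE /=.
- by move: y1; move: (1 + _) => y y1; field; rewrite y1 r1.
- by move: y1; move: (1 + _) => y y1; field; rewrite y1 r1.
- transitivity (x ord0 2 * (b1 ^+ 2 * d0 ^+ 2 + b2 ^+ 2 * d1 ^+ 2) / q' ^+ 2).
    move: y1; move: (1 + _) => y y1.
    by field; rewrite ?y1 ?r1 ?a10 ?a20 ?q1.
  by rewrite -q2 mulfK // expf_neq0.
- have E3 : c * (r' * q' * x ord0 3 / c) = r' * q' * x ord0 3 by rewrite mulrC divfK.
  move: y1 E3; move: (r' * q' * x ord0 3 / c) => z y1 E3.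
  transitivity (c * z / (r' * q')); first by field; rewrite y1 r1 q1.
  by rewrite E3; field; rewrite r1 q1.
Qed.

Lemma torus_coord0_diff x : U x -> differentiable torus_coord0 (torus_param0 x).
Proof.
move=> Ux; have [r0 q0 q2 _] := torus_param0_facts Ux.
have [S y0] := torus_param0_sphere Ux.
pose W := [set w : R4 | 0 < torus_w13 w] `&` [set w | 0 < torus_gap0 w].
have cst0 V (a : R) : smooth_on V (fun=> a : R^o) by exact: smooth_cst.
have sx V i : smooth_on V (fun x : R4 => x ord0 i : R^o) by exact: smooth_coord.
have s13 V : open V -> smooth_on V (fun w => torus_w13 w : R^o).
  by move=> oV; apply: smoothD => //; apply: smoothM => //; exact: smooth_coord.
have sgap V : open V -> smooth_on V (fun w => torus_gap0 w : R^o).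
  by move=> oV; apply: smoothD => //; apply: smoothM => //; exact: smoothX2.
have oW : open W by apply: openI; apply: open_pos; [apply: s13|apply: sgap]; exact: openT.
have Wx : W (torus_param0 x).
  split=> /=; first by rewrite torus_w13_stereo circle_sum0 // divr_gt0 // exprn_gt0.
  by rewrite torus_gap0_stereo torus_param0_gap // divr_gt0 ?exprn_gt0 // mulr_gt0.
apply: (@rsmooth_diff _ W) => //.
apply: rsmooth_quat; split=> /=; apply: smoothM => //.
- by apply: smooth_sqrtV => // [|w []//]; exact: s13.
- by apply: smooth_sqrtV => // [|w []//]; exact: s13.
- by apply: smoothB => //; repeat (apply: smoothM => //).
- by apply: smoothV => // [w [_ /gt_eqF ->]//|]; exact: sgap.
- apply: smoothM => //; apply: smoothB => //.
  by apply: smooth_dot => //; exact: rsmooth_id.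
- by apply: smooth_sqrtV => // [|w []//]; exact: sgap.
Qed.

Lemma torus_param0_cut x : solid_torus x -> cut_set (torus_param0 x).
Proof.
move=> Tx; have Ux : U x by rewrite /U /= (solid_torus_circle Tx).
have [S y0] := torus_param0_sphere Ux; have [r0 q0 q2 _] := torus_param0_facts Ux.
have a10 : a1 != 0 by rewrite gt_eqF.
have a20 : a2 != 0 by rewrite gt_eqF.
have c0' := c_neq0_real.
apply/(cut_setP _ _ _ _ _ _ S y0); split.
  move: (c0 x) (c1 x) (q x) (r x) => ? ? ? ?.
  by field; rewrite a10 a20.
rewrite expr0n /= addr0 torus_param0_gap // -subr_ge0.
have -> : (r x * q x) ^+ 2 -
    (a1 ^+ 2 * (- (r x * b2 * c1 x * x ord0 2 / a1)) ^+ 2 + a2 ^+ 2 * (r x * b1 * c0 x * x ord0 2 / a2) ^+ 2 +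
     c ^+ 2 * (r x * q x * x ord0 3 / c) ^+ 2) = (r x * q x) ^+ 2 * (1 - (x ord0 2 ^+ 2 + x ord0 3 ^+ 2)).
  transitivity ((r x * q x) ^+ 2 - r x ^+ 2 * Bt (c0 x) (c1 x) * x ord0 2 ^+ 2 - (r x * q x) ^+ 2 * x ord0 3 ^+ 2).
    rewrite /Bt; move: (c0 x) (c1 x) (r x) (q x) => ? ? ? ?.
    by field; rewrite a10 a20 c0'.
  by rewrite -q2; move: (q x) (r x) => ? ?; ring.
by rewrite mulr_ge0 ?sqr_ge0 // subr_ge0; case: Tx.
Qed.

Lemma torus_param0_surj w : cut_set w -> exists2 x, solid_torus x & torus_param0 x = w.
Proof.
have [X1 [X2 [X3 [X4 [X5 [S y0 ->]]]]]] := stereo_surj w.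
move=> /(cut_setP _ _ _ _ _ _ S y0)[]; rewrite mulr0 mul0r cc1 mul1r expr0n /= addr0 => E1 E2.
have a10 : a1 != 0 by rewrite gt_eqF.
have a20 : a2 != 0 by rewrite gt_eqF.
have c0' := c_neq0_real.
have p1 : 0 <= a1 ^+ 2 * X1 ^+ 2 by rewrite mulr_ge0 ?sqr_ge0.
have p3 : 0 <= a2 ^+ 2 * X3 ^+ 2 by rewrite mulr_ge0 ?sqr_ge0.
(* If X2 = X4 = 0 then Q = 0, so P = 0, and all five coordinates on the sphere vanish. *)
have r0 : 0 < X2 ^+ 2 + X4 ^+ 2.
  rewrite lt_neqAle addr_ge0 ?sqr_ge0 // andbT eq_sym paddr_eq0 ?sqr_ge0 //.
  rewrite !sqrf_eq0; apply/negP => /andP[/eqP X20 /eqP X40].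
  move: E2; rewrite X20 X40 expr0n /= !mulr0 addr0 => E2.
  have p5 := sqr_ge0 X5.
  have [z1 z3 z5] : [/\ a1 ^+ 2 * X1 ^+ 2 = 0, a2 ^+ 2 * X3 ^+ 2 = 0 & X5 ^+ 2 = 0].
    move: p1 p3 p5 E2; move: (a1 ^+ 2 * X1 ^+ 2) (a2 ^+ 2 * X3 ^+ 2) (X5 ^+ 2) => ? ? ? ? ? ? ?.
    by split; apply/eqP; rewrite eq_le; apply/andP; split=> //; lra.
  move: S; rewrite X20 X40 z5.
  move/eqP: z1; rewrite mulf_eq0 expf_eq0 (negPf a10) /= => /eqP ->.
  move/eqP: z3; rewrite mulf_eq0 expf_eq0 (negPf a20) /= => /eqP ->.
  by rewrite expr0n /= !addr0 => /eqP; rewrite eq_sym oner_eq0.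
set rr := Num.sqrt (X2 ^+ 2 + X4 ^+ 2).
have rr0 : 0 < rr by rewrite sqrtr_gt0.
have rr2 : rr ^+ 2 = X2 ^+ 2 + X4 ^+ 2 by rewrite sqr_sqrtr // ltW.
have rr1 : rr != 0 by rewrite gt_eqF.
clearbody rr.
have x01 : (X2 / rr) ^+ 2 + (X4 / rr) ^+ 2 = 1.
  by rewrite !expr_div_n -mulrDl -rr2 divff // expf_neq0.
have B0 := Bt_gt0 x01.
set bb := Num.sqrt (Bt (X2 / rr) (X4 / rr)).
have bb0 : 0 < bb by rewrite sqrtr_gt0.
have bb2 : bb ^+ 2 = Bt (X2 / rr) (X4 / rr) by rewrite sqr_sqrtr // ltW.
have bb1 : bb != 0 by rewrite gt_eqF.
have rb2 : (rr * bb) ^+ 2 = b1 ^+ 2 * X2 ^+ 2 + b2 ^+ 2 * X4 ^+ 2.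
  by rewrite exprMn bb2 /Bt; field; rewrite rr1.
pose y2 := (b1 * a2 * X2 * X3 - b2 * a1 * X4 * X1) / (rr * bb) ^+ 2.
pose y3 := c * X5 / (rr * bb).
have rb0 : (rr * bb) ^+ 2 != 0 by rewrite expf_neq0 // mulf_neq0.
have Y2 : y2 * (rr * bb) ^+ 2 = b1 * a2 * X2 * X3 - b2 * a1 * X4 * X1 by rewrite divfK.
(* By orthogonality (a1 X1, a2 X3) is a multiple of (- b2 X4, b1 X2), and [y2] is the factor. *)
have F1 : a1 * X1 = - (b2 * X4 * y2).
  apply: (mulIf rb0); rewrite mulNr -(mulrA _ y2) Y2 rb2.
  apply/eqP; rewrite -subr_eq0; apply/eqP.
  transitivity (b1 * X2 * (a1 * b1 * X1 * X2 + a2 * b2 * X3 * X4)); first by ring.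
  by rewrite -E1 mulr0.
have F3 : a2 * X3 = b1 * X2 * y2.
  apply: (mulIf rb0); rewrite -(mulrA _ y2) Y2 rb2.
  apply/eqP; rewrite -subr_eq0; apply/eqP.
  transitivity (b2 * X4 * (a1 * b1 * X1 * X2 + a2 * b2 * X3 * X4)); first by ring.
  by rewrite -E1 mulr0.
have F5 : X5 = rr * bb * y3 / c by rewrite /y3; field; rewrite c0' rr1 bb1.
have G1 : X1 = - (b2 * X4 * y2) / a1 by rewrite -F1 mulrC mulKf.
have G3 : X3 = b1 * X2 * y2 / a2 by rewrite -F3 mulrC mulKf.
have F55 : X5 ^+ 2 = (rr * bb) ^+ 2 * y3 ^+ 2.
  by rewrite {1}F5 expr_div_n cc1 divr1 exprMn.
have x23 : y2 ^+ 2 + y3 ^+ 2 <= 1.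
  have rbp : 0 < (rr * bb) ^+ 2 by rewrite exprn_gt0 // mulr_gt0.
  rewrite -(ler_pM2l rbp) mulr1 [leRHS]rb2; apply: le_trans E2.
  rewrite -(exprMn _ a1) -(exprMn _ a2) F1 F3 F55.
  have -> : (- (b2 * X4 * y2)) ^+ 2 + (b1 * X2 * y2) ^+ 2 = (rr * bb) ^+ 2 * y2 ^+ 2.
    by rewrite rb2; ring.
  by rewrite mulrDr.
clear Y2; clearbody y2 y3.
pose x := quat ((X2 / rr) +i* (X4 / rr)) (y2 +i* y3).
have Tx : solid_torus x by split; rewrite !quatE.
have csq := solid_torus_circle Tx.
have c0E : c0 x = X2 / rr by rewrite /c0 csq sqrtr1 divr1 quatE.
have c1E : c1 x = X4 / rr by rewrite /c1 csq sqrtr1 divr1 quatE.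
have [x2 x3] : x ord0 2 = y2 /\ x ord0 3 = y3 by rewrite !quatE.
have rE : r x = rr.
  rewrite /r /Rr c0E c1E x2 x3; suff -> : E (X2 / rr) (X4 / rr) y2 y3 = (rr^-1) ^+ 2.
    by rewrite sqrtr_sqr ger0_norm ?invrK // ltW // invr_gt0.
  apply: (@mulfI _ (rr ^+ 2)); first by rewrite expf_neq0.
  rewrite -exprMn divff // expr1n -S.
  transitivity (rr ^+ 2 + X1 ^+ 2 + X3 ^+ 2 + X5 ^+ 2); last by rewrite rr2; ring.
  rewrite F55 G1 G3 (exprMn _ rr bb) bb2 /E /Bt.
  by field; rewrite a10 a20 rr1.
exists x => //; rewrite /torus_param0 /q rE c0E c1E x2 x3 -/bb /stereo -F5.
have y1 : 1 + X5 != 0 by rewrite gt_eqF.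
congr quat; congr (_ +i* _).
- by rewrite [in RHS]G1; field; rewrite ?a10 ?y1 ?rr1.
- by field; rewrite ?y1 ?rr1.
- by rewrite [in RHS]G3; field; rewrite ?a20 ?y1 ?rr1.
- by field; rewrite ?y1 ?rr1.
Qed.

Lemma embedded_torus_real (A0 : 'M[C]_4) (e f e' f' : 'rV[C]_4) (l m : R) (om : C) :
  normal_frame A0 e f e' f' l m om -> embedded_solid_torus (moebius e f @` cut_set).
Proof.
move=> nf; have TU : @solid_torus R `<=` U by move=> x Tx; rewrite /U /= (solid_torus_circle Tx).
rewrite (_ : cut_set = torus_param0 @` @solid_torus R).
  apply: (torus_embedding nf (@open_circle_sq R) TU) => //.
  - exact: rsmooth_torus_param0.
  - exact: torus_coord0_diff.
  - exact: torus_coord0K.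
apply/seteqP; split=> [w /torus_param0_surj[x]|w [x Tx <-]]; first by exists x.
exact: torus_param0_cut.
Qed.

End RealPhase.

(** * Twistor lines *)

Section TwistorLines.
Variable R : realType.
Local Notation C := R[i].
Local Notation R4 := 'rV[R]_4.
Implicit Types (v : 'rV[C]_4) (p q u w x : R4) (b : bool).
Local Notation J := (@rmulj R).
Local Notation qone := (qone R).
Local Notation qi := (qi R).
Local Notation qj := (qj R).

Lemma rmulj_cvec p q : J (cvec p q) = cvec (qmul p qj) (qmul q qj).
Proof.
by apply: row4_ext; rewrite rmuljE !cvecE ?(z1_qmul, z2_qmul) ?z1_quat ?z2_quat; ring.
Qed.

Lemma cvec_mulr p q u : cvec (qmul p u) (qmul q u) = z1 u *: cvec p q + z2 u *: J (cvec p q).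
Proof.
by rewrite rmulj_cvec; apply: row4_ext;
  rewrite !(cvecE, mxE) !(z1_qmul, z2_qmul) !(z1_quat, z2_quat) /=; ring.
Qed.

Lemma cvec_neq0 v : v != 0 -> qa v != 0 \/ qb v != 0.
Proof.
move=> v0; have [a0|] := eqVneq (qa v) 0; last by left.
have [b0|] := eqVneq (qb v) 0; last by right.
case/eqP: v0; rewrite -(cvec_ab v) a0 b0.
by apply: row4_ext; rewrite cvecE ?z1_0 ?z2_0 mxE.
Qed.

(** The fibre through v is the quaternionic line of v, so its points are v u with u a quaternion,
    and v u is a complex combination of v and vj. *)
Lemma twistor_line_span v : v != 0 -> exists P : S4 R, forall L : CP3 R, twistor_line P L ->
  exists c d : C, homog L = c *: v + d *: J v.
Proof.
move=> v0; pose a := qa v; pose b := qb v.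
suff [P H] : exists P : S4 R, forall L : CP3 R, twistor_line P L ->
    exists u, quat (xi0 L) (xi12 L) = qmul a u /\ quat (W1 L) (W2 L) = qmul b u.
  exists P => L /H[u [E1 E2]]; exists (z1 u), (z2 u).
  by rewrite homogE E1 E2 cvec_mulr cvec_ab.
have [a0|a0] := eqVneq a 0.
  have b0 : b != 0.
    by have [] := cvec_neq0 v0; rewrite -/a -/b // a0 eqxx.
  exists (infty R) => L; rewrite /twistor_line /= /twistor_proj.
  case: eqVneq => // -> _; exists (qmul (qinv b) (quat (W1 L) (W2 L))).
  by rewrite a0 qmul0l qmulVKl.
exists (pt (qmul b (qinv a))) => L; rewrite /twistor_line /= /twistor_proj.
case: eqVneq => // u0 [E]; exists (qmul (qinv a) (quat (xi0 L) (xi12 L))).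
by rewrite qmulVKl // qmulA -E qmulVKr.
Qed.

Lemma no_null_line (A : 'M[C]_4) : A^T = A ->
  (forall P : S4 R, ~ (twistor_line P `<=` quadric A)) ->
  forall v, v != 0 -> ~ [/\ bil A v v = 0, bil A v (J v) = 0 & bil A (J v) (J v) = 0].
Proof.
move=> symA nl v v0 [E1 E2 E3]; have [P H] := twistor_line_span v0.
apply: (nl P) => L /H[c [d E]]; rewrite /quadric /= bil_mx_eq0 E.
rewrite !(bilDl, bilDr symA) !(bilZl, bilZr symA) (bilC symA (J v) v) E1 E2 E3.
by rewrite !mulr0 !addr0.
Qed.

Lemma quadric_scale (A : 'M[C]_4) (k : C) : k != 0 -> quadric (k *: A) = quadric A.
Proof.
move=> k0; apply/seteqP; split=> L; rewrite /quadric /= -scalemxAr -scalemxAl.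
  by move/eqP; rewrite scaler_eq0 (negPf k0) /= => /eqP.
by move=> ->; rewrite scaler0.
Qed.

(** * The branch cut of a quadric in normal form *)

Section Frame.
Variables (A : 'M[C]_4) (e f e' f' : 'rV[C]_4) (l m : R) (om : C).
Hypothesis symA : A^T = A.
Hypothesis nf : normal_frame A e f e' f' l m om.
Let t := Num.sqrt (l / m).
Let s := Num.sqrt (l * m).
Let cut := cut_set ((t + t^-1) / 2) ((t - t^-1) / 2) ((s + s^-1) / 2) ((s - s^-1) / 2)
             (complex.Re om) (complex.Im om).

(** For z = x + i y, t conj(z) + z / t is (t + 1/t) x - i (t - 1/t) y, and om - conj(om) |w|^2
    splits likewise. These are the coordinates of P + iQ, so the real part of the discriminant is
    |P|^2 - |Q|^2 and its imaginary part is 2 P.Q. *)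
Lemma delta_cut : [set w | ~~ slit (delta l m om w)] = cut.
Proof.
have [t0 s0 _ _] := nf_sqrt nf; rewrite -/t -/s in t0 s0.
have t1 : t != 0 by rewrite gt_eqF.
have s1 : s != 0 by rewrite gt_eqF.
have RE w : complex.Re (delta l m om w) = - cut_gap ((t + t^-1) / 2) ((t - t^-1) / 2)
    ((s + s^-1) / 2) ((s - s^-1) / 2) (complex.Re om) (complex.Im om) w.
  rewrite /delta /sum_sq -/t -/s -!rcV !(cReD, cReM, cReN, cImD, cImM, cImN) !(cRe_conj, cIm_conj).
  rewrite /cut_gap /=.
  by field; rewrite t1 s1.
have IE w : complex.Im (delta l m om w) = 2 * cut_dot ((t + t^-1) / 2) ((t - t^-1) / 2)
    ((s + s^-1) / 2) ((s - s^-1) / 2) (complex.Re om) (complex.Im om) w.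
  rewrite /delta /sum_sq -/t -/s -!rcV !(cReD, cReM, cReN, cImD, cImM, cImN) !(cRe_conj, cIm_conj).
  rewrite /cut_dot /=.
  by field; rewrite t1 s1.
apply/seteqP; split=> w; rewrite /cut /cut_set /= /slit RE IE negb_or negbK -leNgt oppr_le0.
  by move=> /andP[/eqP/eqP]; rewrite mulf_eq0 pnatr_eq0 /= => /eqP.
by move=> [-> ->]; rewrite mulr0 eqxx.
Qed.

(** Provides a point off the cut, at which the two structures can be told apart. *)
Lemma slit_delta0 : slit (delta l m om 0).
Proof.
have D0 : dot (0 : R4) 0 = 0 by rewrite dotE !mxE; ring.
have -> : delta l m om 0 = om * om.
  rewrite /delta /sum_sq D0 z1_0 z2_0 conjc0 (rmorph0 (real_complex R)) (rmorph1 (real_complex R)).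
  by ring.
exact: slit_sqr (nf_re nf).
Qed.

Lemma not_cut_moebius0 : (~` branch_cut A) (moebius e f 0).
Proof.
have [b d0] : exists b, chart_den e f b 0 != 0.
  by have [H0|H0] := num_neq0 nf 0; [exists false|exists true].
have [h0 E] := wcoord_mcoord nf d0.
rewrite (moebius_chart d0) /branch_cut /= (slit_chart symA) (slit_disc nf) E slit_delta0.
by rewrite orbT.
Qed.

Hypothesis no_null : forall v, v != 0 ->
  ~ [/\ bil A v v = 0, bil A v (J v) = 0 & bil A (J v) (J v) = 0].

(** For real om, the degenerate values t = 1 and s = 1 make two diagonal coefficients equal in
    pairs, and an explicit quaternionic line h2 = q h1 is then null. *)
Lemma real_phase : complex.Im om = 0 -> t != 1 /\ s != 1.
Proof.
have [t0 s0] := nf_sqrt nf; rewrite -/t -/s in t0 s0 * => El Em om0.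
have omc : conjc om = om by apply: complex_ext; [exact: cRe_conj|rewrite cIm_conj om0 oppr0].
have K q : [/\ diag_form l m om qone q qone q = 0,
    diag_form l m om qone q qj (qmul q qj) = 0 &
    diag_form l m om qj (qmul q qj) qj (qmul q qj) = 0] -> False.
  move=> [F1 F2 F3]; apply: (no_null (v := cvec qone q *m basis_mx e f)).
    apply/eqP => Z; have : cvec qone q = 0 by rewrite -[LHS]mulmx1 -(nf_right nf) mulmxA Z mul0mx.
    by move=> /(congr1 (fun v : 'rV[C]_4 => v ord0 0)); rewrite cvecE mxE z1_quat => /eqP; rewrite oner_eq0.
  by rewrite rmulj_mul_basis rmulj_cvec qmul1l !(nf_form nf).
have ii0 : ii R * conjc (ii R) = 1 by rewrite conj_ii mulrN ii_sqr opprK.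
split; apply/eqP => E1.
  (* At t = 1 we have l = m, and q = i works since 1 + i^2 = 0 in both pairs of coordinates. *)
  apply: (K qi); rewrite /diag_form El Em E1 omc !(z1_qmul, z2_qmul) !(z1_quat, z2_quat).
  rewrite ?conj_ii ?conjc0 ?conjc1 mulr1 divr1.
  move: (ii_sqr R) (real_complex R s) (real_complex R s)^-1; move: (ii R) => I I2 S S'.
  by split; ring: I2.
(* At s = 1 we have l = 1 / m, so the equal coefficients are paired crosswise and q = j i is
   used. *)
apply: (K (quat 0 (ii R))); rewrite /diag_form El Em E1 omc !(z1_qmul, z2_qmul) !(z1_quat, z2_quat).
rewrite ?conj_ii ?conjc0 ?conjc1 mul1r div1r rcV invrK.
move: (ii_sqr R) (real_complex R t) (real_complex R t)^-1; move: (ii R) => I I2 S S'.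
by split; ring: I2.
Qed.

Lemma embedded_branch_cut : embedded_solid_torus (branch_cut A).
Proof.
rewrite (branch_cut_moebius symA nf) delta_cut.
have [t0 s0 _ _] := nf_sqrt nf; rewrite -/t -/s in t0 s0.
have pos (y : R) : 0 < y -> 0 < (y + y^-1) / 2 by move=> y0; rewrite divr_gt0 // addr_gt0 // invr_gt0.
have hyp (y : R) : 0 < y -> ((y + y^-1) / 2) ^+ 2 = 1 + ((y - y^-1) / 2) ^+ 2.
  by move=> y0; field; rewrite gt_eqF.
have om1 : complex.Re om ^+ 2 + complex.Im om ^+ 2 = 1.
  have := congr1 (@complex.Re R) (nf_om nf); rewrite cReM cRe_conj cIm_conj /= => <-.
  by ring.
have [om0|om0] := eqVneq (complex.Im om) 0; last first.
  exact: (embedded_torus_general (pos _ t0) (pos _ s0) (hyp _ t0) (hyp _ s0) om1 (nf_re nf) om0 nf).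
have [t1 s1] := real_phase om0.
have nz (y : R) : 0 < y -> y != 1 -> (y - y^-1) / 2 != 0.
  move=> y0 y1; rewrite mulf_neq0 ?invr_eq0 ?pnatr_eq0 // subr_eq0; apply: contra y1 => /eqP H.
  have : y * y = 1 by rewrite {2}H divff // gt_eqF.
  move/eqP; rewrite -expr2 sqrf_eq1 => /orP[//|/eqP H2].
  by exfalso; lra.
move: om1; rewrite om0 expr0n /= addr0 => om1.
rewrite /cut om0.
exact: (embedded_torus_real (pos _ t0) (pos _ s0) (nz _ t0 t1) (nz _ s0 s1) om1 nf).
Qed.

End Frame.
End TwistorLines.

Theorem theorem1p13 (R : realType) (Q : set (CP3 R)) :
  nonsingular_quadric Q ->
  (forall p : S4 R, ~ (twistor_line p `<=` Q)) ->
  exists T : set (S4 R),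
    embedded_solid_torus T /\
    exists J1 J2 : S4 R -> 'M[R]_4,
      [/\ OCS (~` T) J1,
          OCS (~` T) J2,
          (exists p : S4 R, (~` T) p /\ J1 p <> J2 p) &
          Q `&` @twistor_proj R @^-1` (~` T) = graph (~` T) J1 `|` graph (~` T) J2].
Proof.
move=> [A [symA detA ->]] nl.
have [k [e [f [e' [f' [l [m [om [k0 nf]]]]]]]]] := exists_normal_frame symA detA (no_null_line symA nl).
have symB : (k *: A)^T = k *: A by rewrite linearZ /= symA.
(* The scalar leaves the quadric unchanged but rotates its discriminant; the cut is the one of the
   rescaled matrix. *)
rewrite -(quadric_scale A k0) in nl *.
exists (branch_cut (k *: A)); split; first exact: embedded_branch_cut symB nf (no_null_line symB nl).
exists (Jglob (k *: A) false), (Jglob (k *: A) true); split.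
- exact: Jglob_OCS.
- exact: Jglob_OCS.
- have H := not_cut_moebius0 symB nf.
  by exists (moebius e f 0); split=> //; exact: Jglob_neq.
- exact: graph_Jglob.
Qed.
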